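(* Let $n,d>0$ be fixed integers. Put $n_0=n$ and, for $i\ge 0$, $g_i=\gcd(n_i,d)$ and $n_{i+1}=n_i/g_i$. Let $k\ge 0$ be the smallest integer with $g_k=1$, and let $m=n_k$ (so $\gcd(m,d)=1$ and $n_{k+1}=m$). For $v\in\mathbb{Z}_m$ let $O(v)=\{v,dv,d^2v,\ldots\}\subseteq\mathbb{Z}_m$ be the orbit of $v$ under the permutation $x\mapsto dx$ of $\mathbb{Z}_m$, and let $o(v)=|O(v)|$. For a prime $p\mid m$ let $\pi_p(m)$ be the largest power of $p$ dividing $m$. Let $V$ be a complete set of representatives of the orbits $O(v)$ different from $\{0\}$, chosen so that for every prime divisor $p$ of $m$ all integers of the form $m/p^j$ with $j\ge 1$ and $p^j\mid m$ (viewed in $\mathbb{Z}_m$) belong to $V$. Then the sand dune group $\Sigma(n,d)$ and the sandpile group (equivalently, critical group) $S(n,d)$ of the generalized de Bruijn graph $\mathrm{DB}(n,d)$ satisfy $$\Sigma(n,d)\cong \Bigl[\bigoplus_{i=0}^{k-1}\mathbb{Z}_{d^{i+1}}^{\,n_i-2n_{i+1}+n_{i+2}}\Bigr]\oplus\Bigl[\bigoplus_{v\in V}\mathbb{Z}_{d^{o(v)}-1}\Bigr]$$ and $$S(n,d)\cong \Bigl[\bigoplus_{i=0}^{k-1}\Bigl(\mathbb{Z}_{d^{i+1}/g_i}\oplus\mathbb{Z}_{d^{i+1}}^{\,n_i-2n_{i+1}+n_{i+2}-1}\Bigr)\Bigr]\oplus\Bigl[\bigoplus_{v\in V}\mathbb{Z}_{(d^{o(v)}-1)/c(v)}\Bigr],$$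 where $c(v)=1$ except in the following cases. For any prime $p\mid m$, $$c(m/\pi_p(m))=\begin{cases}\pi_p(m), & \text{if } p\ne 2 \text{ or } d\equiv 1 \bmod 4 \text{ or } 4\nmid m,\\ \pi_2(m)/2, & \text{if } p=2 \text{ and } d\equiv 3\bmod 4 \text{ and } 4\mid m,\end{cases}$$ and if $4\mid m$ and $d\equiv 3\bmod 4$, then $c(m/2)=2$.
   Context: $\mathbb{Z}_r$ denotes the cyclic group (ring) of integers modulo $r$; empty direct sums are trivial. The generalized de Bruijn graph $\mathrm{DB}(n,d)$ is the directed multigraph with vertex set $\mathbb{Z}_n$ and directed edges $v\to dv+i$ for $i=0,\ldots,d-1$ and all $v\in\mathbb{Z}_n$ (counted with multiplicity, loops allowed). For a directed multigraph $G$ on $n$ vertices, the adjacency matrix $A$ has entry $A_{v,w}$ equal to the number of edges from $v$ to $w$; the Laplacian is $\Delta=D-A$ with $D$ diagonal and $D_{v,v}$ the indegree of $v$. The critical group of $G$ is the finite part (torsion subgroup) of $\mathbb{Z}^n/R$, where $R$ is the $\mathbb{Z}$-span of the rows of $\Delta$. The sandpile group of $G$ at $v$ is the finite part of the analogous quotient of $\mathbb{Z}^{n-1}$ for the reduced Laplacian, obtained from $\Delta$ by deleting the row and column indexed by $v$; for Eulerian $G$ (indegree equals outdegree at every vertex, as is the case for $\mathrm{DB}(n,d)$) it does not depend on $v$ and equals the critical group. Let $\mathcal{Z}_n=\{a(x)\in\mathbb{Z}[x]/(x^n-1) : a(1)=0\}$. With $f_v(x)=d x^v-x^{dv}\sum_{i=0}^{d-1}x^i$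 (the polynomial associated with row $v$ of the Laplacian of $\mathrm{DB}(n,d)$), the critical group is written as $S(n,d)=\mathcal{Z}_n/\langle f_v : v\in\mathbb{Z}_n\setminus\{0\}\rangle_{\mathbb{Z}}$. The sand dune group of $\mathrm{DB}(n,d)$ is $\Sigma(n,d)=\mathcal{Z}_n/\langle g_v : v\in\mathbb{Z}_n\setminus\{0\}\rangle_{\mathbb{Z}}$ with $g_v(x)=(x-1)f_v(x)$. Equivalently, writing $e_v=x^v-1$ for $v\in\mathbb{Z}_n$ (so $e_0=0$ and $\mathcal{Z}_n$ is the $\mathbb{Z}$-span of the $e_v$ with $v\neq 0$), $\Sigma(n,d)=\mathcal{Z}_n/\langle d e_v-e_{dv} : v\in\mathbb{Z}_n\setminus\{0\}\rangle_{\mathbb{Z}}$.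
   Formalization: The formula for S(n,d) is proved for all n,d>0 for the quotient defining S(n,d); for the critical and sandpile groups of the graph (finite parts) d>1 is assumed, since for d=1, n>1 they are trivial while the right-hand side is Z^(n-1). *)

(* Defs.v *)
From HB Require Import structures.
From mathcomp Require Import all_boot all_order all_algebra.
From mathcomp Require Import ring_quotient qpoly.
From mathcomp Require Import boolp.

Set Implicit Arguments.
Unset Strict Implicit.
Unset Printing Implicit Defensive.

Import GRing.Theory Num.Theory.
Import Pdiv.Ring Pdiv.RingMonic.
Local Open Scope ring_scope.

Definition zisog (A B : zmodType) : Prop :=
  exists f : {additive A -> B}, bijective f.

Section Span.
Variables (A : zmodType) (s : seq A).

(* Quotient.quot needs a boolean predicate, hence the classical truth value. *)
Definition zspan : pred A := fun a => `[< inIntSpan (in_tuple s) a >].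

Fact zspan_zmod_closed : zmod_closed zspan.
Proof.
split=> [|a b /asboolP[x ->] /asboolP[y ->]]; apply/asboolP.
  by exists [ffun=> 0]; rewrite big1 // => i _; rewrite ffunE mulr0z.
exists [ffun i => x i - y i]; rewrite -sumrB.
by apply: eq_bigr => i _; rewrite ffunE mulrzBr.
Qed.

HB.instance Definition _ := GRing.isZmodClosed.Build A zspan zspan_zmod_closed.
End Span.

Definition zquot (A : zmodType) (s : seq A) : zmodType :=
  @Quotient.quot A (GRing.ZmodClosed.clone A (zspan s) _).

Section Torsion.
Variable A : zmodType.

Definition is_torsion : pred A :=
  fun a => `[< exists2 k : nat, (0 < k)%N & a *+ k = 0 >].

Fact is_torsion_zmod_closed : zmod_closed is_torsion.
Proof.
split=> [|a b /asboolP[j j0 aj] /asboolP[k k0 bk]]; apply/asboolP.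
  by exists 1%N.
exists (j * k)%N; first by rewrite muln_gt0 j0.
by rewrite mulrnBl mulrnA aj mul0rn mulnC mulrnA bk mul0rn subr0.
Qed.

HB.instance Definition _ :=
  GRing.isZmodClosed.Build A is_torsion is_torsion_zmod_closed.

Record torsion : predArgType :=
  Torsion { torsion_val :> A; _ : torsion_val \in is_torsion }.

HB.instance Definition _ := [isSub for torsion_val].
HB.instance Definition _ := [Choice of torsion by <:].
HB.instance Definition _ := [SubChoice_isSubZmodule of torsion by <:].
End Torsion.

(* Z/rZ for every r; in particular Z/0Z is Z and Z/1Z is trivial,
   unlike the library's 'Z_r. *)
Definition cyc (r : nat) : zmodType :=
  @Quotient.quot int (GRing.ZmodClosed.clone int (dvdz r%:Z) _).

Fixpoint dsum_cyc (s : seq nat) : zmodType :=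
  if s is r :: s' then (cyc r * dsum_cyc s')%type else 'I_1.

(* Directed multigraphs on 'I_n, loops allowed. *)
Record digraph (n : nat) := Digraph {
  edge : finType;
  src : edge -> 'I_n;
  tgt : edge -> 'I_n }.

Section Graph.
Variables (n : nat) (G : digraph n).

Definition indeg (v : 'I_n) : nat := #|[set e : edge G | tgt e == v]|.

Definition adjmx : 'M[int]_n :=
  \matrix_(v, w) #|[set e : edge G | (src e == v) && (tgt e == w)]|%:Z.

Definition laplacian : 'M[int]_n :=
  diag_mx (\row_v (indeg v)%:Z) - adjmx.

Definition coker_rows p q (M : 'M[int]_(p, q)) : zmodType :=
  zquot [seq row i M | i <- enum 'I_p].

Definition critical_group : zmodType := torsion (coker_rows laplacian).

Definition sandpile_group (v : 'I_n) : zmodType :=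
  torsion (coker_rows (row' v (col' v laplacian))).
End Graph.

(* Residues modulo n are the elements of 'I_n. *)
Definition affine_mod n (d i : nat) (v : 'I_n) : 'I_n :=
  Ordinal (ltn_pmod (d * v + i) (leq_ltn_trans (leq0n v) (ltn_ord v))).

Definition deBruijn (n d : nat) : digraph n :=
  @Digraph n ('I_n * 'I_d)%type (fun e => e.1) (fun e => affine_mod d e.2 e.1).

Definition cycpoly (n : nat) := {poly %/ ('X^n - 1 : {poly int})}.
HB.instance Definition _ n := GRing.ComNzRing.on (cycpoly n).

Section Augmentation.
Variable n : nat.

(* a(1) is evaluated on the representative of degree < n; by at1_in_qpoly
   it does not depend on the representative. *)
Definition at1 (a : cycpoly n) : int := (a : {poly int}).[1].

Lemma at1_in_qpoly (p : {poly int}) :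
  (0 < n)%N -> at1 (in_qpoly ('X^n - 1) p) = p.[1].
Proof.
move=> n_gt0; rewrite /at1 /=.
have -> : mk_monic ('X^n - 1 : {poly int}) = 'X^n - 1.
  by rewrite /mk_monic size_XnsubC // ltnS n_gt0 monicXnsubC.
rewrite [in RHS](rdivp_eq (monicXnsubC 1 n_gt0) p) hornerD hornerM.
by rewrite !hornerE expr1n subrr mulr0 add0r.
Qed.

Definition aug : pred (cycpoly n) := fun a => at1 a == 0.

Fact aug_zmod_closed : zmod_closed aug.
Proof.
split=> [|a b]; rewrite !unfold_in /at1 ?horner0 // => /eqP a1 /eqP b1.
by rewrite /= hornerD hornerN a1 b1 subrr.
Qed.

HB.instance Definition _ :=
  GRing.isZmodClosed.Build (cycpoly n) aug aug_zmod_closed.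

Record augideal : predArgType :=
  AugIdeal { augideal_val :> cycpoly n; _ : augideal_val \in aug }.

HB.instance Definition _ := [isSub for augideal_val].
HB.instance Definition _ := [Choice of augideal by <:].
HB.instance Definition _ := [SubChoice_isSubZmodule of augideal by <:].

Variable d : nat.

Definition fpoly (v : 'I_n) : cycpoly n :=
  in_qpoly ('X^n - 1) (d%:R *: 'X^v - 'X^(d * v) * \sum_(i < d) 'X^i).

Definition gpoly (v : 'I_n) : cycpoly n :=
  in_qpoly ('X^n - 1) ('X - 1) * fpoly v.

Fact fpoly_aug v : fpoly v \in aug.
Proof.
rewrite unfold_in at1_in_qpoly ?(leq_ltn_trans _ (ltn_ord v)) //.
rewrite !hornerE expr1n horner_sum (eq_bigr (fun=> 1)) => [|i _].
  by rewrite sumr_const card_ord expr1n mul1r mulr1 subrr.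
by rewrite hornerXn expr1n.
Qed.

Fact gpoly_aug v : gpoly v \in aug.
Proof.
rewrite unfold_in /gpoly -rmorphM at1_in_qpoly.
  by rewrite hornerM !hornerE.
exact: leq_ltn_trans (ltn_ord v).
Qed.

Definition Sgroup : zmodType :=
  zquot [seq AugIdeal (fpoly_aug v) | v <- enum 'I_n & val v != 0%N].

Definition sand_dune : zmodType :=
  zquot [seq AugIdeal (gpoly_aug v) | v <- enum 'I_n & val v != 0%N].

End Augmentation.

(* nquo n d i is n_i: n_0 = n and n_(i+1) = n_i / gcd(n_i, d). *)
Fixpoint nquo (n d i : nat) : nat :=
  if i is j.+1 then (nquo n d j %/ gcdn (nquo n d j) d)%N else n.

Section Orbits.
Variables (m d : nat).

Definition mulmod : 'I_m -> 'I_m := affine_mod d 0.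

(* fingraph's [orbit f v] lists v, f v, f (f v), ... without repetition. *)
Definition orb (v : 'I_m) : {set 'I_m} := [set w in orbit mulmod v].

Definition nonzero_orbits : {set {set 'I_m}} :=
  [set orb v | v : 'I_m] :\ [set v : 'I_m | val v == 0%N].

(* m`_p is the largest power of p dividing m. The cases are disjoint: at most one
   prime p satisfies v = m / m`_p, and none does if v = m / 2 and 4 %| m. *)
Definition cfactor (v : nat) : nat :=
  if [&& 4 %| m, d %% 4 == 3 & v == m %/ 2]%N then 2%N
  else if [seq p : nat <- primes m | v == m %/ m`_p]%N is p :: _ then
    if [|| p != 2, d %% 4 == 1 | ~~ (4 %| m)]%N then (m`_p)%N else (m`_2 %/ 2)%N
  else 1%N.
End Orbits.

(* In the exponents below the subtractions never truncate: for i < k,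
   n_i - 2 n_(i+1) + n_(i+2) >= n_(i+2) > 0, since gcd(n_i, d) >= 2.
   The divisions are exact. *)
Definition sand_dune_moduli (n d k : nat) (V : {set 'I_(nquo n d k)}) : seq nat :=
  (flatten [seq nseq (nquo n d i + nquo n d i.+2 - 2 * nquo n d i.+1)
                     (d ^ i.+1) | i <- iota 0 k]
   ++ [seq d ^ #|orb d v| - 1 | v <- enum V])%N.

Definition sandpile_moduli (n d k : nat) (V : {set 'I_(nquo n d k)}) : seq nat :=
  (flatten [seq d ^ i.+1 %/ gcdn (nquo n d i) d
              :: nseq (nquo n d i + nquo n d i.+2 - 2 * nquo n d i.+1 - 1)
                      (d ^ i.+1) | i <- iota 0 k]
   ++ [seq (d ^ #|orb d v| - 1) %/ cfactor (nquo n d k) d v | v <- enum V])%N.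

(* Main.v *)
Require Import Defs.
From HB Require Import structures.
From mathcomp Require Import all_boot all_order all_algebra.
From mathcomp Require Import cyclic zify ring.
From mathcomp Require Import boolp.

(** Write the vertex [v] as the monomial [X^v]. The relations of the sand dune
    group say that [X^(d v)] is [d] times [X^v], so that [Sigma(n, d)] is
    [Z[X]] modulo the lattice [sand_rel n d] spanned by the multiples of
    [X^n - 1], the constants, and the polynomials [d c - c(X^d)].
    Multiplication by [X - 1] embeds [S(n, d)] into [Sigma(n, d)], and its
    image is the kernel of [p |-> p'(1)] modulo [n], the map [phi] sending
    the vertex [v] to the integer [v] ([sand_rel_mulX1], [mul_aug_phi],
    [mul_aug_surj]). Both groups are thus read off from one lattice of
    polynomials, and a cyclic decomposition is a finite family of
    polynomials with prescribed orders ([cyclic_family]).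

    The generators are built by going from the modulus [n1 = n / gcd(n, d)] up
    to [n], keeping the same polynomials. Two facts drive this step: modulo
    [sand_rel n d] the product [d p] is [p(X^d)], and [p(X^d)] is a relation for
    [n] exactly when [p] is one for [n1] ([sand_rel_comp], [sand_rel_comp_inj]).
    So a generator of order [r] for [n1] has order [d r] for [n], except
    that the generators attached to periodic vertices keep theirs. Vertices that
    agree modulo [n1] have the same successors, whence their differences are
    killed by [d]; choosing one base vertex in each class, the differences
    [X^v - X^(base v)] over the [n - 2 n1 + n2] vertices [v] outside the image of
    multiplication by [d] that are not bases are the new generators, of order
    [d] ([step_family]). At the bottom of this tower the modulus [m] is prime to
    [d], multiplication by [d] permutes [Z_m], and each orbit [O(v)] gives one
    generator of order [d^o(v) - 1] ([per_family]).

    For the kernel of [phi] each generator [b_j] is replaced by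
    [u_j = c_j b_j - w_j], where [w_j] is a combination of the earlier generators
    with the value of [c_j b_j] under [phi], and is killed by [r_j / c_j]. The [u_j]
    are independent, of orders [r_j / c_j]; they generate the whole kernel as
    soon as the product of the [c_j] is [n], by comparison of indices
    ([triangular_kernel]). At each step of the tower [c_j] is the gcd for one
    leaf at distance [n1] from its base, where [phi] is [n1], and is [1] for the
    other new generators. At the bottom it is [c(v)], and what has to be found is a
    combination [w_v] of the special generators, those of [m / pi_p(m)] (and of
    [m / 2] in the exceptional case), that has the value of the generator of [v]
    and order dividing [d^o(v) - 1]. It is found one prime at a time: with
    [e = d^o(v)], the integer [(e - 1) v] vanishes modulo [pi_p(m)], and the sum
    of the first [p^f] powers of [e] has exact valuation [f]
    ([geometric_solution]). This valuation fails for [p = 2] and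
    [e = 3 mod 4], which is why [m / 2] is needed when [d = 3 mod 4]
    and [4] divides [m]. *)

Set Implicit Arguments.
Unset Strict Implicit.
Unset Printing Implicit Defensive.

Import GRing.Theory Num.Theory.
Local Open Scope ring_scope.

(** * Cyclic decompositions of abelian groups *)

Local Open Scope quotient_scope.

Section Isomorphisms.

Fact zmod_morphism_zisog (A B : zmodType) (f : A -> B) :
  zmod_morphism f -> bijective f -> zisog A B.
Proof.
move=> fB fbij; pose F := GRing.isZmodMorphism.Build A B f fB.
by exists (HB.pack_for {additive A -> B} f F).
Qed.

Lemma zisog_sym (A B : zmodType) : zisog A B -> zisog B A.
Proof.
case=> f [g fK gK]; apply: (@zmod_morphism_zisog B A g); last by exists f.
by move=> x y; apply: (can_inj fK); rewrite raddfB !gK.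
Qed.

Lemma zisog_trans (A B C : zmodType) : zisog A B -> zisog B C -> zisog A C.
Proof.
case=> f fbij [g gbij]; apply: (@zmod_morphism_zisog A C (g \o f)).
  by move=> x y; rewrite /= !raddfB.
exact: bij_comp.
Qed.

End Isomorphisms.

Section Span.
Variables (A : zmodType) (s : seq A).

Lemma mem_zspan t : t \in s -> t \in zspan s.
Proof.
move=> ts; have lt_ts : (index t s < size s)%N by rewrite index_mem.
apply/asboolP; exists [ffun i => (i == Ordinal lt_ts)%:R].
rewrite (bigD1 (Ordinal lt_ts)) //= ffunE eqxx nth_index //.
by rewrite big1 ?addr0 // => i /negPf ne; rewrite ffunE ne mulr0z.
Qed.

Lemma zspan_sub (P : zmodClosed A) :
  {subset s <= P} -> {subset zspan s <= P}.
Proof.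
move=> sP a /asboolP[x ->]; apply: rpred_sum => i _; rewrite rpredMz //.
by apply: sP; apply: mem_nth.
Qed.

End Span.

(** The subgroup [G] is, modulo [R], the internal direct sum of the cyclic
    groups generated by the [b j] with [j] in [l], of orders [r j] (order [0]
    meaning infinite order). Naming the generators, instead of asserting an
    isomorphism, is what lets them be reused for other relations [R]. *)
Record cyclic_family (A : zmodType) (R : {pred A}) (G : A -> Prop)
    (J : eqType) (l : seq J) (b : J -> A) (r : J -> nat) : Prop := {
  cf_uniq : uniq l;
  cf_in : forall j, j \in l -> G (b j);
  cf_rel : forall j, j \in l -> b j *+ r j \in R;
  cf_indep : forall x : J -> int, \sum_(j <- l) b j *~ x j \in R ->
    forall j, j \in l -> ((r j)%:Z %| x j)%Z;
  cf_gen : forall a, G a ->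
    exists x : J -> int, a - \sum_(j <- l) b j *~ x j \in R }.

Lemma quot_piP (A : zmodType) (R : zmodClosed A) (a c : A) :
  reflect (\pi_(Quotient.quot R) a = \pi_(Quotient.quot R) c) (a - c \in R).
Proof. by rewrite Quotient.idealrBE; apply: eqP. Qed.

Lemma cyc_piP (m : nat) (x y : int) :
  reflect (\pi_(cyc m) x = \pi_(cyc m) y) (m%:Z %| x - y)%Z.
Proof. exact: (@quot_piP _ (GRing.ZmodClosed.clone int (dvdz m%:Z) _)). Qed.

Section QuotientByFamily.
Variables (A : zmodType) (R : zmodClosed A) (J : eqType).
Variables (b : J -> A) (r : J -> nat).

Lemma rpredMz_dvd (a : A) (m : nat) (x : int) :
  a *+ m \in R -> (m%:Z %| x)%Z -> a *~ x \in R.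
Proof.
by move=> aR /dvdzP[q ->]; rewrite mulrC mulrzA -pmulrn rpredMz.
Qed.

(** The evaluation map from the external direct sum, computed on arbitrary
    integer representatives; it is additive because [r j] kills [b j]. *)
Fixpoint family_map (l : seq J) :
    dsum_cyc [seq r j | j <- l] -> Quotient.quot R :=
  match l return dsum_cyc [seq r j | j <- l] -> Quotient.quot R with
  | [::] => fun=> 0
  | j :: l' => fun y : (cyc (r j) * dsum_cyc [seq r i | i <- l'])%type =>
      \pi_(Quotient.quot R) (b j *~ repr y.1) + @family_map l' y.2
  end.

Lemma repr_cycB (m : nat) (x y : cyc m) :
  (m%:Z %| repr (x - y) - (repr x - repr y))%Z.
Proof. by apply/cyc_piP; rewrite raddfB /= !reprK. Qed.

Lemma repr_cyc_eq0 (m : nat) (x : cyc m) : (m%:Z %| repr x)%Z -> x = 0.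
Proof.
by rewrite -[repr x]subr0 => /cyc_piP; rewrite reprK raddf0.
Qed.

Lemma repr_cyc_pi (m : nat) (x : int) :
  (m%:Z %| x - repr (\pi_(cyc m) x))%Z.
Proof. by apply/cyc_piP; rewrite reprK. Qed.

Lemma family_map_morphism l : (forall j, j \in l -> b j *+ r j \in R) ->
  zmod_morphism (@family_map l).
Proof.
elim: l => [|j l IHl] bR x y /=; first by rewrite subr0.
rewrite IHl => [|i il]; last by rewrite bR // inE il orbT.
rewrite opprD addrACA; congr (_ + _).
rewrite /= -[RHS](raddfB \pi_(Quotient.quot R)); apply/quot_piP; rewrite -!mulrzBr.
apply: rpredMz_dvd (repr_cycB _ _); by rewrite bR // mem_head.
Qed.

Lemma family_map_sum l y : uniq l -> exists x : J -> int,
  @family_map l y = \pi_(Quotient.quot R) (\sum_(j <- l) b j *~ x j) /\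
  ((forall j, j \in l -> ((r j)%:Z %| x j)%Z) -> y = 0).
Proof.
elim: l y => [|j l IHl].
  by move=> y _; exists (fun=> 0); rewrite big_nil raddf0; split=> // _; apply: ord1.
case=> y1 y2 /= /andP[jl /(IHl y2)[x [-> x0]]].
exists (fun i => if i == j then repr y1 else x i).
have eq_x i : i \in l -> (if i == j then repr y1 else x i) = x i.
  by move=> il; case: eqP => // eq_ij; rewrite -eq_ij il in jl.
rewrite big_cons eqxx (raddfD \pi_(Quotient.quot R)) /=; split.
  congr (_ + \pi_(Quotient.quot R) _); rewrite !big_seq; apply: eq_bigr => i il.
  by rewrite eq_x.
move=> rx; have -> : y1 = 0.
  by apply: repr_cyc_eq0; have := rx j (mem_head _ _); rewrite eqxx.
have -> // : y2 = 0.
by apply: x0 => i il; rewrite -eq_x // rx // inE il orbT.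
Qed.

Lemma family_map_surj l (x : J -> int) :
  (forall j, j \in l -> b j *+ r j \in R) ->
  exists y, @family_map l y = \pi_(Quotient.quot R) (\sum_(j <- l) b j *~ x j).
Proof.
elim: l => [|j l IHl] bR /=; first by exists 0; rewrite big_nil raddf0.
have [|y yE] := IHl; first by move=> i il; rewrite bR // inE il orbT.
exists (\pi_(cyc (r j)) (x j), y) => /=; rewrite yE big_cons (raddfD \pi_(Quotient.quot R)) /=.
congr (_ + _); apply/quot_piP; rewrite -mulrzBr -opprB mulrNz rpredN.
by apply: rpredMz_dvd (repr_cyc_pi _ _); rewrite bR // mem_head.
Qed.

Lemma cyclic_family_quot l : cyclic_family R (fun=> True) l b r ->
  zisog (Quotient.quot R) (dsum_cyc [seq r j | j <- l]).
Proof.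
case=> l_uniq _ bR indep gen; apply: zisog_sym.
have fB := family_map_morphism bR.
have f_inj : injective (@family_map l).
  move=> y z /(congr1 (fun t => t - family_map z)); rewrite subrr -fB.
  have [x [-> x0]] := family_map_sum (y - z) l_uniq => /eqP.
  rewrite -(raddf0 \pi_(Quotient.quot R)) => /eqP/quot_piP; rewrite subr0.
  by move/indep/x0/subr0_eq.
apply: zmod_morphism_zisog fB _.
have f_surj q : exists y, @family_map l y = q.
  have [x xE] := gen (repr q) I.
  have [y yE] := family_map_surj x bR.
  exists y; rewrite yE -[RHS]reprK; apply/quot_piP.
  by rewrite -opprB rpredN.
have [g fgK] := choice f_surj.
by exists g => // y; apply: f_inj; rewrite fgK.
Qed.

End QuotientByFamily.

Lemma eq_cyclic_family (A : zmodType) (R : zmodClosed A) (G G' : A -> Prop)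
    (J : eqType) (l l' : seq J) b r :
  (forall a, G a <-> G' a) -> perm_eq l l' ->
  cyclic_family R G l b r -> cyclic_family R G' l' b r.
Proof.
move=> eqG eql [l_uniq bG bR indep gen]; have mem_l := perm_mem eql.
split.
- by rewrite -(perm_uniq eql).
- by move=> j; rewrite -mem_l -eqG => /bG.
- by move=> j; rewrite -mem_l => /bR.
- by move=> x; rewrite -(perm_big _ eql) => /indep xr j; rewrite -mem_l => /xr.
by move=> a /eqG/gen[x]; exists x; rewrite -(perm_big _ eql).
Qed.

Lemma rpred_congr (A : zmodType) (R : zmodClosed A) (a c : A) :
  a - c \in R -> (a \in R) = (c \in R).
Proof. by move=> acR; rewrite -[a](subrK c) rpredDl. Qed.

(** Two maps out of [A0] with the same relations carry a cyclic decomposition of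
    the image of the first one to the image of the second one. *)
Lemma cyclic_family_transport (A0 A B : zmodType) (R : zmodClosed A)
    (R' : zmodClosed B) (G : A -> Prop) (mu : {additive A0 -> A})
    (nu : {additive A0 -> B}) (J : eqType) (l : seq J) b r :
  (forall p, (mu p \in R) = (nu p \in R')) -> (forall p, G (mu p)) ->
  (forall a, G a -> exists p, mu p - a \in R) ->
  (forall y, exists p, nu p = y) ->
  cyclic_family R G l b r ->
  exists b', cyclic_family R' (fun=> True) l b' r.
Proof.
move=> munu muG mu_surj nu_surj [l_uniq bG bR indep gen].
have [p pP] : exists p : J -> A0, forall j, j \in l -> mu (p j) - b j \in R.
  have /choice[p pP] : forall j, exists a, j \in l -> mu a - b j \in R.
    move=> j; have [jl|] := boolP (j \in l); last by exists 0.
    by have [a aP] := mu_surj _ (bG _ jl); exists a.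
  by exists p.
pose q (x : J -> int) := \sum_(j <- l) p j *~ x j.
have muE x : mu (q x) - \sum_(j <- l) b j *~ x j \in R.
  rewrite raddf_sum -sumrB !big_seq; apply: rpred_sum => j jl.
  by rewrite raddfMz -mulrzBl rpredMz // pP.
have nuE x : \sum_(j <- l) nu (p j) *~ x j = nu (q x).
  by rewrite raddf_sum; apply: eq_bigr => j _; rewrite raddfMz.
exists (nu \o p); split=> //=.
- move=> j jl; rewrite -raddfMn -munu raddfMn.
  by rewrite (rpred_congr (c := b j *+ r j)) ?bR // -mulrnBl rpredMn // pP.
- move=> x; rewrite nuE -munu (rpred_congr (muE x)); exact: indep.
move=> y _; have [a <-] := nu_surj y; have [x xP] := gen _ (muG a).
exists x; rewrite nuE -raddfB -munu raddfB.
rewrite -[mu a](subrK (\sum_(j <- l) b j *~ x j)) -addrA.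
by rewrite rpredD // -opprB rpredN.
Qed.

Lemma cyclic_family_zquot (A : zmodType) (s : seq A) (J : eqType) (l : seq J)
    b r (t : seq nat) :
  cyclic_family (zspan s) (fun=> True) l b r ->
  perm_eq [seq r j | j <- l] t -> zisog (zquot s) (dsum_cyc t).
Proof.
move=> fam; case: l fam => [|j0 l] fam.
  by rewrite perm_sym => /perm_nilP->; apply: cyclic_family_quot fam.
rewrite perm_sym => /(perm_iotaP 0%N)[Is Is_perm ->].
have <- : [seq r j | j <- [seq nth j0 (j0 :: l) i | i <- Is]] =
    [seq nth 0%N [seq r j | j <- j0 :: l] i | i <- Is].
  rewrite -map_comp; apply/eq_in_map => i.
  rewrite (perm_mem Is_perm) mem_iota size_map => /andP[_ lti].
  by rewrite /comp (nth_map j0).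
apply: cyclic_family_quot; apply: eq_cyclic_family fam => //.
by rewrite perm_sym; apply/(perm_iotaP j0); exists Is; rewrite -?(size_map r).
Qed.

Section Torsion.
Variables A B : zmodType.

Lemma torsion_zisog : zisog A B -> zisog (torsion A) (torsion B).
Proof.
case=> f [g fK gK].
have f_tors (C D : zmodType) (h : {additive C -> D}) (a : torsion C) :
    h (torsion_val a) \in @is_torsion D.
  case: a => a /asboolP[k k0 ak] /=; apply/asboolP; exists k => //.
  by rewrite -raddfMn ak raddf0.
have gB : zmod_morphism g.
  by move=> x y; apply: (can_inj fK); rewrite raddfB !gK.
pose g' : {additive B -> A} := HB.pack_for {additive B -> A} g
  (GRing.isZmodMorphism.Build B A g gB).
pose F a := Torsion (f_tors _ _ f a); pose F' b := Torsion (f_tors _ _ g' b).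
apply: (@zmod_morphism_zisog _ _ F) => [x y|].
  by apply: val_inj; rewrite /= raddfB.
by exists F' => x; apply: val_inj; rewrite /= ?fK ?gK.
Qed.

Lemma torsion_id : (forall a : A, a \in @is_torsion A) -> zisog (torsion A) A.
Proof.
move=> tA; exists (val : {additive torsion A -> A}).
by exists (fun a => Torsion (tA a)) => [[a ta]|a] //; apply: val_inj.
Qed.

(** The free summand [Z] contributes nothing to the torsion subgroup. *)
Lemma torsion_cyc0 : (forall a : A, a \in @is_torsion A) ->
  zisog (torsion (cyc 0 * A)%type) A.
Proof.
move=> tA; have inP (a : A) : ((0, a) : (cyc 0 * A)%type) \in @is_torsion _.
  have /asboolP[k k0 ak] := tA a; apply/asboolP; exists k => //.
  apply: injective_projections.
    by rewrite (raddfMn (@fst (cyc 0) A)) mul0rn.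
  by rewrite (raddfMn (@snd (cyc 0) A)).
apply: (@zmod_morphism_zisog _ _ (fun y => (torsion_val y).2)) => //.
exists (fun a => Torsion (inP a)) => // -[[x a] xaT]; apply: val_inj => /=.
congr (_, _); have /asboolP[k k0 /(congr1 fst)] := xaT.
rewrite (raddfMn (@fst (cyc 0) A)) /= -[x in LHS]reprK -raddfMn.
rewrite -(raddf0 \pi_(cyc 0)) => /cyc_piP; rewrite subr0 dvd0z mulrn_eq0.
rewrite eqn0Ngt k0 /= => /eqP x0.
by rewrite -[RHS]reprK x0 raddf0.
Qed.
End Torsion.

Lemma dsum_cyc_torsion (t : seq nat) : all (leq 1) t ->
  forall y : dsum_cyc t, y \in @is_torsion (dsum_cyc t).
Proof.
elim: t => [|m t IHt] /=; first by move=> _ y; rewrite (ord1 y) rpred0.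
case/andP=> m0 /IHt tT [x y]; have /asboolP[k k0 yk] := tT y.
apply/asboolP; exists (m * k)%N; first by rewrite muln_gt0 m0.
apply: (@injective_projections (cyc m) (dsum_cyc t)).
  rewrite (raddfMn (@fst (cyc m) (dsum_cyc t))) /= mulrnA.
  rewrite -[x]reprK -(raddfMn \pi_(cyc m)) -[RHS](mul0rn _ k).
  congr (_ *+ _); rewrite -(raddf0 \pi_(cyc m)); apply/cyc_piP.
  by rewrite subr0 pmulrn mulrzz dvdz_mull.
by rewrite (raddfMn (@snd (cyc m) (dsum_cyc t))) /= mulnC mulrnA yk mul0rn.
Qed.

Local Close Scope quotient_scope.

(** * Kernels by triangular change of generators *)

Section TriangularKernel.
Variables (A : zmodType) (R : {pred A}) (phi : A -> int).
Variables (n : nat) (J : eqType) (b : J -> A) (r c : J -> nat).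

Definition comb (l : seq J) (x : J -> int) : A := \sum_(j <- l) b j *~ x j.

(** With [w] the combination of earlier generators given by [t], the element
    [c j * b j - w] lies in the kernel of [phi] modulo [n], and killing [w] by
    [r j / c j] makes its order [r j / c j] when that of [b j] is [r j]. *)
Definition triangular_at (prev : seq J) (j : J) : Prop :=
  (c j %| r j)%N /\ exists t : J -> int,
    comb prev t *+ (r j %/ c j) \in R /\
    (n%:Z %| phi (b j *+ c j - comb prev t))%Z.

Fixpoint triangular (prev l : seq J) : Prop :=
  if l is j :: l' then triangular_at prev j /\ triangular (rcons prev j) l'
  else True.

Lemma triangular_cat prev l1 l2 :
  triangular prev (l1 ++ l2) <->
  triangular prev l1 /\ triangular (prev ++ l1) l2.
Proof.
elim: l1 prev => [|j l1 IHl] prev /=; first by rewrite cats0; tauto.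
by rewrite IHl cat_rcons; tauto.
Qed.

Lemma triangular_dvd prev l : triangular prev l ->
  forall j, j \in l -> (c j %| r j)%N.
Proof.
elim: l prev => //= j l IHl prev [[cr _] /IHl{}IHl] i.
by rewrite inE => /orP[/eqP-> // | /IHl].
Qed.

Lemma combD l x y : comb l (fun j => x j + y j) = comb l x + comb l y.
Proof.
by rewrite -big_split; apply: eq_bigr => j _; rewrite mulrzDr.
Qed.

Lemma combM l x a : comb l (fun j => x j * a) = comb l x *~ a.
Proof.
by rewrite /comb mulrz_suml; apply: eq_bigr => j _; rewrite mulrzA.
Qed.

Lemma eq_comb l x y : {in l, x =1 y} -> comb l x = comb l y.
Proof. by move=> xy; apply: eq_big_seq => j /xy->. Qed.

Lemma comb_rcons l j x : comb (rcons l j) x = comb l x + b j *~ x j.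
Proof. by rewrite /comb big_rcons. Qed.

Lemma comb_rcons_if l j x a : j \notin l ->
  comb (rcons l j) (fun i => if i == j then a else x i) = comb l x + b j *~ a.
Proof.
move=> jl; rewrite comb_rcons eqxx; congr (_ + _).
by apply: eq_comb => i il; case: eqP => // eij; rewrite -eij il in jl.
Qed.

End TriangularKernel.

Section TriangularKernelTheorem.
Variables (A : zmodType) (R : zmodClosed A) (phi : {additive A -> int}).
Variables (n : nat) (J : eqType) (b : J -> A) (r c : J -> nat).
Hypotheses (n_gt0 : (0 < n)%N) (phiR : forall a, a \in R -> (n%:Z %| phi a)%Z).

Let C l := (\prod_(j <- l) c j)%N.

(** The image of the span of [l] under [phi] modulo [n] is generated by some
    divisor [q] of [n]. Each new [b j] enlarges the image by a factor at most
    [c j], so that [q * C l] never drops below [n]; when it equals [n] all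
    these factors are exact, and the [u j] generate the kernel. *)
Lemma triangular_prefix l : uniq l -> (0 < C l)%N ->
  (forall j, j \in l -> b j *+ r j \in R) ->
  (forall x : J -> int, comb b l x \in R ->
    forall j, j \in l -> ((r j)%:Z %| x j)%Z) ->
  triangular R phi n b r c [::] l ->
  exists (u : J -> A) (q : nat),
  [/\ forall j, j \in l -> (n%:Z %| phi (u j))%Z /\ u j *+ (r j %/ c j) \in R,
      forall x, exists t, comb u l x = comb b l t,
      forall x : J -> int, comb u l x \in R ->
        forall j, j \in l -> ((r j %/ c j)%:Z %| x j)%Z,
      [/\ (q %| n)%N, forall t, (q%:Z %| phi (comb b l t))%Z,
          exists t, (n%:Z %| phi (comb b l t) - q%:Z)%Z
        & (n %| q * C l)%N]
    & (q * C l = n)%N -> forall t, (n%:Z %| phi (comb b l t))%Z ->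
        exists x, comb b l t - comb u l x \in R].
Proof.
elim/last_ind: l => [|l j IHl].
  move=> _ _ _ _ _; exists (fun=> 0), n; split=> //.
  - by move=> x; exists x; rewrite /comb !big_nil.
  - split=> //; first by move=> t; rewrite /comb big_nil raddf0 dvdz0.
      by exists (fun=> 0); rewrite /comb big_nil raddf0 sub0r rpredN dvdzz.
    by rewrite dvdn_mulr.
  by move=> _ t _; exists (fun=> 0); rewrite /comb !big_nil subr0 rpred0.
rewrite rcons_uniq /C big_rcons /= -/(C l) [(C l * _)%N]mulnC => /andP[jl l_uniq].
rewrite muln_gt0 => /andP[cj_gt0 C_gt0].
move=> bR indep; rewrite -cats1 => /triangular_cat[tri_l /= [[cr [t [tR tphi]]] _]].
have in_l i : i \in l -> i \in l ++ [:: j] by rewrite mem_cat => ->.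
have [] := IHl l_uniq C_gt0 _ _ tri_l.
- by move=> i /in_l; rewrite cats1; apply: bR.
- move=> x xR i il.
  have := indep (fun i => if i == j then 0 else x i) _ i.
  rewrite comb_rcons_if // mulr0z addr0 mem_rcons inE il orbT => /(_ xR isT).
  by case: eqP => // eij; rewrite -eij il in jl.
move=> u [q [uP u_span u_indep [qn q_dvd [tq tqP] nqC] gen]].
rewrite /= in tphi tR.
rewrite cats1 in in_l *.
pose w := comb b l t; pose uj := b j *+ c j - w.
pose u' i := if i == j then uj else u i.
have u'E i : i \in l -> u' i = u i.
  by rewrite /u'; case: eqP => // -> jl'; rewrite jl' in jl.
have comb_u' x : comb u' (rcons l j) x = comb u l x + uj *~ x j.
  rewrite comb_rcons /u' eqxx -/u'; congr (_ + _).
  by apply: eq_big_seq => i il; rewrite u'E.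
have ujR : uj *+ (r j %/ c j) \in R.
  rewrite mulrnBl rpredB // -mulrnA mulnC divnK //.
  by apply: bR; rewrite mem_rcons mem_head.
have q_gt0 : (0 < q)%N by rewrite (dvdn_gt0 n_gt0).
have q_cphi : (q%:Z %| (c j)%:Z * phi (b j))%Z.
  have := dvdz_trans (_ : q%:Z %| n%:Z)%Z tphi; rewrite dvdzE => /(_ qn).
  rewrite raddfB raddfMn /= -mulr_natl natz => q_phi.
  by have := rpredD q_phi (q_dvd t); rewrite subrK.
have [q' q'_gcd] : exists q' : nat, q'%:Z = gcdz q%:Z (phi (b j)).
  by exists (gcdn q `|phi (b j)|).
have q'_dvd : (q'%:Z %| q%:Z)%Z by rewrite q'_gcd dvdz_gcdl.
have q_cq' : (q %| c j * q')%N.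
  have : (q%:Z %| (c j)%:Z * gcdz q%:Z (phi (b j)))%Z.
    have -> := mulz_gcdr (c j)%:Z q%:Z (phi (b j)).
    by rewrite dvdz_gcd q_cphi dvdz_mull.
  by rewrite -q'_gcd dvdzE abszM.
(* Expanding the new generator turns coefficients [x] into coefficients over
   the old ones: [b j] gets [c j * x j], and [w] is subtracted from the rest. *)
pose y x s i := if i == j then (c j)%:Z * x j else s i - t i * x j.
have comb_y x s : comb u l x = comb b l s ->
    comb u l x + uj *~ x j = comb b (rcons l j) (y x s).
  move=> ->; rewrite comb_rcons_if // mulrzA -pmulrn.
  rewrite /uj mulrzBl addrA addrAC; congr (_ + _).
  rewrite /w -combM /comb -sumrB.
  by apply: eq_bigr => i _; rewrite mulrzBr.
exists u', q'; split.
- move=> i; rewrite mem_rcons inE => /orP[/eqP-> | il].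
    by rewrite /u' eqxx.
  by rewrite u'E //; apply: uP.
- move=> x; have [s sE] := u_span x.
  by exists (y x s); rewrite comb_u' (comb_y _ _ sE).
- move=> x; rewrite comb_u' => xR.
  have [s sE] := u_span x.
  have rj : ((r j %/ c j)%:Z %| x j)%Z.
    have /indep/(_ j) : comb b (rcons l j) (y x s) \in R by rewrite -(comb_y _ _ sE).
    rewrite mem_rcons mem_head /y eqxx => /(_ isT).
    rewrite -{1}(divnK cr) PoszM [(_ %/ _)%:Z * _]mulrC dvdz_mul2l //.
    by rewrite eqz_nat -lt0n.
  move=> i; rewrite mem_rcons inE => /orP[/eqP-> // | il].
  apply: u_indep il; rewrite (rpred_congr (c := comb u l x + uj *~ x j)) //.
  by rewrite opprD addNKr rpredN (rpredMz_dvd ujR).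
- split.
  + by rewrite (dvdn_trans q'_dvd).
  + move=> s; rewrite comb_rcons raddfD raddfMz /= rpredD //.
      by rewrite (dvdz_trans q'_dvd).
    by rewrite -mulrzr dvdz_mulr // q'_gcd dvdz_gcdr.
  + have [e [f ef]] := Bezoutz q%:Z (phi (b j)).
    exists (fun i => if i == j then f else tq i * e).
    rewrite comb_rcons_if // combM raddfD !raddfMz q'_gcd -ef !mulrzz /=.
    move: (phi (comb b l tq)) (phi (b j)) tqP => F G FP.
    have -> : F * e + G * f - (e * q%:Z + f * G) = (F - q%:Z) * e by ring.
    by rewrite dvdz_mulr.
  by rewrite (dvdn_trans nqC) // mulnA dvdn_pmul2r // mulnC.
move=> q'C s sphi.
have qC : (q * C l = n)%N.
  apply/eqP; rewrite eqn_dvd nqC andbT -q'C mulnA dvdn_pmul2r //.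
  by rewrite mulnC.
(* From here on every inequality between the indices is an equality, so that
   a kernel element has its last coefficient divisible by [c j]. *)
have q_eq : q = (c j * q')%N.
  by apply/eqP; rewrite -(eqn_pmul2r C_gt0) qC -q'C mulnCA mulnA.
have sl_phi : (q%:Z %| s j * phi (b j))%Z.
  have := dvdz_trans (_ : q%:Z %| n%:Z)%Z sphi; rewrite dvdzE => /(_ qn) q_phi.
  have := rpredB q_phi (q_dvd s); rewrite comb_rcons raddfD raddfMz /= addrAC.
  by rewrite subrr add0r -mulrzr intz mulrC.
have q'_gt0 : (0 < q')%N by apply: dvdn_gt0 q'_dvd.
have /dvdzP[z zE] : ((c j)%:Z %| s j)%Z.
  have : (q%:Z %| (s j) * gcdz q%:Z (phi (b j)))%Z.
    have : (q%:Z %| (`|s j|%N)%:Z * gcdz q%:Z (phi (b j)))%Z.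
      by rewrite mulz_gcdr dvdz_gcd dvdz_mull.
    by rewrite !dvdzE !abszM absz_nat.
  by rewrite -q'_gcd q_eq PoszM dvdz_mul2r // eqz_nat -lt0n.
pose s' i := s i + t i * z.
have sE : comb b (rcons l j) s = comb b l s' + uj *~ z.
  rewrite comb_rcons combD combM -/w zE [z * _]mulrC mulrzA -pmulrn.
  by rewrite /uj mulrzBl -[RHS]addrA [w *~ z + _]addrC subrK.
have [|x xP] := gen qC s'.
  have := sphi; rewrite sE raddfD raddfMz /= => uphi.
  have := rpredB uphi (_ : (n%:Z %| phi uj *~ z)%Z); rewrite addrK; apply.
  by rewrite -mulrzr dvdz_mulr.
exists (fun i => if i == j then z else x i).
rewrite comb_u' eqxx sE opprD addrACA subrr addr0.
rewrite [comb u l _](eq_comb _ (y := x)) // => i il.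
by case: eqP => // eij; rewrite -eij il in jl.
Qed.

(** As [phi] is onto modulo [n], the divisor [q] of [triangular_prefix] is [1]
    for the whole family, and [C l = n] leaves no slack in the bound [q * C l]. *)
Theorem triangular_kernel l :
  cyclic_family R (fun=> True) l b r -> triangular R phi n b r c [::] l ->
  C l = n -> (exists a, (n%:Z %| phi a - 1)%Z) ->
  exists u, cyclic_family R (fun a => (n%:Z %| phi a)%Z) l u
    (fun j => r j %/ c j)%N.
Proof.
case=> l_uniq _ bR indep gen tri Cn [a aP].
have [|u [q [uP _ u_indep [qn q_dvd [tq tqP] nqC] u_gen]]] :=
  triangular_prefix l_uniq _ bR indep tri; first by rewrite Cn.
have q1 : q = 1%N.
  have [x xR] := gen a I.
  have q_phi : (q%:Z %| phi a)%Z.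
    rewrite -[a](subrK (comb b l x)) raddfD rpredD ?q_dvd //.
    by rewrite (dvdz_trans _ (phiR xR)).
  have := rpredB q_phi (dvdz_trans (_ : q%:Z %| n%:Z)%Z aP).
  by rewrite subKr => /(_ qn); rewrite dvdzE dvdn1 => /eqP.
exists u; split=> //.
- by move=> j /uP[].
- by move=> j /uP[].
move=> a' a'phi; have [x xR] := gen a' I.
have [||t tR] := u_gen _ x; first by rewrite q1 mul1n.
  have := rpredB a'phi (phiR xR).
  by rewrite -raddfB subKr.
by exists t; rewrite -[a'](subrK (comb b l x)) -addrA rpredD.
Qed.
End TriangularKernelTheorem.

Lemma triangularP (A : zmodType) (R : {pred A}) (phi : A -> int) n
    (J : eqType) (b : J -> A) (r c : J -> nat) prev l :
  (forall l1 j l2, l = l1 ++ j :: l2 -> triangular_at R phi n b r c (prev ++ l1) j) ->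
  triangular R phi n b r c prev l.
Proof.
elim: l prev => //= j l IHl prev tri; split.
  by have := tri [::] j l erefl; rewrite cats0.
apply: IHl => l1 i l2 lE; rewrite cat_rcons.
by apply: (tri (j :: l1) i l2); rewrite lE.
Qed.

Lemma triangular_weaken (A : zmodType) (R R' : zmodClosed A)
    (phi : {additive A -> int}) (n n' : nat) (J : eqType) (b : J -> A)
    (r c : J -> nat) (s prev l : seq J) :
  {subset R <= R'} -> (n' %| n)%N -> (forall j, j \in s -> j \notin prev ++ l) ->
  triangular R phi n b r c prev l -> triangular R' phi n' b r c (s ++ prev) l.
Proof.
move=> RR' n'n; elim: l prev => //= j l IHl prev sP [[cr [t [tR tphi]]] tri_l].
split; last by rewrite rcons_cat; apply: IHl; rewrite ?cat_rcons.
split=> //; exists (fun i => if i \in s then 0 else t i).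
suff -> : comb b (s ++ prev) (fun i => if i \in s then 0 else t i) =
    comb b prev t.
  by split; [apply: RR' | apply: dvdz_trans tphi].
rewrite /comb big_cat /= big1_seq ?add0r; last by move=> i /= ->; rewrite mulr0z.
apply: eq_big_seq => i ip; case: ifP => // /sP.
by rewrite mem_cat ip.
Qed.

(** * The relation lattice on integer polynomials *)

Section Functionals.

(** Independence of generators is always certified by functionals of this form,
    where [f i] is the value at [X^i]. *)
Definition ev (f : nat -> int) (p : {poly int}) : int :=
  \sum_(i < size p) p`_i * f i.

Lemma ev_wide f (p : {poly int}) N : (size p <= N)%N -> ev f p = \sum_(i < N) p`_i * f i.
Proof.
move=> le_pN; rewrite /ev (big_ord_widen _ (fun i => p`_i * f i) le_pN).
rewrite big_mkcond; apply: eq_bigr => i _ /=; case: ltnP => // le_pi.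
by rewrite nth_default ?mul0r.
Qed.

Fact ev_is_zmod_morphism f : zmod_morphism (ev f).
Proof.
move=> p q; pose N := maxn (size (p - q)) (maxn (size p) (size q)).
rewrite !(@ev_wide _ _ N) ?leq_max ?leqnn ?orbT // -sumrB.
by apply: eq_bigr => i _; rewrite coefB mulrBl.
Qed.

HB.instance Definition _ f :=
  GRing.isZmodMorphism.Build {poly int} int (ev f) (ev_is_zmod_morphism f).

Lemma ev_Xn f i : ev f 'X^i = f i.
Proof.
rewrite (@ev_wide _ _ i.+1) ?size_polyXn // (bigD1 ord_max) //=.
rewrite coefXn eqxx mul1r big1 ?addr0 // => j /negPf ne; rewrite coefXn.
by rewrite -[(_ : nat) == _]/(j == ord_max) ne mul0r.
Qed.

Lemma poly_sumXn (p : {poly int}) : p = \sum_(i < size p) 'X^i *~ p`_i.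
Proof.
rewrite -[LHS]coefK poly_def; apply: eq_bigr => i _.
by rewrite -[in LHS](intz p`_i) scaler_int.
Qed.

Lemma poly_zmod_ind (P : zmodClosed {poly int}) :
  (forall i, 'X^i \in P) -> forall p, p \in P.
Proof.
by move=> XP p; rewrite (poly_sumXn p) rpred_sum // => i _; rewrite rpredMz.
Qed.

Lemma ev_comp f d p : ev f (p \Po 'X^d) = ev (fun i => f (d * i)%N) p.
Proof.
rewrite {1}(poly_sumXn p) !raddf_sum /=; apply: eq_bigr => i _.
rewrite raddfMz /= raddfMz /= comp_Xn_poly -exprM ev_Xn.
by rewrite mulrzz mulrC.
Qed.

Lemma ev1 p : ev (fun=> 1) p = p.[1].
Proof.
by rewrite horner_coef; apply: eq_bigr => i _; rewrite expr1n.
Qed.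

Lemma evB f g p : ev (fun i => f i - g i) p = ev f p - ev g p.
Proof. by rewrite -sumrB; apply: eq_bigr => i _; rewrite mulrBr. Qed.

Lemma evM f a p : ev (fun i => a * f i) p = a * ev f p.
Proof. by rewrite big_distrr; apply: eq_bigr => i _; rewrite mulrCA. Qed.

Lemma dvdz_ev f m p : (forall i, (m%:Z %| f i)%Z) -> (m%:Z %| ev f p)%Z.
Proof. by move=> mf; apply: rpred_sum => i _; rewrite dvdz_mull. Qed.

End Functionals.

Section CyclicRelation.
Variable n : nat.

Definition cyc_rel : pred {poly int} :=
  fun p => `[< exists q, p = q * ('X^n - 1) >].

Lemma cyc_relP p : reflect (exists q, p = q * ('X^n - 1)) (p \in cyc_rel).
Proof. exact: asboolP. Qed.

Fact cyc_rel_zmod_closed : zmod_closed cyc_rel.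
Proof.
split=> [|p q /cyc_relP[p' ->] /cyc_relP[q' ->]]; apply/cyc_relP.
  by exists 0; rewrite mul0r.
by exists (p' - q'); rewrite mulrBl.
Qed.

HB.instance Definition _ :=
  GRing.isZmodClosed.Build {poly int} cyc_rel cyc_rel_zmod_closed.

Lemma cyc_relM p q : q \in cyc_rel -> p * q \in cyc_rel.
Proof.
by move=> /cyc_relP[q' ->]; apply/cyc_relP; exists (p * q'); rewrite mulrA.
Qed.

Lemma cyc_rel_XnM k : 'X^(n * k) - 1 \in cyc_rel.
Proof.
rewrite exprM -[X in _ - X](expr1n _ k) subrXX; apply/cyc_relP; eexists; exact: mulrC.
Qed.

Lemma cyc_rel_comp d p : p \in cyc_rel -> p \Po 'X^d \in cyc_rel.
Proof.
move=> /cyc_relP[q ->]; rewrite comp_polyM cyc_relM // comp_polyB.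
by rewrite comp_Xn_poly -exprM mulnC comp_polyC cyc_rel_XnM.
Qed.

Lemma cyc_rel_Xn i j : i = j %[mod n] -> 'X^i - 'X^j \in cyc_rel.
Proof.
have X_mod k : 'X^k - 'X^(k %% n) \in cyc_rel.
  rewrite {1}(divn_eq k n) exprD -{2}['X^(k %% n)]mul1r -mulrBl mulrC.
  by rewrite cyc_relM // mulnC cyc_rel_XnM.
move=> ij; have := rpredB (X_mod i) (X_mod j).
by rewrite ij opprB addrA subrK.
Qed.

Lemma cyc_rel_ev f m p : (forall i, (m%:Z %| f (i + n)%N - f i)%Z) ->
  p \in cyc_rel -> (m%:Z %| ev f p)%Z.
Proof.
move=> fn /cyc_relP[q ->]; rewrite (poly_sumXn q) big_distrl raddf_sum /=.
apply: rpred_sum => i _; rewrite mulrzAl raddfMz /= -mulrzr dvdz_mulr //.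
by rewrite mulrBr mulr1 -exprD raddfB /= !ev_Xn.
Qed.

(** As a functional, the coefficient of [X^u] after reduction modulo
    [X^n - 1]. *)
Definition residue (u i : nat) : int := (i == u %[mod n])%N%:Z.

Lemma cyc_rel_fold p : (0 < n)%N ->
  p - \sum_(u < n) 'X^u *~ ev (residue u) p \in cyc_rel.
Proof.
move=> n_gt0.
have -> : \sum_(u < n) 'X^u *~ ev (residue u) p =
    \sum_(i < size p) 'X^(i %% n) *~ p`_i :> {poly int}.
  under eq_bigr do rewrite /ev mulrz_sumr.
  rewrite exchange_big /=; apply: eq_bigr => i _.
  pose u0 := Ordinal (ltn_pmod i n_gt0).
  rewrite (bigD1 u0) //= /residue modn_mod eqxx mulr1 big1 ?addr0 // => u.
  rewrite -val_eqE /= [in X in X -> _]eq_sym => /negPf ne_u.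
  by rewrite (modn_small (ltn_ord u)) ne_u mulr0 mulr0z.
rewrite {1}(poly_sumXn p) -sumrB; apply: rpred_sum => i _.
by rewrite -mulrzBl rpredMz // cyc_rel_Xn // modn_mod.
Qed.

Lemma cyc_rel_residue p : (0 < n)%N ->
  (forall u, (u < n)%N -> ev (residue u) p = 0) -> p \in cyc_rel.
Proof.
move=> n_gt0 p0; have := cyc_rel_fold p n_gt0.
by rewrite big1 ?subr0 // => u _; rewrite p0 // mulr0z.
Qed.

Lemma ev_residue0 u p : p \in cyc_rel -> ev (residue u) p = 0.
Proof.
move=> pC; apply/eqP; rewrite -dvd0z; apply: cyc_rel_ev pC => i.
by rewrite /residue modnDr subrr.
Qed.

End CyclicRelation.

Lemma cyc_rel_dvd n m p : (n %| m)%N -> p \in cyc_rel m -> p \in cyc_rel n.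
Proof.
by move=> /dvdnP[k ->] /cyc_relP[q ->]; rewrite cyc_relM // mulnC cyc_rel_XnM.
Qed.

Lemma cyc_rel_comp_mul n d p : p \in cyc_rel n -> p \Po 'X^d \in cyc_rel (d * n).
Proof.
move=> /cyc_relP[q ->]; rewrite comp_polyM cyc_relM // comp_polyB.
rewrite comp_Xn_poly -exprM comp_polyC; apply/cyc_relP.
by exists 1; rewrite mul1r.
Qed.

Section SandRelation.
Variables n d : nat.

(** With [c = X^v], the term [c *+ d - (c \Po 'X^d)] relates [X^v] and
    [X^(d * v)]; constants are relations because [X^0] stands for the zero
    element [e_0]. *)
Definition sand_rel : pred {poly int} := fun p =>
  `[< exists c a, p - (c *+ d - (c \Po 'X^d)) - a%:P \in cyc_rel n >].

Lemma sand_relP p :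
  reflect (exists c a, p - (c *+ d - (c \Po 'X^d)) - a%:P \in cyc_rel n)
    (p \in sand_rel).
Proof. exact: asboolP. Qed.

Fact sand_rel_zmod_closed : zmod_closed sand_rel.
Proof.
split=> [|p q /sand_relP[c [a pP]] /sand_relP[c' [a' qP]]]; apply/sand_relP.
  by exists 0, 0; rewrite !(mul0rn, raddf0, subr0) rpred0.
exists (c - c'), (a - a').
have -> : p - q - ((c - c') *+ d - ((c - c') \Po 'X^d)) - (a - a')%:P =
    p - (c *+ d - (c \Po 'X^d)) - a%:P - (q - (c' *+ d - (c' \Po 'X^d)) - a'%:P).
  by rewrite mulrnBl comp_polyB polyCB; ring.
exact: rpredB.
Qed.

HB.instance Definition _ :=
  GRing.isZmodClosed.Build {poly int} sand_rel sand_rel_zmod_closed.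

Lemma sand_rel_cyc p : p \in cyc_rel n -> p \in sand_rel.
Proof.
by move=> pC; apply/sand_relP; exists 0, 0; rewrite !(mul0rn, raddf0, subr0).
Qed.

Lemma sand_rel_Xn i j : i = j %[mod n] -> 'X^i - 'X^j \in sand_rel.
Proof. by move=> ij; rewrite sand_rel_cyc // cyc_rel_Xn. Qed.

Lemma sand_rel_const a : a%:P \in sand_rel.
Proof.
apply/sand_relP; exists 0, a.
by rewrite !(mul0rn, raddf0, subr0) subrr rpred0.
Qed.

Lemma sand_rel_Frob p : p *+ d - (p \Po 'X^d) \in sand_rel.
Proof. by apply/sand_relP; exists p, 0; rewrite subrr !subr0 rpred0. Qed.

(** It suffices to test a functional on the three kinds of relations in
    [sand_rel]. *)
Lemma sand_rel_ev f m p :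
  (forall i, (m%:Z %| f (i + n)%N - f i)%Z) ->
  (forall i, (m%:Z %| f i *+ d - f (d * i)%N)%Z) -> (m%:Z %| f 0%N)%Z ->
  p \in sand_rel -> (m%:Z %| ev f p)%Z.
Proof.
move=> fn fd f0 /sand_relP[c [a pC]].
have fp : (m%:Z %| ev f p - (ev f c *+ d - ev (fun i => f (d * i)%N) c)
    - ev f a%:P)%Z.
  have := cyc_rel_ev fn pC; rewrite (raddfB (ev f)) (raddfB (ev f)) /=.
  by rewrite (raddfB (ev f) (c *+ d)) raddfMn -ev_comp.
have ev_c : (m%:Z %| ev f c *+ d - ev (fun i => f (d * i)%N) c)%Z.
  rewrite -mulr_natl -evM -evB; apply: dvdz_ev => i.
  by rewrite mulr_natl.
have ev_a : (m%:Z %| ev f a%:P)%Z.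
  have -> : a%:P = 'X^0 *~ a :> {poly int}.
    by rewrite expr0 -[a in LHS]intz rmorph_int.
  by rewrite raddfMz /= ev_Xn -mulrzr dvdz_mulr.
rewrite -[ev f p](subrK (ev f c *+ d - ev (fun i => f (d * i)%N) c)).
rewrite rpredD // -[X in X \in _](subrK (ev f a%:P)) rpredD //.
Qed.

End SandRelation.

Lemma sand_rel_dvd n m d p : (n %| m)%N ->
  p \in sand_rel m d -> p \in sand_rel n d.
Proof.
move=> nm /sand_relP[c [a pC]]; apply/sand_relP; exists c, a.
exact: cyc_rel_dvd pC.
Qed.

(** The substitution of [X^d] for [X] turns [X^m - 1] into a multiple of
    [X^n - 1]. *)
Lemma sand_rel_comp n m d p : (n %| d * m)%N ->
  p \in sand_rel m d -> p \Po 'X^d \in sand_rel n d.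
Proof.
move=> n_dm /sand_relP[c [a pC]]; apply/sand_relP; exists (c \Po 'X^d), a.
have := cyc_rel_dvd n_dm (cyc_rel_comp_mul d pC).
by rewrite !comp_polyB comp_polyC (raddfMn (comp_poly 'X^d)).
Qed.

Section Descent.
Variables n d : nat.
Hypotheses (n_gt0 : (0 < n)%N) (d_gt0 : (0 < d)%N).
Let g := gcdn n d.
Let n1 := (n %/ g)%N.

Let nE : n = (n1 * g)%N. Proof. by rewrite divnK ?dvdn_gcdl. Qed.
Let g_gt0 : (0 < g)%N. Proof. by rewrite gcdn_gt0 n_gt0. Qed.
Let n1_gt0 : (0 < n1)%N. Proof. by have := n_gt0; rewrite nE muln_gt0 => /andP[]. Qed.

Lemma eqn_mod_mul_quot i j :
  (d * i == d * j %[mod n])%N = (i == j %[mod n1])%N.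
Proof.
pose d1 := (d %/ g)%N.
have dE : d = (g * d1)%N by rewrite mulnC divnK // dvdn_gcdr.
have co : coprime n1 d1.
  rewrite /coprime -(eqn_pmul2r g_gt0) mul1n muln_gcdl.
  by rewrite -nE [(d1 * g)%N]mulnC -dE.
wlog le_ij : i j / (i <= j)%N => [IH|].
  case: (leqP i j) => [/IH // | /ltnW/IH]; rewrite eq_sym => ->.
  by rewrite eq_sym.
rewrite eq_sym [RHS]eq_sym !eqn_mod_dvd ?leq_mul2l ?le_ij ?orbT //.
rewrite -mulnBr nE dE -mulnA [(n1 * g)%N]mulnC dvdn_pmul2l //.
by rewrite Gauss_dvdr.
Qed.

(** Bezout: multiplication by [d] on [Z_n] hits every multiple of the gcd. *)
Lemma mod_mul_gcd u : (g %| u)%N -> exists i, d * i = u %[mod n].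
Proof.
move=> /dvdnP[k ->]; case: (egcdnP n d_gt0) => a b ab _.
exists (a * k)%N; rewrite mulnA [(d * a)%N]mulnC ab gcdnC -/g mulnDl.
by rewrite mulnAC modnMDl mulnC.
Qed.

Lemma dvdn_gcd_mod i : (g %| i)%N = (g %| i %% n)%N.
Proof. by rewrite {1}(divn_eq i n) dvdn_addr // dvdn_mull // dvdn_gcdl. Qed.

(** A relation all of whose exponents are multiples of [d] already holds before
    the substitution of [X^d] for [X]: comparing the coefficients outside
    [d Z_n] shows that the polynomial [c] witnessing it is itself of the form
    [c' \Po 'X^d]. *)
Lemma sand_rel_comp_inj p : p \Po 'X^d \in sand_rel n d -> p \in sand_rel n1 d.
Proof.
move=> /sand_relP[c [a pC]].
have ev_leaf u : (u < n)%N -> ~~ (g %| u)%N -> ev (residue n u) c = 0.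
  move=> lt_un gu; have ev_mul q : ev (residue n u) (q \Po 'X^d) = 0.
    rewrite ev_comp /ev big1 // => i _; rewrite /residue.
    case: eqP => [/(congr1 (dvdn g)) | _]; last by rewrite mulr0.
    by rewrite -!dvdn_gcd_mod (negPf gu) dvdn_mulr // dvdn_gcdr.
  have := ev_residue0 u pC; rewrite -(comp_polyC a 'X^d).
  rewrite !(raddfB (ev _)) /= !ev_mul sub0r !subr0 raddfMn /=.
  move=> /eqP; rewrite oppr_eq0 mulrn_eq0.
  by rewrite eqn0Ngt d_gt0 => /eqP.
(* Every exponent left in [c] is a multiple of [d] modulo [n]. *)
have [c' c'P] : exists c', c - (c' \Po 'X^d) \in cyc_rel n.
  have /choice[f fP] : forall u : 'I_n, exists i : nat,
      ('X^u - 'X^(d * i)) *~ ev (residue n u) c \in cyc_rel n.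
    move=> u; have [/mod_mul_gcd[i iP] | gu] := boolP (g %| u)%N.
      by exists i; rewrite rpredMz // cyc_rel_Xn.
    by exists 0%N; rewrite ev_leaf // mulr0z rpred0.
  exists (\sum_(u < n) 'X^(f u) *~ ev (residue n u) c).
  rewrite -[c in c - _](subrK (\sum_(u < n) 'X^u *~ ev (residue n u) c)) -addrA.
  rewrite rpredD ?cyc_rel_fold // raddf_sum -sumrB rpred_sum // => u _.
  by rewrite (raddfMz (comp_poly 'X^d)) /= comp_Xn_poly -exprM -mulrzBl fP.
pose s := p - (c' *+ d - (c' \Po 'X^d)).
apply/sand_relP; exists c', a; rewrite -/s.
apply: cyc_rel_residue => // u _.
have sC : (s - a%:P) \Po 'X^d \in cyc_rel n.
  pose w := c - (c' \Po 'X^d).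
  have -> : (s - a%:P) \Po 'X^d =
      ((p \Po 'X^d) - (c *+ d - (c \Po 'X^d)) - a%:P)
      + (w *+ d - (w \Po 'X^d)).
    rewrite /s /w !comp_polyB comp_polyC (raddfMn (comp_poly 'X^d)) mulrnBl /=.
    ring.
  by rewrite rpredD // rpredB ?rpredMn ?cyc_rel_comp.
have := ev_residue0 (d * u) sC; rewrite ev_comp => <-.
by apply: eq_bigr => i _; rewrite /residue eqn_mod_mul_quot.
Qed.

End Descent.

(** * New vertices when the modulus grows *)

Section Leaves.
Variables n d : nat.
Hypotheses (n_gt0 : (0 < n)%N) (d_gt0 : (0 < d)%N).
Let g := gcdn n d.
Let n1 := (n %/ g)%N.
Let g1 := gcdn n1 d.
Hypothesis g_neq1 : g != 1%N.

Let nE : n = (n1 * g)%N. Proof. by rewrite divnK ?dvdn_gcdl. Qed.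
Let g_gt1 : (1 < g)%N.
Proof. by rewrite ltn_neqAle eq_sym g_neq1 gcdn_gt0 n_gt0. Qed.
Let g_gt0 : (0 < g)%N. Proof. exact: ltnW. Qed.
Let n1_gt0 : (0 < n1)%N.
Proof. by have := n_gt0; rewrite nE muln_gt0 => /andP[]. Qed.
Let n1_dvd : (n1 %| n)%N. Proof. by rewrite nE dvdn_mulr. Qed.
Let g1E : gcdn n1 g = g1.
Proof. by rewrite /g1 /g gcdnA; congr gcdn; apply/gcdn_idPl. Qed.
Let g1_dvdg : (g1 %| g)%N. Proof. by rewrite -g1E dvdn_gcdr. Qed.
Let g1_dvdn1 : (g1 %| n1)%N. Proof. by rewrite dvdn_gcdl. Qed.

(** A representative of the class of [v] modulo [n1], the set of vertices with
    the same successors as [v]. A multiple of [g] is preferred: it is a multiple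
    of [d] modulo [n], and hence comes from the modulus [n1] by the
    substitution of [X^d] for [X]. Only classes of multiples of [g1] contain
    one; the others use the least residue. *)
Definition base_vertex (v : nat) : nat :=
  head (v %% n1)%N
    [seq u <- iota 0 n | (u == v %[mod n1])%N && (g %| u)%N].

(** The vertices outside the image of multiplication by [d] that do not serve
    as a base. *)
Definition is_leaf (v : nat) : bool :=
  [&& (v < n)%N, ~~ (g %| v)%N & (n1 <= v)%N || (g1 %| v)%N].

Lemma base_vertexP v : base_vertex v = v %[mod n1] /\ (base_vertex v < n)%N.
Proof.
rewrite /base_vertex; case E: [seq u <- iota 0 n | _] => [|u s] /=.
  rewrite modn_mod; split=> //.
  by rewrite (leq_trans (ltn_pmod _ n1_gt0)) // dvdn_leq.
have : u \in u :: s by rewrite mem_head.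
by rewrite -E mem_filter mem_iota => /andP[/andP[/eqP-> _] /andP[_ ->]].
Qed.

Lemma base_vertex_congr v w : v = w %[mod n1] -> base_vertex v = base_vertex w.
Proof. by rewrite /base_vertex => ->. Qed.

Lemma base_vertex_dvd v : (g1 %| v)%N -> (g %| base_vertex v)%N.
Proof.
rewrite -g1E => /(@mod_mul_gcd n1 g g_gt0 v)[i iP].
rewrite /base_vertex; case E: [seq u <- iota 0 n | _] => [|u s] /=.
  have : (g * i %% n)%N \in [seq u <- iota 0 n | (u == v %[mod n1])%N && (g %| u)%N].
    rewrite mem_filter mem_iota /= add0n ltn_mod n_gt0 andbT.
    rewrite modn_dvdm // iP eqxx /=.
    by rewrite -dvdn_gcd_mod dvdn_mulr.
  by rewrite E.
have : u \in u :: s by rewrite mem_head.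
by rewrite -E mem_filter => /andP[/andP[_ ->]].
Qed.

Lemma base_vertex_id v : ~~ (g1 %| v)%N -> base_vertex v = (v %% n1)%N.
Proof.
rewrite /base_vertex; case E: [seq u <- iota 0 n | _] => [|u s] //=.
have : u \in u :: s by rewrite mem_head.
rewrite -E mem_filter => /andP[/andP[/eqP uv gu] _] /negP[].
have g1_mod w : (g1 %| w)%N = (g1 %| w %% n1)%N.
  by rewrite {1}(divn_eq w n1) dvdn_addr // dvdn_mull.
by rewrite g1_mod -uv -g1_mod (dvdn_trans g1_dvdg).
Qed.

Lemma base_vertex0 : base_vertex 0 = 0%N.
Proof. by rewrite /base_vertex; case: (n) n_gt0 => //= m _; rewrite eqxx dvdn0. Qed.

Lemma base_vertex_leaf v : is_leaf (base_vertex v) = false.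
Proof.
apply/and3P=> -[lt_n gb lf]; have [g1v | g1v] := boolP (g1 %| v)%N.
  by rewrite base_vertex_dvd in gb.
move: lf; rewrite base_vertex_id // leqNgt ltn_mod n1_gt0 /=.
by apply/negP; apply: contra g1v => g1v; rewrite (divn_eq v n1) dvdn_add // dvdn_mull.
Qed.

Lemma base_vertex_nonleaf v : (v < n)%N -> ~~ (g %| v)%N -> ~~ is_leaf v ->
  base_vertex v = v.
Proof.
move=> lt_n gv; rewrite /is_leaf lt_n gv /= negb_or -ltnNge => /andP[lt_n1 g1v].
by rewrite base_vertex_id // modn_small.
Qed.

(** This leaf lies at distance exactly [n1] above its base vertex, so that [phi]
    takes on its generator the smallest value possible, [n1]. When [g] divides
    [n1], the vertex [n1] is not a leaf and its successor is used. *)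
Definition special_leaf : nat := if (g %| n1)%N then n1.+1 else n1.

Lemma special_leafP :
  is_leaf special_leaf /\ special_leaf = (base_vertex special_leaf + n1)%N.
Proof.
have g1_small : (0 < g1)%N by rewrite gcdn_gt0 n1_gt0.
rewrite /special_leaf /is_leaf; case: ifP => gn1.
  have g_le_n1 : (g <= n1)%N by rewrite dvdn_leq.
  have g1g : g1 = g by rewrite -g1E; apply/gcdn_idPr.
  have gn : ~~ (g %| n1.+1)%N by rewrite -addn1 dvdn_addr // dvdn1 g_neq1.
  rewrite leqnSn gn /= andbT; split; first last.
  - rewrite base_vertex_id ?g1g // -addn1 -{2}[n1]mul1n modnMDl modn_small //.
      by rewrite addnC.
    by rewrite (leq_trans g_gt1).
  - rewrite nE (@leq_trans (n1 + n1)) //; last by rewrite addnn -muln2 leq_mul2l g_gt1 orbT.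
    by rewrite -addn1 -[X in (X <= _)%N]addn1 -addnA leq_add2l (leq_trans g_gt1).
rewrite leqnn gn1 andbT; split; first by rewrite nE ltn_Pmulr.
by rewrite (@base_vertex_congr _ 0) ?base_vertex0 // modnn mod0n.
Qed.

Lemma count_dvdn k q : (0 < k)%N -> count (dvdn k) (iota 0 (q * k)) = q.
Proof.
move=> k_gt0; elim: q => [|q IHq] //; rewrite mulSn addnC iotaD count_cat IHq.
rewrite add0n; case: k k_gt0 => // k _ in IHq *.
rewrite /= dvdn_mull // (_ : count _ _ = 0%N) ?addn1 //.
apply/eqP; rewrite -leqn0 leqNgt -has_count; apply/hasPn => i.
rewrite mem_iota => /andP[lo hi]; apply/negP=> /dvdnP[a aE].
move: lo hi; rewrite {i}aE ltn_pmul2r // addSnnS -mulSnr ltn_pmul2r // ltnS.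
by case: ltngtP.
Qed.

(** There are [n - n1] vertices that are not multiples of [g]; among them the
    bases are the [v < n1] that are not multiples of [g1], of which there are
    [n1 - n1 / g1]. *)
Lemma count_leaf : count is_leaf (iota 0 n) = (n + n1 %/ g1 - 2 * n1)%N.
Proof.
pose low v := (v < n1)%N && ~~ (g1 %| v)%N.
have all_g : count (predC (dvdn g)) (iota 0 n) = (n - n1)%N.
  have := count_predC (dvdn g) (iota 0 n).
  by rewrite {1}nE count_dvdn // size_iota => /(canRL (addKn _)).
have all_g1 : count low (iota 0 n) = (n1 - n1 %/ g1)%N.
  have le_n1 : (n1 <= n)%N by rewrite dvdn_leq.
  rewrite -(subnKC le_n1) iotaD count_cat add0n.
  rewrite [X in (_ + X)%N](_ : _ = 0%N) ?addn0; last first.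
    apply/eqP; rewrite -leqn0 leqNgt -has_count; apply/hasPn => i.
    by rewrite mem_iota /low => /andP[le_i _]; rewrite ltnNge le_i.
  rewrite (eq_in_count (a2 := predC (dvdn g1))).
    have := count_predC (dvdn g1) (iota 0 n1).
    have g1_gt0 : (0 < g1)%N by rewrite gcdn_gt0 n1_gt0.
    by rewrite -{1}(divnK g1_dvdn1) count_dvdn // size_iota => /(canRL (addKn _)).
  by move=> i; rewrite mem_iota /low => /andP[_ ->].
have := count_predUI is_leaf low (iota 0 n).
rewrite (@eq_in_count _ (predU is_leaf low) (predC (dvdn g))); last first.
  move=> v; rewrite mem_iota /= add0n /is_leaf /low => -> /=.
  have [gv | gv] := boolP (g %| v)%N; first by rewrite (dvdn_trans g1_dvdg gv) /= andbF.
  by rewrite /= ltnNge; case: leqP => //=; case: (g1 %| v)%N.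
rewrite (@eq_count _ (predI is_leaf low) pred0); last first.
  move=> v; rewrite /= /is_leaf /low ltnNge.
  by case: (g1 %| v)%N; case: leqP => //=; rewrite ?andbF.
have g1_le : (n1 %/ g1 <= n1)%N by rewrite leq_div.
have le_n1n : (2 * n1 <= n)%N by rewrite nE mulnC leq_mul2l g_gt1 orbT.
rewrite count_pred0 all_g all_g1.
have arith : forall c q a b : nat, (q <= a -> 2 * a <= b ->
  b - a + 0 = c + (a - q) -> c = b + q - 2 * a)%N by clear; lia.
exact: arith.
Qed.

End Leaves.

(** * From the modulus [n / gcd n d] to the modulus [n] *)

Section Spanned.
Variables (A : zmodType) (J : eqType) (b : J -> A) (l : seq J).

Definition spanned (R : {pred A}) : pred A :=
  fun a => `[< exists x, a - comb b l x \in R >].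

Variable R : zmodClosed A.

Lemma spannedP a : reflect (exists x, a - comb b l x \in R) (a \in spanned R).
Proof. exact: asboolP. Qed.

Fact spanned_zmod_closed : zmod_closed (spanned R).
Proof.
split=> [|a a' /spannedP[x ax] /spannedP[y ay]]; apply/spannedP.
  by exists (fun=> 0); rewrite /comb big1 ?subr0 ?rpred0.
exists (fun j => x j + y j * -1); rewrite combD combM mulrN1z opprD addrACA.
by rewrite -opprD rpredB.
Qed.

HB.instance Definition _ :=
  GRing.isZmodClosed.Build A (spanned R) spanned_zmod_closed.

Lemma spanned_rel a : a \in R -> a \in spanned R.
Proof.
by move=> aR; apply/spannedP; exists (fun=> 0); rewrite /comb big1 ?subr0.
Qed.

Lemma comb_single i z : uniq l -> i \in l ->
  comb b l (fun j => if j == i then z else 0) = b i *~ z.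
Proof.
move=> l_uniq il; rewrite /comb (bigD1_seq i) //= eqxx big1 ?addr0 // => j.
by move=> /negPf->.
Qed.

Lemma spanned_gen j : uniq l -> j \in l -> b j \in spanned R.
Proof.
move=> l_uniq jl; apply/spannedP; exists (fun i => if i == j then 1 else 0).
by rewrite comb_single // mulr1z subrr rpred0.
Qed.

End Spanned.

(** The value at [1] of the derivative; it sends the vertex [v] to the integer
    [v], and its kernel modulo [n] is the copy of [S(n, d)] in [Sigma(n, d)]. *)
Local Notation phi := (ev Posz).

(** The generators in [lP] come from the periodic vertices and satisfy their
    relations modulo a common multiple [M] of all the moduli in play, which is
    why they survive unchanged when [n] grows; those in [lN] come from the
    remaining vertices and have orders divisible by [d]. The triangularity data
    for the two lists are independent of each other. *)
Record tower (d M n : nat) (J : eqType) (b : J -> {poly int}) (r c : J -> nat)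
    (lN lP : seq J) : Prop := {
  tower_family : cyclic_family (sand_rel n d) (fun=> True) (lN ++ lP) b r;
  tower_order : forall j, j \in lN -> (d %| r j)%N /\ (0 < r j)%N;
  tower_tri : triangular (sand_rel n d) phi n b r c [::] lN;
  tower_per : forall j, j \in lP -> b j *+ r j \in sand_rel M d;
  tower_tri_per : triangular (sand_rel M d) phi M b r c [::] lP;
  tower_prod : (\prod_(j <- lN ++ lP) c j)%N = n }.

Section Step.
Variables n d M : nat.
Hypotheses (n_gt0 : (0 < n)%N) (d_gt0 : (0 < d)%N) (nM : (n %| M)%N).
Let g := gcdn n d.
Let n1 := (n %/ g)%N.
Hypothesis g_neq1 : g != 1%N.
Variables (J : eqType) (b : J -> {poly int}) (r c : J -> nat) (lN lP : seq J).
Hypothesis tw : tower d M n1 b r c lN lP.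

Local Notation R := (sand_rel n d).
Local Notation R1 := (sand_rel n1 d).
Let v0 := special_leaf n d.
Let base := base_vertex n d.

Let nE : n = (n1 * g)%N. Proof. by rewrite divnK ?dvdn_gcdl. Qed.
Let g_gt0 : (0 < g)%N. Proof. by rewrite gcdn_gt0 n_gt0. Qed.
Let n1_gt0 : (0 < n1)%N.
Proof. by have := n_gt0; rewrite nE muln_gt0 => /andP[]. Qed.
Let n1_dvd : (n1 %| n)%N. Proof. by rewrite nE dvdn_mulr. Qed.
Let n_dvd : (n %| d * n1)%N.
Proof. by rewrite nE mulnC dvdn_mul // dvdn_gcdr. Qed.

(** The summand [nat] indexes the new leaves; the old polynomials are reused
    verbatim. *)
Definition step_gen (j : nat + J) : {poly int} :=
  match j with inl v => 'X^v - 'X^(base v) | inr j => b j end.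
Definition step_order (j : nat + J) : nat :=
  match j with inl _ => d | inr j => if j \in lN then (d * r j)%N else r j end.
Definition step_index (j : nat + J) : nat :=
  match j with inl v => if v == v0 then g else 1%N | inr j => c j end.
Definition other_leaves : seq nat :=
  [seq v <- iota 0 n | is_leaf n d v && (v != v0)].
(** The special leaf comes first: its multiples correct the values of [phi] for
    all the generators that follow. *)
Definition step_nil : seq (nat + J) :=
  map inl (v0 :: other_leaves) ++ map inr lN.
Definition step_per : seq (nat + J) := map inr lP.

Let b' := step_gen.
Let r' := step_order.
Let c' := step_index.
Let leaves := v0 :: other_leaves.

Let leavesP v : (v \in leaves) = is_leaf n d v.
Proof.
have [lf0 _] := special_leafP n_gt0 g_neq1.
rewrite inE mem_filter mem_iota; case: eqVneq => [-> | _] /=; first by rewrite lf0.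
by rewrite andbT; apply: andb_idr => /and3P[].
Qed.

Let leaves_uniq : uniq leaves.
Proof.
by rewrite /= filter_uniq ?iota_uniq // mem_filter eqxx andbF.
Qed.

Lemma size_leaves :
  size leaves = (n + n1 %/ gcdn n1 d - 2 * n1)%N.
Proof.
rewrite -count_leaf // -size_filter; apply/perm_size/uniq_perm => //.
  by rewrite filter_uniq ?iota_uniq.
move=> v; rewrite leavesP mem_filter mem_iota.
by apply/esym/andb_idr => /and3P[].
Qed.

Lemma comb_step s t x : comb b' (map inl s ++ map inr t) x =
  comb (b' \o inl) s (x \o inl) + comb b t (x \o inr).
Proof. by rewrite /comb big_cat !big_map. Qed.

Let base_mod v : base v = v %[mod n1].
Proof. by case: (base_vertexP d n_gt0 v). Qed.

(** [v] and its base have the same image under multiplication by [d]. *)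
Lemma leaf_rel v : b' (inl v) *+ d \in R.
Proof.
rewrite (rpred_congr (sand_rel_Frob n d _)) comp_polyB !comp_Xn_poly -!exprM.
apply: sand_rel_Xn; apply/eqP.
by rewrite eqn_mod_mul_quot //; apply/eqP/esym/base_mod.
Qed.

Let R_comp p : p \in R1 -> p \Po 'X^d \in R.
Proof. exact: sand_rel_comp. Qed.

Let R_R1 p : p \in R -> p \in R1.
Proof. exact: sand_rel_dvd. Qed.

Let l := lN ++ lP.
Let l' := step_nil ++ step_per.

Let l'E : l' = map inl leaves ++ map inr l.
Proof. by rewrite /l' /step_nil -catA -map_cat. Qed.

Let l'_uniq : uniq l'.
Proof.
rewrite l'E cat_uniq !map_inj_uniq ?leaves_uniq ?(cf_uniq (tower_family tw)).
- by rewrite andbT; apply/hasPn => _ /mapP[j _ ->]; apply/mapP=> -[].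
- by move=> ? ? [].
by move=> ? ? [].
Qed.

(** Up to relations for [n1] the old generators suffice. A relation for [n1] is,
    up to relations for [n], a combination of differences [X^(i + n1) - X^i],
    hence of differences [X^v - X^(base v)]. The latter is a new generator
    or zero when [v] is not a multiple of [g]; otherwise it is [s(X^d)] for some
    [s], and [s(X^d)] is spanned by the [b j (X^d) = d b j]. *)
Lemma step_family_gen p : p \in spanned b' l' R.
Proof.
have tf := tower_family tw.
have R_sp q : q \in R -> q \in spanned b' l' R by apply: spanned_rel.
have sp_gen j : j \in l' -> b' j \in spanned b' l' R by apply: spanned_gen.
have comp_sp s : s \Po 'X^d \in spanned b' l' R.
  have [x xP] := cf_gen tf (a := s) I.
  rewrite -[s](subrK (comb b l x)) comp_polyD rpredD //.
    by rewrite R_sp // R_comp.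
  rewrite raddf_sum big_seq rpred_sum // => j jl.
  rewrite (raddfMz (comp_poly 'X^d)) rpredMz //=.
  rewrite -[_ \Po _](subKr (b j *+ d)) rpredB //; last first.
    by rewrite R_sp // sand_rel_Frob.
  rewrite rpredMn //.
  apply: (sp_gen (inr j)).
  by rewrite l'E mem_cat map_f ?orbT.
have leaf_sp v : 'X^v - 'X^(base v) \in spanned b' l' R.
  pose w := (v %% n)%N; have lt_wn : (w < n)%N by rewrite ltn_mod.
  have vw : v = w %[mod n] by rewrite modn_mod.
  have -> : base v = base w.
    by apply: base_vertex_congr; rewrite /w modn_dvdm.
  rewrite -['X^v](subrK 'X^w) -addrA rpredD //.
    by rewrite R_sp // sand_rel_Xn.
  have [lf | nlf] := boolP (is_leaf n d w).
    apply: (sp_gen (inl w)).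
    by rewrite l'E mem_cat map_f ?leavesP.
  have [gw | gw] := boolP (g %| w)%N; last first.
    by rewrite [base w]base_vertex_nonleaf // subrr rpred0.
  have gb : (g %| base w)%N.
    rewrite base_vertex_dvd // (dvdn_trans _ gw) // dvdn_gcd dvdn_gcdr andbT.
    by rewrite (dvdn_trans (dvdn_gcdl _ _)) // n1_dvd.
  have [i iP] := mod_mul_gcd d_gt0 gw; have [j jP] := mod_mul_gcd d_gt0 gb.
  have /R_sp wR := sand_rel_Xn d (esym iP).
  have /R_sp bR := sand_rel_Xn d (esym jP).
  have -> : 'X^w - 'X^(base w) = ('X^w - 'X^(d * i)) - ('X^(base w) - 'X^(d * j))
      + (('X^i - 'X^j : {poly int}) \Po 'X^d).
    by rewrite comp_polyB !comp_Xn_poly -!exprM; ring.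
  by apply: rpredD; [apply: rpredB | apply: comp_sp].
have [x /sand_relP[q [a /cyc_relP[t tP]]]] := cf_gen tf (a := p) I.
have comb_sp : comb b l x \in spanned b' l' R.
  rewrite /comb big_seq rpred_sum // => j jl; rewrite rpredMz //.
  apply: (sp_gen (inr j)).
  by rewrite l'E mem_cat map_f ?orbT.
rewrite -[p](subrK (comb b l x)) rpredD //.
rewrite -[p - _](subrK (q *+ d - (q \Po 'X^d))) rpredD //; last first.
  by rewrite R_sp // sand_rel_Frob.
rewrite -[X in X \in _](subrK a%:P) rpredD //; last first.
  by rewrite R_sp // sand_rel_const.
rewrite tP (poly_sumXn t) big_distrl rpred_sum //= => i _.
rewrite mulrzAl rpredMz // mulrBr mulr1 -exprD.
have base_eq : base (i + n1) = base i.
  by apply: base_vertex_congr; rewrite modnDr.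
have -> : 'X^(i + n1) - 'X^i =
    ('X^(i + n1) - 'X^(base (i + n1))) - ('X^i - 'X^(base i)) :> {poly int}.
  by rewrite base_eq opprB addrA subrK.
exact: rpredB.
Qed.

Lemma leaf_relM v : b' (inl v) \in R1.
Proof. by apply: sand_rel_Xn; rewrite base_mod. Qed.

Lemma comb_nil (x y : J -> int) : {in lN, x =1 y} -> {in lP, x =1 fun=> 0} ->
  comb b l x = comb b lN y.
Proof.
move=> xN xP; rewrite /comb big_cat /= [X in _ + X]big1_seq ?addr0.
  by apply: eq_big_seq => j /xN->.
by move=> j /= jP; rewrite xP ?mulr0z.
Qed.

(** Reducing to the modulus [n1] kills the leaves, so the old coefficients are
    divisible by the old orders. The periodic part then drops out, and what
    remains of the old part is [d] times a combination, hence of the form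
    [y(X^d)], with exponents that are multiples of [g]. The coefficient at a
    leaf [u] therefore sees only the generator of [u], and gives divisibility by
    [d]. Finally [y(X^d)] alone is a relation, and [sand_rel_comp_inj] yields
    the missing factor [r j] in [y j]. *)
Lemma step_family_indep (x : nat + J -> int) : comb b' l' x \in R ->
  forall j, j \in l' -> ((r' j)%:Z %| x j)%Z.
Proof.
have [tf to] := (tower_family tw, tower_order tw).
have l_uniq : uniq (lN ++ lP) by exact: cf_uniq tf.
rewrite {1}l'E comb_step => xR.
have leafR1 : comb (b' \o inl) leaves (x \o inl) \in R1.
  by apply: rpred_sum => v _; rewrite rpredMz ?leaf_relM.
have old_dvd : forall j, j \in l -> ((r j)%:Z %| x (inr j))%Z.
  apply: (cf_indep tf); have := rpredB (R_R1 xR) leafR1.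
  by rewrite addrAC subrr add0r.
have perR : comb b lP (x \o inr) \in R.
  rewrite /comb big_seq rpred_sum // => j jP.
  apply: (rpredMz_dvd (m := r j)).
    exact: sand_rel_dvd nM (tower_per tw jP).
  by apply: old_dvd; rewrite mem_cat jP orbT.
pose y j := (r j %/ d)%N%:Z * (x (inr j) %/ (r j)%:Z)%Z.
have xE j : j \in lN -> x (inr j) = y j * d.
  move=> jN; have [dr r_gt0] := to _ jN.
  rewrite /y mulrAC -PoszM divnK // mulrC divzK // old_dvd //.
  by rewrite mem_cat jN.
have nilR : comb b lN (x \o inr) - (comb b lN y \Po 'X^d) \in R.
  have -> : comb b lN (x \o inr) = comb b lN y *+ d.
    by rewrite pmulrn -combM; apply: eq_comb => j /xE.
  exact: sand_rel_Frob.
have yR : comb (b' \o inl) leaves (x \o inl) + (comb b lN y \Po 'X^d) \in R.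
  have -> : comb (b' \o inl) leaves (x \o inl) + (comb b lN y \Po 'X^d) =
      comb (b' \o inl) leaves (x \o inl) + comb b l (x \o inr)
      - (comb b lN (x \o inr) - (comb b lN y \Po 'X^d)) - comb b lP (x \o inr).
    by rewrite [comb b l _]/comb big_cat -!/(comb b _ _) /=; ring.
  by apply: rpredB; first apply: rpredB.
have leaf_dvd u : u \in leaves -> (d%:Z %| x (inl u))%Z.
  move=> uL; have := uL; rewrite leavesP => /and3P[lt_un gu _].
  have mul_u i : (d * i == u %[mod n])%N = false.
    apply/eqP=> /(congr1 (dvdn g)); rewrite -!dvdn_gcd_mod (negPf gu).
    by rewrite dvdn_mulr // dvdn_gcdr.
  have ev_leaf v : v \in leaves -> ev (residue n u) (b' (inl v)) = (v == u)%:Z.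
    move=> vL; rewrite raddfB /= !ev_Xn /residue.
    have [_ lt_bn] := base_vertexP d n_gt0 v.
    rewrite !modn_small //; last by move: vL; rewrite leavesP => /and3P[].
    case: (eqVneq (base v) u) => [bu | _]; last by rewrite subr0.
    have := base_vertex_leaf n_gt0 g_neq1 v.
    by rewrite -/base bu -leavesP uL.
  have <- : ev (residue n u) (comb (b' \o inl) leaves (x \o inl)
      + (comb b lN y \Po 'X^d)) = x (inl u).
    rewrite raddfD /= ev_comp [X in _ + X]big1 ?addr0; last first.
      by move=> i _; rewrite /residue mul_u mulr0.
    have -> : ev (residue n u) (comb (b' \o inl) leaves (x \o inl)) =
        \sum_(v <- leaves) (v == u)%:Z * x (inl v).
      rewrite raddf_sum; apply: eq_big_seq => v vL.
      by rewrite raddfMz mulrzz -ev_leaf.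
    rewrite (bigD1_seq u) //= eqxx mul1r big1 ?addr0 // => v /negPf->.
    by rewrite mul0r.
  apply: sand_rel_ev yR => [i | i |].
  - by rewrite /residue modnDr subrr.
  - by rewrite /residue mul_u subr0 pmulrn mulrzz dvdz_mull.
  by have := mul_u 0%N; rewrite muln0 /residue => ->.
have leafR : comb (b' \o inl) leaves (x \o inl) \in R.
  rewrite /comb big_seq rpred_sum // => v vL.
  by apply: (rpredMz_dvd (leaf_rel v)); apply: leaf_dvd.
have yR1 : comb b lN y \in R1.
  apply: sand_rel_comp_inj => //.
  by have := rpredB yR leafR; rewrite addrAC subrr add0r.
have y_dvd j : j \in lN -> ((r j)%:Z %| y j)%Z.
  move=> jN; pose z i := if i \in lN then y i else 0.
  have zR : comb b (lN ++ lP) z \in R1.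
    rewrite (@comb_nil _ y) // /z => i iN; first by rewrite iN.
    case: ifP => // iN'; move: l_uniq; rewrite cat_uniq => /and3P[_ /hasPn].
    by move=> /(_ _ iN); rewrite /= iN'.
  by have := cf_indep tf zR (j := j); rewrite /z mem_cat jN => /(_ isT).
move=> j; rewrite l'E mem_cat => /orP[/mapP[v vL ->] | /mapP[i il ->]].
  exact: leaf_dvd.
rewrite /r' /=; case: ifP => iN; last exact: old_dvd.
by rewrite xE // PoszM mulrC dvdz_mul // y_dvd.
Qed.

Lemma step_order_nil j : j \in lN -> r' (inr j) = (d * r j)%N.
Proof. by rewrite /r' /= => ->. Qed.

Lemma step_order_per j : j \in lP -> r' (inr j) = r j.
Proof.
rewrite /r' /=; case: ifP => // jN jP.
have := cf_uniq (tower_family tw); rewrite cat_uniq => /and3P[_ /hasPn].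
by move=> /(_ _ jP); rewrite /= jN.
Qed.

Lemma step_family : cyclic_family R (fun=> True) l' b' r'.
Proof.
have [tf to] := (tower_family tw, tower_order tw).
split=> // [j||]; last by move=> p _; apply/spannedP/step_family_gen.
  rewrite l'E mem_cat => /orP[/mapP[v vL ->] | /mapP[i il ->]].
    exact: leaf_rel.
  move: il; rewrite mem_cat => /orP[iN | iP].
    have := cf_rel tf (j := i); rewrite mem_cat iN => /(_ isT)/R_comp.
    rewrite step_order_nil // mulnC mulrnA.
    by rewrite -(rpred_congr (sand_rel_Frob n d _)).
  by rewrite step_order_per // (sand_rel_dvd nM) // (tower_per tw).
exact: step_family_indep.
Qed.

Let phi_special : phi (b' (inl v0)) = n1%:Z.
Proof.
have [_ v0E] := special_leafP n_gt0 g_neq1.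
by rewrite raddfB /= !ev_Xn [X in X%:Z - _]v0E PoszD addrC addKr.
Qed.

Let phi_leaf v : (n1%:Z %| phi (b' (inl v)))%Z.
Proof.
rewrite raddfB /= !ev_Xn; have := base_mod v; move: (base v) => w wv.
rewrite -eqz_mod_dvd; apply/eqP.
by rewrite !modz_nat wv.
Qed.

(** Each value of [phi] on a leaf is a multiple of [n1], which is the value on
    the special leaf: the index is [1] and [w] a multiple of the generator of
    that leaf. *)
Lemma triangular_leaves prev s : inl v0 \in prev ->
  uniq (prev ++ map inl s) ->
  triangular R phi n b' r' c' prev (map inl s).
Proof.
elim: s prev => [|v s IHs] prev //= v0p.
rewrite -cat_rcons => uniq_p; split; last first.
  by apply: IHs => //; rewrite mem_rcons inE v0p orbT.
move: uniq_p; rewrite cat_uniq rcons_uniq => /andP[/andP[vp p_uniq] _].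
have v_v0 : (v == v0) = false.
  by apply/negbTE; apply: contra vp => /eqP->.
have /dvdzP[z zE] := phi_leaf v.
rewrite /triangular_at /= v_v0 dvd1n divn1; split=> //.
exists (fun j => if j == inl v0 then z else 0); rewrite comb_single //.
split; first by rewrite pmulrn mulrzAC -pmulrn rpredMz ?leaf_rel.
rewrite mulr1n raddfB raddfMz /= -/(b' (inl v)) zE -/(b' (inl v0)) phi_special.
by rewrite mulrzz mulrC subrr.
Qed.

(** The old [w] is killed by [r / c] modulo the relations for [n1], hence by
    [d r / c] modulo those for [n]. Its value under [phi] is right only modulo
    [n1], and is corrected by a multiple of the special leaf, killed by [d]. *)
Lemma triangular_old prev s : {subset s <= lN} ->
  triangular R1 phi n1 b r c prev s ->
  triangular R phi n b' r' c' (map inl leaves ++ map inr prev) (map inr s).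
Proof.
elim: s prev => [|j s IHs] prev //= sN [[cr [t [tR tphi]]] tri_s].
split; last first.
  rewrite -cats1 -catA -(map_cat _ prev [:: j]) cats1; apply: IHs => //.
  by move=> i is_; apply: sN; rewrite inE is_ orbT.
have jN : j \in lN by apply: sN; rewrite mem_head.
rewrite /triangular_at step_order_nil // [c' _]/=; split; first exact: dvdn_mull.
have /dvdzP[z zE] := tphi.
exists (fun i => match i with
  | inl v => if v == v0 then z else 0 | inr i => t i end).
rewrite (comb_step leaves prev) [comb b prev _](@eq_comb _ _ _ _ _ t) //.
rewrite [comb _ leaves _](_ : _ = b' (inl v0) *~ z); last first.
  by rewrite -(@comb_single _ _ (b' \o inl) leaves v0) ?mem_head.
split.
  rewrite -muln_divA // mulrnDl rpredD //.
    by rewrite mulrnA rpredMn // pmulrn mulrzAC -pmulrn rpredMz ?leaf_rel.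
  rewrite mulnC mulrnA (rpred_congr (sand_rel_Frob n d _)).
  exact: R_comp.
rewrite opprD addrCA raddfD raddfN raddfMz /= -/(b' (inl v0)) phi_special zE.
by rewrite mulrzz mulrC addNr.
Qed.

Lemma triangular_per prev s : {subset s <= lP} ->
  triangular (sand_rel M d) phi M b r c prev s ->
  triangular (sand_rel M d) phi M b' r' c' (map inr prev) (map inr s).
Proof.
elim: s prev => [|j s IHs] prev //= sP [[cr [t [tR tphi]]] tri_s].
split; last first.
  rewrite -map_rcons; apply: IHs => //.
  by move=> i is_; apply: sP; rewrite inE is_ orbT.
have jP : j \in lP by apply: sP; rewrite mem_head.
rewrite /triangular_at step_order_per //; split=> //.
exists (fun i => if i is inr i then t i else 0).
by rewrite -[map inr prev]cat0s (comb_step [::]) /comb big_nil add0r.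
Qed.

Lemma tower_step : tower d M n b' r' c' step_nil step_per.
Proof.
have to := tower_order tw.
split; first exact: step_family.
- move=> j; rewrite mem_cat => /orP[/mapP[v _ ->] | /mapP[i iN ->]].
    by rewrite /r' /= dvdnn d_gt0.
  by rewrite step_order_nil // dvdn_mulr // muln_gt0 d_gt0; have [] := to _ iN.
- apply/triangular_cat; split; last first.
    by rewrite cat0s -[map inl _]cats0; apply: triangular_old (tower_tri tw).
  rewrite /=; split; last first.
    apply: triangular_leaves; first by rewrite mem_head.
    have : uniq (map (@inl nat J) leaves).
      by rewrite map_inj_uniq ?leaves_uniq // => ? ? [].
    exact.
  rewrite /triangular_at /c' /r' /= eqxx dvdn_gcdr; split=> //.
  exists (fun=> 0); rewrite /comb big_nil mul0rn rpred0 subr0; split=> //.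
  by rewrite raddfMn [X in X *+ _]phi_special pmulrn mulrzz -PoszM -nE dvdzz.
- move=> _ /mapP[j jP ->]; rewrite step_order_per //; exact: (tower_per tw).
- exact: (triangular_per (prev := [::]) _ (tower_tri_per tw)).
rewrite -/l' l'E big_cat !big_map /= [X in (_ * X)%N](tower_prod tw).
rewrite big_cons /= eqxx big1_seq ?muln1; first by rewrite mulnC -nE.
by move=> v /=; rewrite mem_filter => /andP[/andP[_ /negPf->]].
Qed.

Lemma step_orders : [seq r' j | j <- step_nil] =
  nseq (n + n1 %/ gcdn n1 d - 2 * n1) d ++ [seq (d * r j)%N | j <- lN].
Proof.
rewrite -size_leaves map_cat -!map_comp; congr (_ ++ _).
  have map_d (s : seq nat) : [seq (r' \o inl) v | v <- s] = nseq (size s) d.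
    by elim: s => //= v s ->.
  exact: map_d.
by apply/eq_in_map => j; apply: step_order_nil.
Qed.

Lemma step_orders_kernel : [seq (r' j %/ c' j)%N | j <- step_nil] =
  (d %/ g)%N :: nseq (n + n1 %/ gcdn n1 d - 2 * n1 - 1) d
  ++ [seq (d * (r j %/ c j))%N | j <- lN].
Proof.
rewrite -size_leaves map_cat -!map_comp /= eqxx subn1 /=; congr (_ :: _ ++ _).
  have: {in other_leaves, forall v, (d %/ c' (inl v))%N = d}.
    by move=> v; rewrite mem_filter /c' /= => /andP[/andP[_ /negPf->] _]; rewrite divn1.
  elim: other_leaves => //= v s IHs d1; rewrite d1 ?mem_head // IHs // => i is_.
  by rewrite d1 // inE is_ orbT.
apply/eq_in_map => j jN; have cr := triangular_dvd (tower_tri tw) jN.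
by rewrite /comp step_order_nil // -muln_divA.
Qed.

End Step.

(** * The tower over all moduli *)

Lemma sand_rel_phi n d p : p \in sand_rel n d -> (n%:Z %| phi p)%Z.
Proof.
apply: sand_rel_ev => [i|i|]; last by rewrite dvdz0.
  by rewrite PoszD addrAC subrr add0r dvdzz.
by rewrite PoszM pmulrn mulrzz mulrC subrr dvdz0.
Qed.

(** The periodic generators may be appended after the other ones, because their
    triangularity data hold for the multiple [M] of [n]. *)
Lemma tower_kernel d M n (J : eqType) b r c (lN lP : seq J) :
  (0 < n)%N -> (n %| M)%N -> tower d M n b r c lN lP ->
  exists u, cyclic_family (sand_rel n d) (fun p => (n%:Z %| phi p)%Z)
    (lN ++ lP) u (fun j => r j %/ c j)%N.
Proof.
move=> n_gt0 nM tw; apply: triangular_kernel (tower_family tw) _ _ _ => //.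
- exact: sand_rel_phi.
- apply/triangular_cat; split; first exact: tower_tri tw.
  rewrite cat0s -[X in triangular _ _ _ _ _ _ X]cats0.
  apply: triangular_weaken (tower_tri_per tw) => [p||j jN] //.
    exact: sand_rel_dvd.
  have := cf_uniq (tower_family tw); rewrite cat_uniq => /and3P[_ /hasPn jP _].
  by apply/negP => /jP; rewrite /= jN.
- exact: tower_prod tw.
by exists 'X^1; rewrite [X in X - 1](ev_Xn Posz 1) subrr dvdz0.
Qed.

Lemma nquo_shift n d i : nquo (n %/ gcdn n d) d i = nquo n d i.+1.
Proof. by elim: i => //= i ->. Qed.

Lemma nquo_gt0 n d i : (0 < n)%N -> (0 < nquo n d i)%N.
Proof.
move=> n_gt0; elim: i => //= i IHi.
by rewrite divn_gt0 ?gcdn_gt0 ?IHi // dvdn_leq // dvdn_gcdl.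
Qed.

(** At each step the modulus loses a divisor of [d]; so [n_k * d ^ k] is a
    common multiple of all the [n_i]. *)
Lemma nquo_dvd n d i : (n %| nquo n d i * d ^ i)%N.
Proof.
elim: i => [|i IHi]; first by rewrite muln1.
rewrite (dvdn_trans IHi) //= expnSr mulnA mulnAC dvdn_mul //.
rewrite -{1}(divnK (dvdn_gcdl (nquo n d i) d)).
by rewrite dvdn_mul // dvdn_gcdr.
Qed.

Definition nil_orders n d k : seq nat :=
  flatten [seq nseq (nquo n d i + nquo n d i.+2 - 2 * nquo n d i.+1) (d ^ i.+1)
          | i <- iota 0 k]%N.

Definition nil_orders_kernel n d k : seq nat :=
  flatten [seq d ^ i.+1 %/ gcdn (nquo n d i) d
              :: nseq (nquo n d i + nquo n d i.+2 - 2 * nquo n d i.+1 - 1)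
                      (d ^ i.+1) | i <- iota 0 k]%N.

Lemma nil_ordersS n d k : nil_orders n d k.+1 =
  nseq (n + nquo n d 2 - 2 * nquo n d 1) d
  ++ [seq (d * x)%N | x <- nil_orders (n %/ gcdn n d) d k].
Proof.
rewrite /nil_orders /= expn1; congr (_ ++ _).
rewrite -[iota 1 k]/(iota (1 + 0) k) iotaDl -map_comp map_flatten -map_comp.
congr flatten; apply: eq_map => i.
by rewrite /comp map_nseq -expnS !nquo_shift.
Qed.

Lemma nil_orders_kernelS n d k : nil_orders_kernel n d k.+1 =
  (d %/ gcdn n d)%N :: nseq (n + nquo n d 2 - 2 * nquo n d 1 - 1) d
  ++ [seq (d * x)%N | x <- nil_orders_kernel (n %/ gcdn n d) d k].
Proof.
rewrite /nil_orders_kernel /= expn1; congr (_ :: _ ++ _).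
rewrite -[iota 1 k]/(iota (1 + 0) k) iotaDl -map_comp map_flatten -map_comp.
congr flatten; apply: eq_map => i.
have gd : (gcdn (nquo n d i.+1) d %| d ^ i.+1)%N.
  by rewrite expnS dvdn_mulr // dvdn_gcdr.
by rewrite /comp map_cons map_nseq !nquo_shift (muln_divA _ gd) -!expnS.
Qed.

(** Induction along the moduli [n_k, ..., n_0], starting from a purely periodic
    family for [n_k]. *)
Theorem tower_exists d M k (J0 : eqType) b0 r0 c0 (l0 : seq J0) n :
  (0 < n)%N -> (0 < d)%N -> (n %| M)%N ->
  (forall i, (i < k)%N -> gcdn (nquo n d i) d <> 1%N) ->
  tower d M (nquo n d k) b0 r0 c0 [::] l0 ->
  exists (J : eqType) b r c (lN lP : seq J),
  [/\ tower d M n b r c lN lP, [seq r j | j <- lN] = nil_orders n d k,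
      [seq (r j %/ c j)%N | j <- lN] = nil_orders_kernel n d k,
      [seq r j | j <- lP] = [seq r0 j | j <- l0]
    & [seq (r j %/ c j)%N | j <- lP] = [seq (r0 j %/ c0 j)%N | j <- l0]].
Proof.
elim: k n => [|k IHk] n n_gt0 d_gt0 nM gk tw0.
  by exists J0, b0, r0, c0, [::], l0.
have g_neq1 : gcdn n d != 1%N by apply/eqP; apply: (gk 0%N).
have n1_gt0 := nquo_gt0 d 1 n_gt0; rewrite /= in n1_gt0.
have n1M : (n %/ gcdn n d %| M)%N.
  by rewrite (dvdn_trans _ nM) // -[X in (_ %| X)%N](divnK (dvdn_gcdl n d)) dvdn_mulr.
have [||J [b [r [c [lN [lP [tw rN kN rP kP]]]]]]] := IHk _ n1_gt0 d_gt0 n1M.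
- by move=> i ik; rewrite nquo_shift; apply: gk.
- by rewrite nquo_shift.
exists (nat + J)%type, (@step_gen n d J b), (step_order d r lN).
exists (@step_index n d J c), (step_nil n d lN), (step_per lP); split.
- exact: tower_step.
- by rewrite (step_orders n_gt0 g_neq1) nil_ordersS -rN -map_comp.
- by rewrite (step_orders_kernel n_gt0 g_neq1 tw) nil_orders_kernelS -kN -map_comp.
- rewrite -rP /step_per -map_comp; apply/eq_in_map => j jP.
  by rewrite /comp (step_order_per tw).
rewrite -kP /step_per -map_comp; apply/eq_in_map => j jP.
by rewrite /comp (step_order_per tw).
Qed.

(** * Valuations of geometric sums *)

Section GeometricSums.
Local Open Scope nat_scope.

Lemma geometric_mul e P N :
  \sum_(i < P * N) e ^ i = (\sum_(i < P) e ^ i) * \sum_(j < N) (e ^ P) ^ j.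
Proof.
elim: N => [|N IHN]; first by rewrite muln0 !big_ord0 muln0.
rewrite mulnS addnC big_split_ord /= IHN big_ord_recr /= mulnDr; congr (_ + _).
rewrite -expnM big_distrl /=; apply: eq_bigr => i _.
by rewrite -expnD addnC.
Qed.

(** Modulo [p ^ 2], the [j]-th power of [1 + p x] is [1 + j p x]. *)
Lemma geometric_expansion p x N : exists z,
  \sum_(j < N) (1 + p * x) ^ j = N + p * x * 'C(N, 2) + p ^ 2 * z.
Proof.
have pow j : exists w, (1 + p * x) ^ j = 1 + j * (p * x) + p ^ 2 * w.
  elim: j => [|j [w IHj]]; first by exists 0; rewrite expn0 mul0n muln0.
  exists (w * (1 + p * x) + j * x ^ 2); rewrite expnSr IHj; ring.
elim: N => [|N [z IHN]]; first by exists 0; rewrite big_ord0 bin0n !muln0.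
have [w wE] := pow N; exists (z + w); rewrite big_ord_recr /= IHN wE binS bin1.
ring.
Qed.

(** The lifting-the-exponent lemma, for the quotient of
    [e ^ (p ^ f) - 1] by [e - 1]: raising [E = e ^ (p ^ f)] to the power [p]
    brings in the factor [1 + E + ... + E ^ (p - 1)], which is [p] modulo
    [p ^ 2] because [p] divides ['C(p, 2)] when [p] is odd, and because [4]
    divides [E - 1] when [p = 2]. *)
Lemma logn_geometric p e f : prime p -> 0 < e -> p %| e.-1 ->
  (p != 2) || (4 %| e.-1) -> logn p (\sum_(i < p ^ f) e ^ i) = f.
Proof.
move=> p_pr e_gt0 pe cond; elim: f => [|f IHf].
  by rewrite expn0 big_ord1 expn0 logn1.
have sum_gt0 E N : 0 < E -> 0 < N -> 0 < \sum_(i < N) E ^ i.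
  by case: N => // N E_gt0 _; rewrite big_ord_recl expn0.
rewrite expnSr geometric_mul lognM ?sum_gt0 ?expn_gt0 ?e_gt0 ?prime_gt0 //.
rewrite IHf -addn1; congr (_ + _).
set E := e ^ p ^ f.
have dvd_E q : q %| e.-1 -> q %| E.-1.
  by move=> qe; rewrite /E predn_exp dvdn_mulr.
have E_gt0 : 0 < E by rewrite expn_gt0 e_gt0.
suff [z ->] : exists z, \sum_(j < p) E ^ j = p * (1 + p * z).
  rewrite lognM ?(prime_gt0 p_pr) // (logn_prime p p_pr) eqxx lognE p_pr /=.
  by rewrite dvdn_addl ?dvdn_mulr // dvdn1 [p == 1](gtn_eqF (prime_gt1 p_pr)).
have [p2 | p2] := eqVneq p 2.
  move: cond; rewrite p2 /= => /dvd_E/dvdnP[z zE].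
  exists z; rewrite big_ord_recl big_ord1 expn0 expn1.
  rewrite -(prednK E_gt0) zE; ring.
have /dvdnP[x xE] := dvd_E _ pe.
have [z] := geometric_expansion p x p.
rewrite mulnC -xE add1n prednK // => ->.
have : p %| 'C(p, 2).
  by apply: prime_dvd_bin => //=; rewrite ltn_neqAle eq_sym p2 prime_gt1.
by move=> /dvdnP[y ->]; exists (x * y + z); rewrite xE; ring.
Qed.

(** Used with [e = d ^ o(v)] and [s = v], to find a multiple [t] of a generator
    of order [d ^ o - 1], where [o] is the order of [d] modulo [p ^ a], that
    has the same [p]-part as [v] and is still killed by [e - 1]. The sum of
    the first [P = p ^ f] powers of [e] has exactly the valuation [f] of [s], so
    a multiple [t] of it solves [s = t (mod p ^ a)], and [(e - 1) * t] is a
    multiple of [e ^ P - 1], which [p ^ a] divides. When [p ^ a] divides [s],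
    take [t = 0]. *)
Lemma geometric_solution p a e s : prime p -> 0 < e ->
  p ^ a %| e.-1 * s ->
  [|| p != 2, 4 %| e.-1 | ~~ (p %| s)] ->
  exists t P y, [/\ s = t %[mod p ^ a], p ^ a %| (e ^ P).-1 \/ y = 0
    & e.-1 * t = (e ^ P).-1 * y].
Proof.
move=> p_pr e_gt0 es cond.
have [as_ | nas] := boolP (p ^ a %| s).
  exists 0, 0, 0; rewrite muln0; split=> //; last by right.
  by rewrite mod0n; apply/eqP.
have s_gt0 : 0 < s by case: s nas {es cond} => //; rewrite dvdn0.
set f := logn p s; have [s' s'p sE] := pfactor_coprime p_pr s_gt0.
rewrite -/f in sE.
have lt_fa : f < a by rewrite ltnNge -pfactor_dvdn.
have aE : p ^ a = p ^ (a - f) * p ^ f by rewrite -expnD subnK // ltnW.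
have e_dvd : p ^ (a - f) %| e.-1.
  move: es; rewrite sE mulnA aE dvdn_pmul2r ?expn_gt0 ?prime_gt0 //.
  by rewrite mulnC Gauss_dvdr // coprime_pexpl ?subn_gt0.
pose Q := \sum_(i < p ^ f) e ^ i.
have pe : p %| e.-1 by rewrite (dvdn_trans _ e_dvd) // dvdn_exp ?subn_gt0.
have Qf : logn p Q = f.
  have [f0 | f_gt0] := posnP f.
    by rewrite /Q f0 expn0 big_ord1 expn0 logn1.
  apply: logn_geometric => //; move: cond; case: (p != 2) => //=.
  by rewrite -[p in p %| s]expn1 pfactor_dvdn // -/f f_gt0 orbF.
have Q_gt0 : 0 < Q.
  have : 0 < p ^ f by rewrite expn_gt0 prime_gt0.
  by rewrite /Q; case: (p ^ f) => // N _; rewrite big_ord_recl expn0.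
have [Q' Q'p QE] := pfactor_coprime p_pr Q_gt0.
have Q'_gt0 : 0 < Q' by move: Q_gt0; rewrite QE muln_gt0 => /andP[].
have [|y yP] := @mod_mul_gcd (p ^ a) Q' Q'_gt0 s'.
  have /eqP-> : coprime (p ^ a) Q' by rewrite coprimeXl.
  exact: dvd1n.
exists (Q * y), (p ^ f), y; split.
- have -> : Q * y = Q' * y * p ^ f by rewrite QE Qf mulnAC.
  by rewrite [in LHS]sE -modnMml -yP modnMml.
- by left; rewrite predn_exp -/Q QE Qf aE mulnA dvdn_mul // dvdn_mulr.
by rewrite predn_exp mulnA.
Qed.

End GeometricSums.

(** * Orbits of multiplication by [d] on residues prime to [d] *)

Section Orbits.
Local Open Scope nat_scope.
Variables m d : nat.
Hypotheses (m_gt0 : 0 < m) (md : coprime m d).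

Definition residue_ord (a : nat) : 'I_m := Ordinal (ltn_pmod a m_gt0).

Lemma eqn_mod_mul_coprime i j : (d * i == d * j %[mod m]) = (i == j %[mod m]).
Proof.
have -> : (d * i == d * j %[mod m]) = (i == j %[mod m %/ gcdn m d]).
  exact: eqn_mod_mul_quot.
by rewrite (eqP md) divn1.
Qed.

Lemma mulmod_inj : injective (@mulmod m d).
Proof.
move=> v w /(congr1 val) /= /eqP; rewrite !addn0 eqn_mod_mul_coprime.
by rewrite !modn_small // => /eqP/val_inj.
Qed.

Lemma iter_mulmod a v : val (iter a (@mulmod m d) v) = d ^ a * v %% m.
Proof.
elim: a => [|a IHa]; first by rewrite mul1n modn_small.
by rewrite iterS /= addn0 IHa modnMmr expnS mulnA.
Qed.

Lemma mem_orb (v w : 'I_m) :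
  reflect (exists a, w = d ^ a * v %[mod m]) (w \in orb d v).
Proof.
rewrite inE -fconnect_orbit; apply: (iffP idP) => [/iter_findex <- | [a aE]].
  by exists (findex (@mulmod m d) v w); rewrite iter_mulmod modn_mod.
have -> : w = iter a (@mulmod m d) v; last exact: fconnect_iter.
by apply: val_inj; rewrite iter_mulmod -aE modn_small.
Qed.

Lemma orb_refl (v : 'I_m) : v \in orb d v.
Proof. by apply/mem_orb; exists 0; rewrite mul1n. Qed.

Lemma card_orb (v : 'I_m) : #|orb d v| = order (@mulmod m d) v.
Proof.
by rewrite cardsE; have /card_uniqP-> := orbit_uniq (@mulmod m d) v; rewrite size_orbit.
Qed.

Lemma card_orb_gt0 (v : 'I_m) : 0 < #|orb d v|.
Proof. by apply/card_gt0P; exists v; apply: orb_refl. Qed.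

(** The orbit size is the order of [d] modulo [m / gcd(m, v)]. *)
Lemma orb_order (v : 'I_m) a :
  (d ^ a * v == v %[mod m]) = (#|orb d v| %| a).
Proof.
set o := #|orb d v|; have o_gt0 : 0 < o by apply: card_orb_gt0.
have iterE b : (d ^ b * v == v %[mod m]) = (iter b (@mulmod m d) v == v).
  by rewrite -val_eqE iter_mulmod [in X in _ == X]modn_small.
have iter_o q : iter (q * o) (@mulmod m d) v = v.
  elim: q => // q IHq; rewrite mulSn iterD IHq /o card_orb.
  exact: iter_order mulmod_inj v.
rewrite iterE {1}(divn_eq a o) addnC iterD iter_o /dvdn.
apply/eqP/eqP => [a_o | ->] //.
have := @findex_iter _ (@mulmod m d) v (a %% o).
by rewrite -card_orb ltn_mod a_o findex0 => /(_ o_gt0).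
Qed.

Lemma orb_eq (v w : 'I_m) : w \in orb d v -> orb d w = orb d v.
Proof.
rewrite inE -fconnect_orbit => vw; apply/setP => u; rewrite !inE -!fconnect_orbit.
by rewrite (same_connect (fconnect_sym mulmod_inj) vw).
Qed.

Variable V : {set 'I_m}.
Hypothesis V_reps : is_transversal V (nonzero_orbits m d) [set v | val v != 0].

Lemma reps_neq0 v : v \in V -> val v != 0.
Proof. by move/(subsetP (transversal_sub V_reps)); rewrite inE. Qed.

Let orb_nonzero (v : 'I_m) : val v != 0 ->
  exists u, V :&: orb d v = [set u].
Proof.
move=> v0; have /and3P[_ _ /forall_inP/(_ (orb d v))] := V_reps.
move=> /(_ _)/cards1P; apply; rewrite !inE imset_f // andbT.
apply/negP => /eqP/setP/(_ v); rewrite orb_refl inE.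
by rewrite (negPf v0).
Qed.

Lemma reps_inj v w : v \in V -> w \in V -> w \in orb d v -> w = v.
Proof.
move=> vV wV wv; have [u /setP uE] := orb_nonzero (reps_neq0 vV).
have := uE v; have := uE w; rewrite !in_setI !in_set1 vV wV wv orb_refl.
by move=> /esym/eqP-> /esym/eqP->.
Qed.

Lemma reps_cover w : val w != 0 -> exists2 v, v \in V & w \in orb d v.
Proof.
move=> w0; have [u /setP/(_ u)] := orb_nonzero w0.
rewrite in_setI in_set1 eqxx => /andP[uV uw]; exists u => //.
by rewrite (orb_eq uw) orb_refl.
Qed.

End Orbits.

(** * The periodic vertices *)

Section Periodic.
Variables m d k : nat.
Hypotheses (m_gt0 : (0 < m)%N) (d_gt0 : (0 < d)%N) (md : coprime m d).
Variable V : {set 'I_m}.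
Hypothesis V_reps : is_transversal V (nonzero_orbits m d) [set v | val v != 0%N].

Let M := (m * d ^ k)%N.
(* By Euler [d ^ K = 1] modulo [m], and [d ^ K] is a multiple of [d ^ k] since
   [K >= k]. *)
Let K := (k * totient m)%N.

Let dK : d ^ K = 1 %[mod m].
Proof.
rewrite /K mulnC expnM -modnXm Euler_exp_totient; first by rewrite modnXm exp1n.
by rewrite coprime_sym.
Qed.

Let M_dvd a : (m %| a)%N -> (M %| a * d ^ K)%N.
Proof.
move=> ma; rewrite dvdn_mul // dvdn_exp2l // leq_pmulr //.
by rewrite totient_gt0.
Qed.

(** The exponent [v * d ^ K] is the periodic lift of the residue [v], for all
    the moduli between [m] and [M] at once. *)
Definition per_gen (v : 'I_m) : {poly int} := 'X^(v * d ^ K).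
Definition per_order (v : 'I_m) : nat := (d ^ #|orb d v| - 1)%N.

Lemma sand_rel_iter n a s : 'X^s *+ d ^ a - 'X^(d ^ a * s) \in sand_rel n d.
Proof.
elim: a => [|a IHa]; first by rewrite mul1n mulr1n subrr rpred0.
rewrite -['X^s *+ _](subrK ('X^(d ^ a * s) *+ d)) -addrA rpredD //.
  by rewrite expnSr mulrnA -mulrnBl rpredMn.
rewrite expnS -mulnA; have := sand_rel_Frob n d 'X^(d ^ a * s).
by rewrite comp_Xn_poly -exprM.
Qed.

Lemma per_order_dvd v a : (#|orb d v| %| a)%N -> (per_order v %| d ^ a - 1)%N.
Proof.
move=> /dvdnP[q ->]; rewrite /per_order mulnC expnM !subn1 [X in (_ %| X)%N]predn_exp.
exact: dvdn_mulr.
Qed.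

Lemma per_order_rel v : per_gen v *+ per_order v \in sand_rel M d.
Proof.
rewrite /per_order mulrnBr ?expn_gt0 ?d_gt0 // mulr1n.
rewrite -[_ *+ _](subrK 'X^(d ^ #|orb d v| * (v * d ^ K))) -addrA rpredD //.
  exact: sand_rel_iter.
apply: sand_rel_Xn; apply/eqP; set o := #|orb d v|.
rewrite eqn_mod_dvd; last by rewrite leq_pmull ?expn_gt0 ?d_gt0.
rewrite mulnA -mulnBl M_dvd // -eqn_mod_dvd ?leq_pmull ?expn_gt0 ?d_gt0 //.
by rewrite orb_order.
Qed.

(** In the group, [X^(d ^ a * v)] is [d ^ a] times the generator of the orbit
    of [v]; this functional reads off that multiple, which is defined modulo
    [d ^ o(v) - 1]. *)
Definition orbit_weight (v : 'I_m) (i : nat) : int :=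
  \sum_(a < #|orb d v|) (d ^ a)%N%:Z * (i == d ^ a * v %[mod m])%N%:Z.

Lemma orbit_weight_gen (v w : 'I_m) : v \in V -> w \in V ->
  orbit_weight v (w * d ^ K) = (w == v)%:Z.
Proof.
move=> vV wV; rewrite /orbit_weight.
have wK (u : nat) : (u * d ^ K)%N = u %[mod m] by rewrite -modnMmr dK modnMmr muln1.
have [-> | ne] := eqVneq w v.
  rewrite (bigD1 (Ordinal (card_orb_gt0 d v))) //= mul1n wK eqxx mulr1.
  rewrite big1 ?addr0 // => a; rewrite -val_eqE /= => a0.
  by rewrite eq_sym orb_order // gtnNdvd ?mulr0 // lt0n.
rewrite big1 // => a _; rewrite wK; case: eqP => [wv | _]; last by rewrite mulr0.
case/eqP: ne; apply: (reps_inj V_reps vV wV).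
by apply/mem_orb; exists a.
Qed.

(** Passing from [i] to [d * i] shifts the sum by one place around the orbit,
    at the cost of a factor [d ^ o(v) - 1] where it closes up. *)
Lemma orbit_weight_rel v p : v \in V -> p \in sand_rel m d ->
  ((per_order v)%:Z %| ev (orbit_weight v) p)%Z.
Proof.
move=> vV; set o := #|orb d v|; apply: sand_rel_ev => [i|i|].
- rewrite /orbit_weight -sumrB big1 ?dvdz0 // => a _.
  by rewrite modnDr subrr.
- pose G a := (d * i == d ^ a * v %[mod m])%N%:Z.
  have -> : orbit_weight v i *+ d - orbit_weight v (d * i) =
      (per_order v)%:Z * G 0%N.
    have -> : orbit_weight v (d * i) = \sum_(a < o) (d ^ a)%N%:Z * G a by [].
    have -> : orbit_weight v i *+ d = \sum_(a < o) (d ^ a.+1)%N%:Z * G a.+1.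
      rewrite -sumrMnl; apply: eq_bigr => a _.
      rewrite /G expnS -mulnA eqn_mod_mul_coprime // PoszM.
      by rewrite pmulrn mulrzz mulrC mulrA.
    have Go : G o = G 0%N.
      rewrite /G; have /eqP-> : (d ^ o * v == v %[mod m])%N by rewrite orb_order.
      by rewrite mul1n.
    have : \sum_(a < o.+1) (d ^ a)%N%:Z * G a =
        \sum_(a < o) (d ^ a)%N%:Z * G a + (d ^ o)%N%:Z * G o.
      by rewrite big_ord_recr.
    rewrite big_ord_recl /= expn0 mul1r Go => /(canRL (addKr _)) ->.
    rewrite /per_order -/o -subzn ?expn_gt0 ?d_gt0 //.
    move: (\sum_(a < o) _) => S; ring.
  by rewrite dvdz_mulr.
rewrite /orbit_weight big1 ?dvdz0 // => a _.
case: eqP => [|_]; last by rewrite mulr0.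
rewrite mod0n => /esym/eqP va; have := reps_neq0 V_reps vV.
have : (m %| v)%N by rewrite -(@Gauss_dvdr _ (d ^ a)) // coprimeXr.
by rewrite /dvdn modn_small // => ->.
Qed.

Lemma sand_rel_per_gen (v : 'I_m) a : 'X^(d ^ a * v) - per_gen v *+ d ^ a \in sand_rel m d.
Proof.
rewrite -['X^_](subrK ('X^v *+ d ^ a)) -addrA rpredD //.
  by rewrite -opprB rpredN sand_rel_iter.
rewrite -mulrnBl rpredMn // sand_rel_Xn //.
by rewrite -modnMmr dK modnMmr muln1.
Qed.

Lemma ev_per_genM f v z : ev f (per_gen v *~ z) = f (v * d ^ K)%N * z.
Proof. by rewrite (raddfMz (ev f)) /= ev_Xn mulrzz. Qed.

(** Every residue is zero or some [d ^ a * v]; independence holds because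
    the functionals [orbit_weight v] are dual to the generators. *)
Lemma per_family :
  cyclic_family (sand_rel m d) (fun=> True) (enum V) per_gen per_order.
Proof.
split=> //; first exact: enum_uniq.
- move=> v _; apply: sand_rel_dvd (per_order_rel v); exact: dvdn_mulr.
- move=> x xR v; rewrite mem_enum => vV.
  have := orbit_weight_rel vV xR; rewrite raddf_sum (bigD1_seq v) ?mem_enum ?enum_uniq //=.
  rewrite big1_seq ?addr0 => [|w /andP[/negPf ne]].
    by rewrite ev_per_genM orbit_weight_gen // eqxx mul1r.
  by rewrite mem_enum ev_per_genM => wV; rewrite orbit_weight_gen // ne mul0r.
move=> p _; apply/spannedP; move: p; apply: poly_zmod_ind => i.
pose w := residue_ord m_gt0 i.
rewrite -['X^i](subrK 'X^w) rpredD //.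
  by rewrite spanned_rel // sand_rel_Xn // modn_mod.
have [w0 | /(reps_cover m_gt0 md V_reps)[v vV]] := eqVneq (val w) 0%N.
  by rewrite [nat_of_ord w]w0 spanned_rel // (sand_rel_const m d 1).
case/mem_orb => a wE.
rewrite -['X^w](subrK 'X^(d ^ a * v)) rpredD //.
  by rewrite spanned_rel // sand_rel_Xn.
rewrite -['X^_](subrK (per_gen v *+ d ^ a)) rpredD //.
  by rewrite spanned_rel // sand_rel_per_gen.
by rewrite rpredMn // spanned_gen ?mem_enum ?enum_uniq.
Qed.

End Periodic.

(** * The special periodic vertices *)

Section Specials.
Variables m d k : nat.
Hypotheses (m_gt0 : (0 < m)%N) (d_gt0 : (0 < d)%N) (md : coprime m d).
Variable V : {set 'I_m}.
Hypothesis V_reps : is_transversal V (nonzero_orbits m d) [set v | val v != 0%N].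
Hypothesis V_prime_powers : forall (p j : nat) (v : 'I_m),
  prime p -> (p %| m)%N -> (0 < j)%N -> (p ^ j %| m)%N ->
  val v = (m %/ p ^ j)%N -> v \in V.

Let M := (m * d ^ k)%N.
Let K := (k * totient m)%N.
Local Notation b := (@per_gen m d k).
Local Notation r := (@per_order m d).
Local Notation c := (fun v : 'I_m => cfactor m d v).

(** The case where the order of [d] modulo powers of [2] escapes the
    lifting-the-exponent lemma. *)
Definition exceptional := (4 %| m)%N && (d %% 4 == 3)%N.
Definition half : 'I_m := residue_ord m_gt0 (m %/ 2).
Definition special (p : nat) : 'I_m := residue_ord m_gt0 (m %/ m`_p).
Definition specials : seq 'I_m :=
  (if exceptional then [:: half] else [::]) ++ [seq special p | p <- primes m].

Lemma part_primes p : p \in primes m -> (m`_p %| m)%N /\ (1 < m`_p)%N.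
Proof.
move=> pm; split; first exact: dvdn_part.
move: (pm); rewrite mem_primes => /and3P[p_pr _ _].
by rewrite p_part -{1}(expn0 p) ltn_exp2l ?prime_gt1 // logn_gt0.
Qed.

Lemma val_special p : p \in primes m -> val (special p) = (m %/ m`_p)%N.
Proof. by move=> /part_primes[_ q_gt1]; rewrite /= modn_small // ltn_Pdiv. Qed.

Lemma val_half : exceptional -> val half = (m %/ 2)%N.
Proof. by move=> _; rewrite /= modn_small // ltn_Pdiv. Qed.

Lemma part_div_inj q q' : (q %| m)%N -> (q' %| m)%N ->
  (m %/ q = m %/ q')%N -> q = q'.
Proof.
move=> qm q'm eq_div; have q_gt0 : (0 < m %/ q)%N.
  by rewrite divn_gt0 ?(dvdn_leq _ qm) // (dvdn_gt0 m_gt0 qm).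
apply/eqP; rewrite -(eqn_pmul2l q_gt0) {2}eq_div.
by rewrite !divnK.
Qed.

Lemma special_inj : {in primes m &, injective special}.
Proof.
move=> p q pm qm /(congr1 val); rewrite !val_special // => /part_div_inj.
move=> /(_ (dvdn_part _ _) (dvdn_part _ _)) pq.
move: pm qm; rewrite !mem_primes => /and3P[p_pr _ pm] /and3P[q_pr _ qm].
have : (p %| m`_p)%N by rewrite p_part -{1}(expn1 p) dvdn_exp2l // logn_gt0 mem_primes p_pr m_gt0.
by rewrite pq p_part Euclid_dvdX // dvdn_prime2 // => /andP[/eqP].
Qed.

Lemma half_special p : exceptional -> p \in primes m -> special p != half.
Proof.
move=> ex pm; apply/eqP => /(congr1 val); rewrite val_special // val_half //.
have /andP[m4 _] := ex; have m2 : (2 %| m)%N by apply: dvdn_trans m4.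
move=> /(part_div_inj (dvdn_part _ _) m2) p2.
have p_2 : p = 2%N.
  move: pm; rewrite mem_primes => /and3P[p_pr _ pm].
  apply/eqP; rewrite -dvdn_prime2 // -p2 p_part -{1}(expn1 p) dvdn_exp2l //.
  by rewrite logn_gt0 mem_primes p_pr m_gt0.
have : (4 %| m`_p)%N.
  by rewrite p_2 p_part (@dvdn_exp2l 2 2) // -pfactor_dvdn.
by rewrite p2.
Qed.

Lemma specials_uniq : uniq specials.
Proof.
rewrite /specials cat_uniq (map_inj_in_uniq special_inj) primes_uniq andbT.
apply/andP; split; first by case: ifP.
apply/hasPn => _ /mapP[p pm ->] /=; case: ifP => // ex.
by rewrite inE half_special.
Qed.

Lemma specials_half : exceptional -> half \in specials.
Proof. by rewrite /specials => ->; rewrite mem_head. Qed.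

Lemma specials_special p : p \in primes m -> special p \in specials.
Proof. by move=> pm; rewrite mem_cat map_f ?orbT. Qed.

Lemma specials_reps : {subset specials <= V}.
Proof.
move=> v; rewrite mem_cat => /orP[|/mapP[p pm ->]].
  case: ifP => // ex; rewrite inE => /eqP->.
  have /andP[m4 _] := ex; have m2 : (2 %| m)%N by apply: dvdn_trans m4.
  by apply: (@V_prime_powers 2 1); rewrite // val_half.
have [qm q_gt1] := part_primes pm.
move: (pm); rewrite mem_primes => /and3P[p_pr _ p_m].
apply: (@V_prime_powers p (logn p m)) => //; rewrite -?p_part ?val_special //.
by rewrite logn_gt0.
Qed.

Lemma cfactor_half : exceptional -> c half = 2%N.
Proof.
by move=> ex; rewrite /cfactor; have /andP[-> ->] := ex; rewrite -val_half ?eqxx.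
Qed.

Lemma odd_multiplier : (2 %| m)%N -> odd d.
Proof.
move=> /(coprime_dvdl)/(_ md); rewrite coprime2n; exact.
Qed.

Lemma cfactor_special p : p \in primes m ->
  c (special p) = (if exceptional && (p == 2%N) then m`_2 %/ 2 else m`_p)%N.
Proof.
move=> pm; rewrite /cfactor.
case: ifP => [/and3P[m4 d3 /eqP sp_half] | _].
  have ex : exceptional by rewrite /exceptional m4.
  by have /eqP[] := half_special ex pm; apply: val_inj; rewrite [LHS]sp_half val_half.
have -> : [seq q : nat <- primes m | nat_of_ord (special p) == m %/ m`_q]%N = [:: p].
  rewrite (@eq_in_filter _ _ (pred1 p)) ?filter_pred1_uniq ?primes_uniq //.
  move=> q qm /=; rewrite -(val_special qm); apply/eqP/eqP => [eq_sp|-> //].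
  by apply: special_inj => //; apply/val_inj/esym.
rewrite /exceptional; case: (eqVneq p 2%N) => [-> | _] /=; last by rewrite andbF.
rewrite andbT; case: (boolP (4 %| m)%N) => m4 /=; last by rewrite orbT.
rewrite orbF; have : odd d by apply: odd_multiplier; apply: dvdn_trans m4.
have -> : odd d = odd (d %% 4) by rewrite {1}(divn_eq d 4) oddD oddM andbF.
by have := ltn_pmod d (isT : 0 < 4)%N; case: (d %% 4)%N => [|[|[|[|]]]].
Qed.

Lemma cfactor_other (v : 'I_m) : v \notin specials -> c v = 1%N.
Proof.
move=> vS; rewrite /cfactor; case: ifP => [/and3P[m4 d3 /eqP vh] | _].
  have ex : exceptional by rewrite /exceptional m4.
  have v_half : v = half by apply: val_inj; rewrite val_half.
  by rewrite v_half specials_half in vS.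
rewrite (@eq_in_filter _ _ pred0) ?filter_pred0 // => p pm /=.
apply/negbTE; apply: contra vS => /eqP vp.
have -> : v = special p by apply: val_inj; rewrite val_special.
exact: specials_special.
Qed.

(** The special vertices come first, with [half] at the head, so that they are
    available to all the others in the triangular change of generators. *)
Definition rep_order : seq 'I_m := specials ++ [seq v <- enum V | v \notin specials].

Lemma perm_rep_order : perm_eq rep_order (enum V).
Proof.
apply: uniq_perm; rewrite ?enum_uniq //.
  rewrite cat_uniq specials_uniq filter_uniq ?enum_uniq // andbT.
  by apply/hasPn => v; rewrite mem_filter => /andP[].
move=> v; rewrite mem_cat mem_filter mem_enum.
by case: (boolP (v \in specials)) => //= /specials_reps->.
Qed.

(** The prime powers dividing [m] exactly multiply to [m]; in the exceptional
    case [half] takes one factor [2] away from the vertex of the prime [2]. *)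
Lemma prod_cfactor : (\prod_(v <- rep_order) c v)%N = m.
Proof.
rewrite big_cat /= [X in (_ * X)%N]big1_seq ?muln1; last first.
  by move=> v; rewrite mem_filter => /andP[_ /andP[/cfactor_other-> _]].
have prod_parts : (\prod_(p <- primes m) m`_p)%N = m.
  rewrite [RHS](prod_prime_decomp m_gt0) prime_decompE big_map.
  by apply: eq_bigr => p _; rewrite p_part.
rewrite big_cat big_map /=; case: ifP => ex; last first.
  rewrite big_nil mul1n -[RHS]prod_parts; apply: eq_big_seq => p pm.
  by rewrite cfactor_special // ex.
have /andP[m4 _] := ex; have pm2 : 2%N \in primes m.
  by rewrite mem_primes m_gt0 /=; apply: dvdn_trans m4.
rewrite big_seq1 cfactor_half // -[RHS]prod_parts.
rewrite (bigD1_seq 2%N) ?primes_uniq //= [RHS](bigD1_seq 2%N) ?primes_uniq //=.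
rewrite mulnA; congr (_ * _)%N.
  rewrite cfactor_special // ex /= mulnC divnK // p_part.
  by rewrite (@dvdn_exp2l 2 1) // logn_gt0.
rewrite big_seq_cond [RHS]big_seq_cond; apply: eq_bigr => p /andP[pm p2].
by rewrite cfactor_special // ex (negPf p2).
Qed.

(** As [phi] takes the value [v * d ^ K] on the generator of [v], a congruence
    modulo [m] between residues suffices: the factor [d ^ K] raises it to the
    modulus [M]. *)
Lemma per_triangular_at prev (v : 'I_m) (t : 'I_m -> int) :
  (c v %| r v)%N ->
  (forall i, ((r i)%:Z %| t i * (r v %/ c v)%N%:Z)%Z) ->
  (m%:Z %| (c v * v)%N%:Z - \sum_(i <- prev) t i * (val i)%:Z)%Z ->
  triangular_at (sand_rel M d) phi M b r c prev v.
Proof.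
move=> cr tr tm; split=> //; exists t; split.
  rewrite pmulrn -combM /comb rpred_sum // => i _.
  exact: (rpredMz_dvd (per_order_rel k m_gt0 d_gt0 md i)).
have phi_gen (i : 'I_m) : phi (b i) = (val i)%:Z * (d ^ K)%N%:Z.
  by rewrite ev_Xn PoszM.
have -> : phi (b v *+ c v - comb b prev t) =
    ((c v * v)%N%:Z - \sum_(i <- prev) t i * (val i)%:Z) * (d ^ K)%N%:Z.
  rewrite raddfB raddfMn /= phi_gen mulrBl PoszM; congr (_ - _).
    by rewrite pmulrn mulrzz mulrC mulrA.
  rewrite raddf_sum mulr_suml; apply: eq_bigr => i _.
  by rewrite raddfMz [X in X *~ _]phi_gen mulrzz mulrC mulrA.
have -> : M%:Z = m%:Z * (d ^ k)%N%:Z by rewrite -PoszM.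
apply: dvdz_mul => //; rewrite dvdzE /= dvdn_exp2l // leq_pmulr //.
by rewrite totient_gt0.
Qed.

Lemma mul_div_dvd q x : (q %| m)%N -> (m %| x * (m %/ q))%N = (q %| x)%N.
Proof.
move=> qm; rewrite -{1}(divnK qm) mulnC dvdn_pmul2r //.
by rewrite divn_gt0 ?(dvdn_leq _ qm) // (dvdn_gt0 m_gt0 qm).
Qed.

Lemma orb_dvd (v : 'I_m) a : (m %| (d ^ a - 1) * v)%N = (#|orb d v| %| a)%N.
Proof.
rewrite -(orb_order m_gt0 md) eqn_mod_dvd ?leq_pmull ?expn_gt0 ?d_gt0 //.
by rewrite mulnBl mul1n.
Qed.

Lemma orb_special p a : p \in primes m ->
  (m`_p %| d ^ a - 1)%N = (#|orb d (special p)| %| a)%N.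
Proof.
by move=> pm; rewrite -orb_dvd val_special // mul_div_dvd // dvdn_part.
Qed.

Lemma per_order_half a : exceptional -> (r half %| d ^ a - 1)%N.
Proof.
move=> ex; apply: per_order_dvd; apply: dvdn_trans (dvd1n a).
have /andP[m4 _] := ex; have m2 : (2 %| m)%N by apply: dvdn_trans m4.
rewrite -orb_dvd val_half // mul_div_dvd // expn1 dvdn2 oddB //.
by rewrite odd_multiplier.
Qed.

(** Here [2 * half = m], so that [w = 0] works. *)
Lemma triangular_half prev : exceptional ->
  triangular_at (sand_rel M d) phi M b r c prev half.
Proof.
move=> ex; have /andP[m4 _] := ex; have m2 : (2 %| m)%N by apply: dvdn_trans m4.
apply: (per_triangular_at (t := fun=> 0)).
- rewrite cfactor_half // /per_order dvdn2 oddB ?expn_gt0 ?d_gt0 //.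
  by rewrite oddX odd_multiplier ?orbT.
- by move=> i; rewrite mul0r dvdz0.
rewrite big1 ?subr0 => [|i _]; last by rewrite mul0r.
by rewrite cfactor_half // [nat_of_ord half]val_half // mulnC divnK // dvdzz.
Qed.

Lemma sum_single (prev : seq 'I_m) i (z : int) : uniq prev -> i \in prev ->
  \sum_(j <- prev) (if j == i then z else 0) * (val j)%:Z = z * (val i)%:Z.
Proof.
move=> p_uniq ip; rewrite (bigD1_seq i) //= eqxx big1 ?addr0 // => j /negPf->.
by rewrite mul0r.
Qed.

Lemma cfactor_special_dvd p : p \in primes m -> (c (special p) %| r (special p))%N.
Proof.
move=> pm; have q_dvd : (m`_p %| r (special p))%N by rewrite orb_special.
rewrite cfactor_special //; case: ifP => // /andP[_ /eqP p2].
rewrite -p2 (dvdn_trans _ q_dvd) // p2.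
have : (2 %| m`_2)%N by rewrite p_part (@dvdn_exp2l 2 1) // logn_gt0 -p2.
by move=> q2; rewrite -{2}(divnK q2) dvdn_mulr.
Qed.

(** Here [o(half) = 1], and [d - 1] is [2] times an odd number, which is prime to
    [m`_2 / 2]; one factor [2] is left in the quotient because the whole of [m`_2]
    divides the order. *)
Lemma half_order_dvd : exceptional ->
  (r half %| r (special 2) %/ (m`_2 %/ 2))%N.
Proof.
move=> ex; have /andP[m4 /eqP d3] := ex.
have pm2 : 2%N \in primes m.
  by rewrite mem_primes m_gt0 /=; apply: dvdn_trans m4.
have q2 : (2 %| m`_2)%N by rewrite p_part (@dvdn_exp2l 2 1) // logn_gt0.
have q_dvd : (m`_2 %| r (special 2))%N by rewrite orb_special.
have q2_dvd : (m`_2 %/ 2 %| r (special 2))%N.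
  by rewrite (dvdn_trans _ q_dvd) // -{2}(divnK q2) dvdn_mulr.
have q2_gt0 : (0 < m`_2 %/ 2)%N by rewrite divn_gt0 // dvdn_leq.
set x := (_ %/ (m`_2 %/ 2))%N.
have xE : (x * (m`_2 %/ 2) = r (special 2))%N by rewrite divnK.
have x2 : (2 %| x)%N.
  by rewrite -(dvdn_pmul2r q2_gt0) xE mulnC divnK.
have h_dvd : (r half %| x * (m`_2 %/ 2))%N by rewrite xE per_order_half.
have h1 : r half = (d - 1)%N.
  have m2 : (2 %| m)%N by apply: dvdn_trans m4.
  have : (#|orb d half| %| 1)%N.
    by rewrite -orb_dvd val_half // mul_div_dvd // expn1 dvdn2 oddB // odd_multiplier.
  by rewrite dvdn1 /per_order => /eqP->.
pose w := (d %/ 4 * 2 + 1)%N.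
have hE : r half = (2 * w)%N.
  rewrite h1 {1}(divn_eq d 4) d3 /w; move: (d %/ 4)%N => a; lia.
have w_odd : coprime 2%N w by rewrite coprime2n /w oddD oddM andbF.
rewrite hE Gauss_dvd // x2 /=.
have : (w %| x * (m`_2 %/ 2))%N by rewrite (dvdn_trans _ h_dvd) // hE dvdn_mull.
rewrite Gauss_dvdl //.
suff: coprime w (m`_2)%N by apply: coprime_dvdr; rewrite -{2}(divnK q2) dvdn_mulr.
by rewrite p_part coprime_sym coprimeXl.
Qed.

(** The multiple [c v * v] is [m] with [w = 0], or else it is [m / 2], the value of
    [half]. *)
Lemma triangular_special prev p : p \in primes m -> uniq prev ->
  (exceptional -> half \in prev) ->
  triangular_at (sand_rel M d) phi M b r c prev (special p).
Proof.
move=> pm p_uniq half_p; have cr := cfactor_special_dvd pm.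
have [qm q_gt1] := part_primes pm.
have [/andP[ex /eqP p2] | not_ex] := boolP (exceptional && (p == 2%N)); last first.
  apply: (per_triangular_at (t := fun=> 0)) => //.
  rewrite big1 ?subr0 => [|i _]; last by rewrite mul0r.
  rewrite cfactor_special // (negPf not_ex) [nat_of_ord _]val_special //.
  by rewrite mulnC divnK // dvdzz.
rewrite p2 in pm qm cr *; have /andP[m4 _] := ex.
have q4 : (4 %| m`_2)%N by rewrite p_part (@dvdn_exp2l 2 2) // -pfactor_dvdn.
have q2 : (2 %| m`_2)%N by apply: dvdn_trans q4.
have m2 : (2 %| m)%N by apply: dvdn_trans m4.
have cE : c (special 2) = (m`_2 %/ 2)%N by rewrite cfactor_special // ex.
apply: (per_triangular_at (t := fun i => if i == half then 1 else 0)) => //.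
  move=> i; case: eqP => [-> | _]; last by rewrite mul0r dvdz0.
  by rewrite mul1r dvdzE /= cE half_order_dvd.
rewrite sum_single ?half_p // mul1r [X in _ - X%:Z]val_half // cE.
rewrite [nat_of_ord _]val_special //.
have -> : (m`_2 %/ 2 * (m %/ m`_2) = m %/ 2)%N.
  by rewrite mulnC muln_divA // divnK.
by rewrite subrr dvdz0.
Qed.

(** The multiples of [v] that are combinations of the special vertices by
    coefficients preserving the order. They form a subgroup of [Z], which
    reduces the decomposition of [v] to that of its components for the primes
    dividing [m]. *)
Definition decomposable (v : 'I_m) : pred int := fun x =>
  `[< exists t : 'I_m -> int,
      [/\ forall i, i \notin specials -> t i = 0,
          forall i, ((r i)%:Z %| t i * (r v)%:Z)%Z
        & (m%:Z %| x * (val v)%:Z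
                   - \sum_(i <- specials) t i * (val i)%:Z)%Z] >].

Fact decomposable_zmod_closed v : zmod_closed (decomposable v).
Proof.
split=> [|x y /asboolP[t [t0 tr tm]] /asboolP[s [s0 sr sm]]]; apply/asboolP.
  exists (fun=> 0); split=> //.
  by rewrite mul0r big1 ?subr0 ?dvdz0 // => i _; rewrite mul0r.
exists (fun i => t i - s i); split=> [i iS|i|].
- by rewrite t0 // s0 // subr0.
- by rewrite mulrBl rpredB.
have -> : \sum_(i <- specials) (t i - s i) * (val i)%:Z =
    \sum_(i <- specials) t i * (val i)%:Z - \sum_(i <- specials) s i * (val i)%:Z.
  by rewrite -sumrB; apply: eq_bigr => i _; rewrite mulrBl.
by rewrite mulrBl opprD addrACA -opprD rpredB.
Qed.

HB.instance Definition _ v :=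
  GRing.isZmodClosed.Build int (decomposable v) (decomposable_zmod_closed v).

Lemma decomposable_single (v i : 'I_m) (x : int) (t : nat) : i \in specials ->
  (r i %| t * r v)%N -> (m%:Z %| x * (val v)%:Z - t%:Z * (val i)%:Z)%Z ->
  x \in decomposable v.
Proof.
move=> iS tr tm; apply/asboolP.
exists (fun j => if j == i then t%:Z else 0); split=> [j jS|j|].
- by case: eqP => // ji; rewrite ji iS in jS.
- by case: eqP => [->|_]; rewrite ?mul0r ?dvdz0 // dvdzE abszM.
by rewrite sum_single ?specials_uniq.
Qed.

(** The multiple [m / pi_p(m) * v] is [v] times the special vertex of [p], and
    [geometric_solution] adjusts the coefficient [v] modulo [pi_p(m)]. When it
    fails to apply, [v] is divisible by [pi_2(m) / 2] and the component for [2] is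
    zero or [half]. *)
Lemma decomposable_part (v : 'I_m) p : p \in primes m ->
  ((m %/ m`_p)%N%:Z : int) \in decomposable v.
Proof.
move=> pm; have [qm q_gt1] := part_primes pm.
move: (pm); rewrite mem_primes => /and3P[p_pr _ p_m].
have q_gt0 : (0 < m %/ m`_p)%N.
  by rewrite divn_gt0 ?(dvdn_leq _ qm) // (dvdn_gt0 m_gt0 qm).
pose e := (d ^ #|orb d v|)%N; have e_gt0 : (0 < e)%N by rewrite expn_gt0 d_gt0.
have ev_dvd : (p ^ logn p m %| e.-1 * v)%N.
  by rewrite -p_part (dvdn_trans qm) // -subn1 orb_dvd.
have sub_dvd (s t : nat) : s = t %[mod m`_p] ->
    (m%:Z %| (m %/ m`_p)%N%:Z * s%:Z - t%:Z * (m %/ m`_p)%N%:Z)%Z.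
  move=> st; rewrite [t%:Z * _]mulrC -mulrBr.
  have -> : m%:Z = (m %/ m`_p)%N%:Z * (m`_p)%N%:Z by rewrite -PoszM divnK.
  rewrite dvdz_mul2l ?eqz_nat -?lt0n //.
  by rewrite -eqz_mod_dvd !modz_nat st.
have [cond | ] := boolP [|| p != 2, 4 %| e.-1 | ~~ (p %| v)]%N.
  have [t [P [y [vt yP tE]]]] := geometric_solution p_pr e_gt0 ev_dvd cond.
  apply: (@decomposable_single v (special p) _ t); first exact: specials_special.
    rewrite /(r v) -/e subn1 mulnC tE.
    case: yP => [eP | ->]; last by rewrite muln0 dvdn0.
    rewrite dvdn_mulr // -subn1 /e -expnM per_order_dvd //.
    by rewrite -orb_special // expnM subn1 p_part.
  by rewrite val_special // sub_dvd // p_part.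
(* The exceptional prime: [e - 1] is twice an odd number [w], so that
   [e - 1] kills only the multiples of [2 ^ (a - 1)] modulo [2 ^ a]. *)
rewrite !negb_or !negbK => /and3P[/eqP p2 e4 v2].
rewrite p2 in pm qm q_gt1 q_gt0 ev_dvd sub_dvd v2 p_m *.
have d_odd : odd d by apply: odd_multiplier.
set a := logn 2 m in ev_dvd; have qE : (m`_2 = 2 ^ a)%N by rewrite p_part.
have [va | nva] := boolP (2 ^ a %| v)%N.
  apply: (@decomposable_single v (special 2) _ 0); first exact: specials_special.
    by rewrite mul0n dvdn0.
  rewrite val_special // sub_dvd // qE mod0n.
  exact/eqP.
have a_gt0 : (0 < a)%N by rewrite logn_gt0.
pose w := (e.-1 %/ 2)%N.
have e_odd : odd e by rewrite oddX d_odd orbT.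
have wE : (e.-1 = 2 * w)%N.
  by rewrite mulnC divnK // dvdn2 -subn1 oddB // e_odd.
have w_odd : coprime 2%N w.
  by rewrite coprime2n; apply: contraR e4 => w_even; rewrite wE (@dvdn_pmul2l 2 2) // dvdn2.
have va1 : (2 ^ a.-1 %| v)%N.
  move: ev_dvd; rewrite wE -(prednK a_gt0) expnS -mulnA dvdn_pmul2l //.
  by rewrite Gauss_dvdr // coprimeXl.
have a_gt1 : (1 < a)%N.
  by rewrite ltnNge; apply: contra nva => a1; have -> : a = 1%N by apply/eqP; rewrite eqn_leq a1.
have m4 : (4 %| m)%N by rewrite (@pfactor_dvdn 2 2).
have ex : exceptional.
  rewrite /exceptional m4 /=.
  have d4 : (d %% 4 == 1)%N || (d %% 4 == 3)%N.
    have : odd (d %% 4) by move: d_odd; rewrite {1}(divn_eq d 4) oddD oddM andbF.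
    by have := ltn_pmod d (isT : 0 < 4)%N; case: (d %% 4)%N => [|[|[|[|]]]].
  case/orP: d4 => // /eqP d1; case/negP: e4.
  by rewrite -subn1 -eqn_mod_dvd // /e -modnXm d1 exp1n.
have m2 : (2 %| m)%N by apply: dvdn_trans m4.
apply: (@decomposable_single v half _ 1); first exact: specials_half.
  by rewrite mul1n per_order_half.
have [s sE] := dvdnP va1.
have s_odd : odd s.
  apply: contraR nva => s_even; rewrite sE -(prednK a_gt0) expnS /= dvdn_mul //.
  by rewrite dvdn2.
rewrite val_half // mul1r.
have -> : (m %/ 2 = m %/ m`_2 * 2 ^ a.-1)%N.
  rewrite -{1}(divnK qm) qE -(prednK a_gt0) expnS /= [(2 * _)%N]mulnC mulnA.
  by rewrite mulnK.
have -> : (val v)%:Z = s%:Z * (2 ^ a.-1)%N%:Z by rewrite -PoszM -sE.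
rewrite PoszM.
have -> : m%:Z = (m %/ m`_2)%N%:Z * (2 ^ a.-1)%N%:Z * 2%:Z.
  by rewrite -!PoszM -mulnA -expnSr prednK // -qE divnK.
move: (m %/ m`_2)%N%:Z (2 ^ a.-1)%N%:Z => C B.
have -> : C * (s%:Z * B) - C * B = C * B * (s%:Z - 1) by ring.
apply: dvdz_mul => //.
have -> : s%:Z - 1 = (s - 1)%N%:Z by rewrite subzn // odd_gt0.
by rewrite dvdzE /= dvdn2 oddB ?odd_gt0 // s_odd.
Qed.

(** The integers [m / pi_p(m)] have gcd [1], so that the components of [v] for
    the various primes add up to [v]. *)
Lemma special_decomposition (v : 'I_m) : val v != 0%N ->
  exists t : 'I_m -> int,
  [/\ forall i, i \notin specials -> t i = 0,
      forall i, ((r i)%:Z %| t i * (r v)%:Z)%Z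
    & (m%:Z %| (val v)%:Z - \sum_(i <- specials) t i * (val i)%:Z)%Z].
Proof.
move=> v0; suff : (1 : int) \in decomposable v.
  by move=> /asboolP[t [t0 tr]]; rewrite mul1r => tm; exists t.
have m_gt1 : (1 < m)%N.
  have lt_vm := ltn_ord v; rewrite (leq_ltn_trans _ lt_vm) // lt0n //.
(* The subgroup [decomposable v] contains the gcd of any of its members. *)
have gcd_good (l : seq nat) : {in l, forall x, (x%:Z : int) \in decomposable v} ->
    ((foldr gcdn 0%N l)%:Z : int) \in decomposable v.
  elim: l => [|x l IHl] lP /=; first exact: rpred0.
  have [u [u' uE]] := Bezoutz x%:Z (foldr gcdn 0%N l)%:Z.
  rewrite -[(gcdn _ _)%:Z]/(gcdz x%:Z (foldr gcdn 0%N l)%:Z) -uE.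
  have xP : (x%:Z : int) \in decomposable v by apply: lP; rewrite mem_head.
  have lP' : ((foldr gcdn 0%N l)%:Z : int) \in decomposable v.
    by apply: IHl => y yl; apply: lP; rewrite inE yl orbT.
  rewrite rpredD // mulrC -mulrzz rpredMz //.
pose l := [seq (m %/ m`_p)%N | p : nat <- primes m].
suff l1 : foldr gcdn 0%N l = 1%N.
  rewrite -[1]/(1%N%:Z) -l1.
  by apply: gcd_good => _ /mapP[p pm ->]; apply: decomposable_part.
have gcd_dvd q (s : seq nat) x : (q %| foldr gcdn 0%N s)%N -> x \in s -> (q %| x)%N.
  elim: s => //= y s IHs; rewrite dvdn_gcd inE => /andP[qy qs] /orP[/eqP-> //|].
  exact: IHs.
apply/eqP; apply: contraT => G1; set G := foldr _ _ _ in G1.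
have pG : (pdiv G %| G)%N := pdiv_dvd G.
have [p0 p0m] : exists p, p \in primes m.
  by exists (pdiv m); rewrite mem_primes pdiv_prime // m_gt0 pdiv_dvd.
have inl p : p \in primes m -> (m %/ m`_p)%N \in l by move=> pm; apply: map_f.
have G_dvd p : p \in primes m -> (G %| m %/ m`_p)%N.
  by move=> /inl; apply: gcd_dvd.
have G_m : (G %| m)%N.
  rewrite (dvdn_trans (G_dvd _ p0m)) //.
  by rewrite -[X in (_ %| X)%N](divnK (dvdn_part p0 m)) dvdn_mulr.
have G_gt1 : (1 < G)%N.
  by rewrite ltn_neqAle eq_sym G1 (dvdn_gt0 m_gt0 G_m).
have p_pr := pdiv_prime G_gt1; set p := pdiv G in pG p_pr.
have pm : p \in primes m by rewrite mem_primes p_pr m_gt0 (dvdn_trans pG).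
have := dvdn_trans pG (G_dvd p pm).
rewrite -(@dvdn_pmul2r m`_p) ?part_gt0 // divnK ?dvdn_part //.
by rewrite p_part -expnS pfactor_dvdn // ltnn.
Qed.

(** An order-preserving combination of special vertices with the value of [v]
    serves as [w], with index [1]. *)
Lemma triangular_other s (v : 'I_m) : v \in V -> v \notin specials ->
  uniq (specials ++ s) ->
  triangular_at (sand_rel M d) phi M b r c (specials ++ s) v.
Proof.
move=> vV vS s_uniq.
have [t [t0 tr tm]] := special_decomposition (reps_neq0 V_reps vV).
have c1 := cfactor_other vS.
apply: (per_triangular_at (t := t)); rewrite ?c1 ?divn1 ?mul1n ?dvd1n //.
rewrite big_cat /= [X in _ - (_ + X)]big1_seq ?addr0 // => i /= is_.
rewrite t0 ?mul0r //; move: s_uniq; rewrite cat_uniq => /and3P[_ /hasPn + _].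
by apply.
Qed.

Lemma per_triangular : triangular (sand_rel M d) phi M b r c [::] rep_order.
Proof.
have ro_uniq : uniq rep_order by rewrite (perm_uniq perm_rep_order) enum_uniq.
apply/triangular_cat; split; last first.
  apply: triangularP => l1 v l2 lE.
  have : v \in [seq v <- enum V | v \notin specials].
    by rewrite lE mem_cat mem_head orbT.
  rewrite mem_filter mem_enum => /andP[vS vV]; apply: triangular_other => //.
  have := ro_uniq; rewrite /rep_order lE catA => u.
  by move: u; rewrite (cat_uniq (_ ++ l1)) => /andP[u _].
apply/triangular_cat; split.
  by case: ifP => //= ex; split=> //; apply: triangular_half.
apply: triangularP => l1 v l2 lE.
have : v \in [seq special p | p <- primes m] by rewrite lE mem_cat mem_head orbT.
case/mapP=> p pm vE; rewrite vE; apply: triangular_special => //.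
  have := specials_uniq; rewrite /specials lE catA => u.
  by move: u; rewrite (cat_uniq (_ ++ l1)) => /andP[u _].
by move=> ex; rewrite ex mem_head.
Qed.

Lemma per_tower : tower d M m b r c [::] rep_order.
Proof.
split=> //.
- apply: eq_cyclic_family (per_family k m_gt0 d_gt0 md V_reps) => //.
  by rewrite perm_sym perm_rep_order.
- by move=> v _; apply: per_order_rel.
- exact: per_triangular.
exact: prod_cfactor.
Qed.

End Specials.

(** * The rows of the Laplacian as polynomials *)

Section RowPolynomials.
Variables n d : nat.
Hypothesis n_gt0 : (0 < n)%N.

Definition all_ones : {poly int} := \sum_(i < n) 'X^i.

(** The combination, with the coefficients of [c], of the rows of the
    Laplacian. Multiplication by [X - 1] turns it into the relation of
    [sand_rel] that is witnessed by [(X - 1) * c]. *)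
Definition row_comb (c : {poly int}) : {poly int} :=
  c *+ d - (c \Po 'X^d) * \sum_(i < d) 'X^i.

Fact row_comb_is_zmod_morphism : zmod_morphism row_comb.
Proof.
by move=> c c'; rewrite /row_comb mulrnBl comp_polyB mulrBl; ring.
Qed.

HB.instance Definition _ :=
  GRing.isZmodMorphism.Build {poly int} {poly int} row_comb row_comb_is_zmod_morphism.

Lemma mul_row_comb c :
  ('X - 1) * row_comb c = (('X - 1) * c) *+ d - ((('X - 1) * c) \Po 'X^d).
Proof.
rewrite /row_comb comp_polyM comp_polyB comp_polyX comp_polyC.
rewrite subrX1 mulrBr mulrnAr; ring.
Qed.

(** The outdegree is [d] at every vertex. *)
Lemma row_comb1 c : (row_comb c).[1] = 0.
Proof.
rewrite /row_comb !hornerE hornerMn horner_comp hornerXn expr1n horner_sum.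
rewrite (eq_bigr (fun=> 1)) => [|i _]; last by rewrite hornerXn expr1n.
by rewrite sumr_const card_ord mulr_natr subrr.
Qed.

Lemma mul_all_ones : ('X - 1) * all_ones = 'X^n - 1.
Proof. by rewrite subrX1. Qed.

Lemma all_ones1 : all_ones.[1] = n%:Z.
Proof.
rewrite horner_sum (eq_bigr (fun=> 1)) => [|i _]; last by rewrite hornerXn expr1n.
by rewrite sumr_const card_ord -mulr_natr mul1r natz.
Qed.

Lemma mulX1_inj : injective (fun p : {poly int} => ('X - 1) * p).
Proof. by apply: mulfI; rewrite -['X - 1]/('X - 1%:P) polyXsubC_eq0. Qed.

(** The rows of the Laplacian sum to zero: each vertex has indegree [d]. *)
Lemma row_comb_ones : row_comb all_ones \in cyc_rel n.
Proof.
have -> : row_comb all_ones = all_ones * (d%:R - \sum_(a < d) 'X^n ^+ a).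
  apply: mulX1_inj; rewrite /= mul_row_comb mulrA mul_all_ones comp_polyB.
  rewrite comp_polyC comp_Xn_poly -exprM mulnC exprM mulrBr -subrX1 mulr_natr.
  by [].
rewrite cyc_relM //.
have -> : d%:R - \sum_(a < d) 'X^n ^+ a = \sum_(a < d) (1 - 'X^n ^+ a) :> {poly int}.
  by rewrite sumrB sumr_const card_ord.
apply: rpred_sum => a _; rewrite -opprB rpredN -exprM; exact: cyc_rel_XnM.
Qed.

Lemma row_comb_cyc c : c \in cyc_rel n -> row_comb c \in cyc_rel n.
Proof.
move=> cC; rewrite /row_comb rpredB ?rpredMn // mulrC cyc_relM //.
exact: cyc_rel_comp.
Qed.

Lemma cyc_rel1 p : p \in cyc_rel n -> p.[1] = 0.
Proof.
by move=> /cyc_relP[q ->]; rewrite hornerM !hornerE expr1n subrr mulr0.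
Qed.

Lemma divX1 (p : {poly int}) : p.[1] = 0 -> exists q, p = ('X - 1) * q.
Proof.
move=> p1; have /factor_theorem[q ->] : root p 1 by apply/rootP.
by exists q; rewrite mulrC.
Qed.

(** Subtracting [c.[1]] from the witness [c] of a relation costs only a
    constant, and makes it a multiple of [X - 1]. *)
Lemma sand_rel_row p : p \in sand_rel n d <->
  exists c, p - p.[1]%:P - ('X - 1) * row_comb c \in cyc_rel n.
Proof.
split=> [/sand_relP[c [a pC]] | [c pC]]; last first.
  apply/sand_relP; exists (('X - 1) * c), p.[1].
  by rewrite -mul_row_comb addrAC.
have [c1 c1E] : exists q, c - c.[1]%:P = ('X - 1) * q.
  by apply: divX1; rewrite !hornerE subrr.
have cE : c = ('X - 1) * c1 + c.[1]%:P by rewrite -c1E subrK.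
have fE : c *+ d - (c \Po 'X^d) = ('X - 1) * row_comb c1 + (c.[1] *+ d - c.[1])%:P.
  rewrite mul_row_comb {1 2}cE comp_polyD comp_polyC polyCB polyCMn mulrnDl.
  ring.
exists c1; rewrite fE in pC; have := cyc_rel1 pC.
rewrite !(hornerD, hornerN, hornerC) hornerM row_comb1 mulr0 add0r => p1.
have -> : p.[1]%:P = (c.[1] *+ d - c.[1])%:P + a%:P.
  by rewrite -polyCD; congr (_%:P); apply/eqP; rewrite -subr_eq0 opprD addrA p1.
rewrite (_ : _ - _ - _ = p - (('X - 1) * row_comb c1 + (c.[1] *+ d - c.[1])%:P)
  - a%:P) //; ring.
Qed.

(** Multiplication by [X - 1] is injective from [S(n, d)] to [Sigma(n, d)]. If
    [(X - 1) x] is [(X^n - 1) q], then [x] is [all_ones * q]; evaluation at [1],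
    where [all_ones] is [n], makes [q] a multiple of [X - 1]. *)
Lemma sand_rel_mulX1 p : p.[1] = 0 ->
  ('X - 1) * p \in sand_rel n d <-> exists c, p - row_comb c \in cyc_rel n.
Proof.
move=> p1; have Xp1 : (('X - 1) * p).[1] = 0 by rewrite hornerM !hornerE.
split=> [/sand_rel_row[c] | [c pC]]; last first.
  apply/sand_rel_row; exists c; rewrite Xp1 subr0 -mulrBr.
  exact: cyc_relM.
rewrite Xp1 subr0 -mulrBr => /cyc_relP[q].
rewrite -mul_all_ones mulrCA => /mulX1_inj pE.
have q1 : q.[1] = 0.
  have := congr1 (fun t => t.[1]) pE; rewrite /= hornerM all_ones1.
  rewrite hornerD hornerN p1 row_comb1 subrr => /esym/eqP; rewrite mulf_eq0 => /orP[/eqP-> //|].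
  by rewrite eqz_nat eqn0Ngt n_gt0.
have [q' qE] := divX1 q1; exists c; apply/cyc_relP; exists q'.
by rewrite pE qE -mul_all_ones; ring.
Qed.

End RowPolynomials.

(** * Passing from polynomials to the groups of the graph *)

Section RowSpan.
Variables (n : nat) (B : zmodType) (nu : {additive {poly int} -> B}).
Variables (F : {additive {poly int} -> {poly int}}) (s : seq B) (v0 : nat).
Hypotheses (lt_v0n : (v0 < n)%N)
  (nu_cyc : forall p, p \in cyc_rel n -> nu p = 0)
  (F_cyc : forall p, p \in cyc_rel n -> F p \in cyc_rel n)
  (F_ones : F (all_ones n) \in cyc_rel n)
  (s_mem : forall v, (v < n)%N -> v != v0 -> nu (F 'X^v) \in s)
  (s_row : forall y, y \in s -> exists v : nat, y = nu (F 'X^v)).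

Definition row_image : pred B := fun y => `[< exists c, y = nu (F c) >].

Fact row_image_zmod_closed : zmod_closed row_image.
Proof.
split=> [|y z /asboolP[c ->] /asboolP[c' ->]]; apply/asboolP.
  by exists 0; rewrite !raddf0.
by exists (c - c'); rewrite !raddfB.
Qed.

HB.instance Definition _ :=
  GRing.isZmodClosed.Build B row_image row_image_zmod_closed.

(** Because the rows sum to zero, one row, at [v0], may be left out. *)
Lemma zspan_rows p : p \in zspan s <-> exists c, p = nu (F c).
Proof.
split=> [ps | [c ->]].
  suff /asboolP : p \in row_image by [].
  apply: zspan_sub ps => y /s_row[v ->].
  by apply/asboolP; exists 'X^v.
have row_mod i : nu (F 'X^i) = nu (F 'X^(i %% n)).
  apply/eqP; rewrite -subr_eq0 -!raddfB nu_cyc // F_cyc // cyc_rel_Xn //.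
  by rewrite modn_mod.
have row_mem v : (v < n)%N -> v != v0 -> nu (F 'X^v) \in zspan s.
  by move=> lt_vn ne; apply/mem_zspan/s_mem.
have row_v0 : nu (F 'X^v0) \in zspan s.
  have := nu_cyc F_ones; rewrite !raddf_sum (bigD1 (Ordinal lt_v0n)) //=.
  move=> /eqP; rewrite addr_eq0 => /eqP->; rewrite rpredN rpred_sum // => v.
  by rewrite -val_eqE /= => ne; apply: row_mem.
rewrite (poly_sumXn c) !raddf_sum rpred_sum // => i _.
rewrite !raddfMz rpredMz //= row_mod.
have [-> // | ne] := eqVneq (i %% n)%N v0.
by apply: row_mem => //; rewrite ltn_mod (leq_ltn_trans _ lt_v0n).
Qed.

End RowSpan.

Section Augmentation.
Variables n d : nat.
Hypothesis n_gt0 : (0 < n)%N.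

(** Subtracting the multiple of [X^v] that brings the value at [1] to zero
    recovers an element of the augmentation ideal from a row vector whose entry
    at [v] has been deleted; so these maps serve both for [S(n, d)] and for the
    sandpile group at [v]. *)
Definition mul_aug (v : nat) (p : {poly int}) : {poly int} :=
  ('X - 1) * (p - p.[1] *: 'X^v).

Fact mul_aug_is_zmod_morphism v : zmod_morphism (mul_aug v).
Proof.
move=> p q; rewrite /mul_aug hornerD hornerN scalerBl; ring.
Qed.

HB.instance Definition _ v :=
  GRing.isZmodMorphism.Build {poly int} {poly int} (mul_aug v)
    (mul_aug_is_zmod_morphism v).

Lemma aug_at1 v (p : {poly int}) : (p - p.[1] *: 'X^v).[1] = 0.
Proof. by rewrite !hornerE expr1n mulr1 subrr. Qed.

(** The derivative of [(X - 1) p] is [p + (X - 1) p']. *)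
Lemma phi_mulX1 p : phi (('X - 1) * p) = p.[1].
Proof.
rewrite -ev1 {1}(poly_sumXn p) big_distrr /= raddf_sum; apply: eq_bigr => i _.
rewrite mulrzAr raddfMz /= mulrBl mul1r -exprS raddfB /= !ev_Xn.
by rewrite mulrzz -addn1 PoszD addrC addKr mulrC.
Qed.

Lemma phi_const a : phi a%:P = 0.
Proof.
have -> : a%:P = 'X^0 *~ a :> {poly int}.
  by rewrite expr0 -[a in LHS]intz rmorph_int.
by rewrite (raddfMz (ev Posz)) /= ev_Xn mul0rz.
Qed.

Lemma mul_aug_phi v p : (n%:Z %| phi (mul_aug v p))%Z.
Proof. by rewrite phi_mulX1 aug_at1 dvdz0. Qed.

(** Up to a constant [a] is [(X - 1) y] with [y.[1] = n * z]; subtracting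
    [z * all_ones], which [X - 1] turns into [X^n - 1], makes the value at [1]
    vanish. *)
Lemma mul_aug_surj v a : (n%:Z %| phi a)%Z ->
  exists p, mul_aug v p - a \in sand_rel n d.
Proof.
have [y yE] : exists y, a - a.[1]%:P = ('X - 1) * y.
  by apply: divX1; rewrite !hornerE subrr.
have -> : a = ('X - 1) * y + a.[1]%:P by rewrite -yE subrK.
rewrite (raddfD (ev Posz)) /= phi_mulX1 phi_const addr0 => /dvdzP[z zE].
exists (y - all_ones n * z%:P); rewrite /mul_aug.
have -> : (y - all_ones n * z%:P).[1] = 0.
  by rewrite hornerD hornerN hornerM all_ones1 hornerC zE mulrC subrr.
rewrite scale0r subr0 mulrBr mulrA mul_all_ones opprD addrACA subrr add0r.
rewrite rpredB ?sand_rel_const // rpredN sand_rel_cyc // mulrC cyc_relM //.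
by have := cyc_rel_XnM n 1; rewrite muln1.
Qed.

Fact aug_poly_subproof (p : {poly int}) :
  in_qpoly ('X^n - 1) (p - p.[1]%:P) \in @aug n.
Proof.
by rewrite unfold_in at1_in_qpoly // !hornerE subrr.
Qed.

Definition aug_poly p : augideal n := AugIdeal (aug_poly_subproof p).

Fact aug_poly_is_zmod_morphism : zmod_morphism aug_poly.
Proof.
move=> p q; apply: val_inj; rewrite /= -raddfB; congr (in_qpoly _ _).
by rewrite hornerD hornerN polyCB; ring.
Qed.

HB.instance Definition _ :=
  GRing.isZmodMorphism.Build {poly int} (augideal n) aug_poly
    aug_poly_is_zmod_morphism.

Lemma mk_monic_Xn1 : mk_monic ('X^n - 1 : {poly int}) = 'X^n - 1.
Proof. by rewrite /mk_monic size_XnsubC // ltnS n_gt0 monicXnsubC. Qed.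

Lemma in_qpoly_eq0 p : (in_qpoly ('X^n - 1) p == 0) = (p \in cyc_rel n).
Proof.
rewrite -val_eqE /= mk_monic_Xn1.
apply/eqP/cyc_relP => [p0 | [q ->]]; last first.
  by rewrite (Pdiv.RingMonic.rmodp_mull (monicXnsubC 1 n_gt0)).
exists (Pdiv.Ring.rdivp p ('X^n - 1)).
by rewrite {1}(Pdiv.RingMonic.rdivp_eq (monicXnsubC 1 n_gt0) p) p0 addr0.
Qed.

Lemma aug_poly_eq0 p : (aug_poly p == 0) = (p - p.[1]%:P \in cyc_rel n).
Proof. by rewrite -in_qpoly_eq0 -val_eqE. Qed.

Definition aug_rep (a : augideal n) : {poly int} := val (val (val a)).

Fact aug_rep_is_zmod_morphism : zmod_morphism aug_rep.
Proof. by []. Qed.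

HB.instance Definition _ :=
  GRing.isZmodMorphism.Build (augideal n) {poly int} aug_rep
    aug_rep_is_zmod_morphism.

Lemma aug_rep1 a : (aug_rep a).[1] = 0.
Proof. by apply/eqP; case: a. Qed.

Lemma aug_repK : cancel aug_rep aug_poly.
Proof.
move=> a; apply: val_inj => /=; rewrite aug_rep1.
rewrite subr0; apply: val_inj; apply: in_qpoly_small; exact: size_mk_monic.
Qed.

Lemma aug_poly_row (v : 'I_n) :
  aug_poly (row_comb d 'X^v) = AugIdeal (@fpoly_aug n d v).
Proof.
apply: val_inj => /=; rewrite row_comb1 subr0 /fpoly; congr (in_qpoly _ _).
by rewrite /row_comb comp_Xn_poly -exprM scaler_nat.
Qed.

Lemma aug_poly_mul_row (v : 'I_n) :
  aug_poly (('X - 1) * row_comb d 'X^v) = AugIdeal (@gpoly_aug n d v).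
Proof.
apply: val_inj => /=; rewrite hornerM row_comb1 mulr0 subr0 /gpoly rmorphM.
by congr (_ * _); rewrite /fpoly /row_comb comp_Xn_poly -exprM scaler_nat.
Qed.

Definition mulX1_row (c : {poly int}) : {poly int} := ('X - 1) * row_comb d c.

Fact mulX1_row_is_zmod_morphism : zmod_morphism mulX1_row.
Proof. by move=> c c'; rewrite /mulX1_row raddfB mulrBr. Qed.

HB.instance Definition _ :=
  GRing.isZmodMorphism.Build {poly int} {poly int} mulX1_row
    mulX1_row_is_zmod_morphism.

Let aug_cyc p : p \in cyc_rel n -> aug_poly p = 0.
Proof. by move=> pC; apply/eqP; rewrite aug_poly_eq0 (cyc_rel1 pC) subr0. Qed.

Lemma zspan_aug_rows (F : {additive {poly int} -> {poly int}})
    (h : 'I_n -> augideal n) y :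
  (forall v : 'I_n, aug_poly (F 'X^v) = h v) ->
  (forall p, p \in cyc_rel n -> F p \in cyc_rel n) ->
  F (all_ones n) \in cyc_rel n ->
  y \in zspan [seq h v | v <- enum 'I_n & val v != 0%N] <->
  exists c, y = aug_poly (F c).
Proof.
move=> hE F_cyc F_ones; apply: (@zspan_rows n _ aug_poly F _ 0) => //.
  move=> v lt_vn v0; apply/mapP; exists (Ordinal lt_vn); last by rewrite -hE.
  by rewrite mem_filter mem_enum v0.
by move=> _ /mapP[v _ ->]; exists v; apply/esym/hE.
Qed.

Lemma sand_dune_rel p : (p \in sand_rel n d) =
  (aug_poly p \in
    zspan [seq AugIdeal (@gpoly_aug n d v) | v <- enum 'I_n & val v != 0%N]).
Proof.
have spanP := @zspan_aug_rows mulX1_row _ (aug_poly p) aug_poly_mul_row.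
have relE c : (p - p.[1]%:P - ('X - 1) * row_comb d c \in cyc_rel n) =
    (aug_poly p == aug_poly (mulX1_row c)).
  rewrite -subr_eq0 -(raddfB aug_poly) aug_poly_eq0 hornerD hornerN.
  by rewrite [(mulX1_row c).[1]]hornerM row_comb1 mulr0 subr0 addrAC.
apply/idP/idP => [/(sand_rel_row n d)[c] | ].
  rewrite relE => /eqP pc; apply/spanP; last by exists c.
    by move=> q qC; rewrite cyc_relM // row_comb_cyc.
  by rewrite cyc_relM // row_comb_ones.
case/spanP => [q qC | | c /eqP].
- by rewrite cyc_relM // row_comb_cyc.
- by rewrite cyc_relM // row_comb_ones.
by rewrite -relE => pC; apply/sand_rel_row; exists c.
Qed.

Lemma mul_aug_rel v p :
  mul_aug v p \in sand_rel n d <->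
  exists c, p - p.[1] *: 'X^v - row_comb d c \in cyc_rel n.
Proof. exact/(sand_rel_mulX1 d n_gt0)/aug_at1. Qed.

Lemma Sgroup_rel p : (mul_aug 0 p \in sand_rel n d) =
  (aug_poly p \in
    zspan [seq AugIdeal (@fpoly_aug n d v) | v <- enum 'I_n & val v != 0%N]).
Proof.
have spanP := @zspan_aug_rows (row_comb d) _ (aug_poly p) aug_poly_row.
have relE c : (p - p.[1] *: 'X^0 - row_comb d c \in cyc_rel n) =
    (aug_poly p == aug_poly (row_comb d c)).
  rewrite -subr_eq0 -(raddfB aug_poly) aug_poly_eq0 hornerD hornerN.
  by rewrite row_comb1 subr0 addrAC expr0 alg_polyC.
apply/idP/idP => [/mul_aug_rel[c] | ].
  rewrite relE => /eqP pc; apply/spanP; last by exists c.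
    by move=> q; apply: row_comb_cyc.
  exact: row_comb_ones.
case/spanP => [q | | c /eqP].
- exact: row_comb_cyc.
- exact: row_comb_ones.
by rewrite -relE => pC; apply/mul_aug_rel; exists c.
Qed.

Definition fold_row (p : {poly int}) : 'rV[int]_n :=
  \row_w ev (residue n w) p.

Fact fold_row_is_zmod_morphism : zmod_morphism fold_row.
Proof. by move=> p q; apply/rowP => w; rewrite !mxE raddfB. Qed.

HB.instance Definition _ :=
  GRing.isZmodMorphism.Build {poly int} 'rV[int]_n fold_row
    fold_row_is_zmod_morphism.

Lemma fold_row_eq0 p : (fold_row p == 0) = (p \in cyc_rel n).
Proof.
apply/eqP/idP => [/rowP p0 | pC].
  apply: cyc_rel_residue => // u lt_un.
  by have := p0 (Ordinal lt_un); rewrite !mxE.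
by apply/rowP => w; rewrite !mxE ev_residue0.
Qed.

Lemma residue_ord_eq (u w : 'I_n) : residue n w u = (u == w)%:Z.
Proof. by rewrite /residue !modn_small. Qed.

Lemma fold_row_surj y : exists p, fold_row p = y.
Proof.
exists (\sum_(u < n) 'X^u *~ y ord0 u); apply/rowP => w.
rewrite !mxE raddf_sum (bigD1 w) //= big1 ?addr0 => [|u /negPf ne].
  by rewrite (raddfMz (ev _)) /= ev_Xn residue_ord_eq eqxx mulrzz mul1r.
by rewrite (raddfMz (ev _)) /= ev_Xn residue_ord_eq ne mul0rz.
Qed.

Let edges (v w : 'I_n) : int :=
  \sum_(i < d) (affine_mod d i v == w)%:Z.

Lemma ev_residue_row (v w : 'I_n) :
  ev (residue n w) (row_comb d 'X^v) = (v == w)%:Z *+ d - edges v w.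
Proof.
rewrite /row_comb (raddfB (ev _)) raddfMn /= ev_Xn residue_ord_eq.
congr (_ - _); rewrite comp_Xn_poly -exprM mulr_sumr raddf_sum.
apply: eq_bigr => i _; rewrite -exprD /= ev_Xn /residue -val_eqE /=.
by rewrite [X in (_ == X)%N]modn_small.
Qed.

Lemma card_set_int (T : finType) (P : pred T) :
  #|[set e | P e]|%:Z = \sum_e (P e)%:Z :> int.
Proof.
rewrite cardsE -sum1_card big_mkcond -natz natr_sum.
by apply: eq_bigr => e _; rewrite natz unfold_in; case: (P e).
Qed.

Lemma adjmx_deBruijn (v w : 'I_n) : adjmx (deBruijn n d) v w = edges v w.
Proof.
rewrite mxE card_set_int -(pair_bigA _ (fun (u : 'I_n) (i : 'I_d) =>
  ((u == v) && (affine_mod d i u == w))%:Z)) /=.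
rewrite (bigD1 v) //= [X in _ + X]big1 ?addr0 => [|u /negPf ne].
  by apply: eq_bigr => i _; rewrite eqxx.
by rewrite big1 // => i _; rewrite ne.
Qed.

(** Read entrywise, [row_comb_ones] equates [d] with the number of edges into
    each vertex. *)
Lemma indeg_deBruijn (w : 'I_n) : indeg (deBruijn n d) w = d.
Proof.
have := ev_residue0 w (row_comb_ones n d); rewrite !raddf_sum.
rewrite (eq_bigr (fun v : 'I_n => (v == w)%:Z *+ d - edges v w)); last first.
  by move=> v _; apply: ev_residue_row.
rewrite sumrB sumrMnl (bigD1 w) //= eqxx big1 ?addr0 => [|u /negPf-> //].
move=> /eqP; rewrite subr_eq0 -[_ *+ d]/(d%:R) natz => /eqP dE.
apply/eqP; rewrite -eqz_nat dE /indeg card_set_int.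
by rewrite -(pair_bigA _ (fun (u : 'I_n) (i : 'I_d) => (affine_mod d i u == w)%:Z)).
Qed.

Lemma laplacian_row (v : 'I_n) :
  row v (laplacian (deBruijn n d)) = fold_row (row_comb d 'X^v).
Proof.
apply/rowP => w; rewrite [RHS]mxE ev_residue_row [LHS]mxE /laplacian.
rewrite [LHS]mxE [X in _ + X]mxE adjmx_deBruijn; congr (_ - _).
rewrite !mxE indeg_deBruijn; case: (v == w); last by rewrite mulr0n mul0rn.
by rewrite mulr1n -[RHS]/(d%:R) natz.
Qed.

Definition cut_row (v : 'I_n) (p : {poly int}) : 'rV[int]_n.-1 :=
  col' v (fold_row p).

Fact cut_row_is_zmod_morphism v : zmod_morphism (cut_row v).
Proof. by move=> p q; rewrite /cut_row raddfB; apply/rowP => w; rewrite !mxE. Qed.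

HB.instance Definition _ v :=
  GRing.isZmodMorphism.Build {poly int} 'rV[int]_n.-1 (cut_row v)
    (cut_row_is_zmod_morphism v).

(** The deleted entry is determined by the others and the value at [1]. *)
Lemma cut_row_eq0 v p : (cut_row v p == 0) = (p - p.[1] *: 'X^v \in cyc_rel n).
Proof.
have foldX w : fold_row 'X^v 0 w = (v == w)%:Z by rewrite mxE ev_Xn residue_ord_eq.
have foldXZ a : fold_row (a *: 'X^v) = a *: fold_row 'X^v.
  by rewrite -[a in LHS]intz scaler_int raddfMz -scaler_int intz.
apply/eqP/idP => [/rowP p0 | pC].
  set q := p - _; have q_ne (w : 'I_n) : w != v -> ev (residue n w) q = 0.
    rewrite eq_sym => /unlift_some[i -> _]; have := p0 i; rewrite !mxE => pw.
    have := foldXZ p.[1] => /rowP/(_ (lift v i)); rewrite !mxE => XE.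
    rewrite (raddfB (ev _)) /= pw XE ev_Xn residue_ord_eq.
    by rewrite (negPf (neq_lift v i)) mulr0 subrr.
  apply: cyc_rel_residue => // u lt_un.
  have [uv | ne] := eqVneq (Ordinal lt_un) v; last exact: q_ne ne.
  have := cyc_rel1 (cyc_rel_fold q n_gt0); rewrite hornerD hornerN [q.[1]]aug_at1.
  rewrite horner_sum (bigD1 v) //= big1 => [|w /q_ne->]; last by rewrite mulr0z horner0.
  rewrite -[u]/(val (Ordinal lt_un)) uv addr0 sub0r => /eqP.
  rewrite oppr_eq0 -scaler_int hornerZ hornerXn expr1n mulr1 intz.
  by move/eqP.
have -> : p = (p - p.[1] *: 'X^v) + p.[1] *: 'X^v by rewrite subrK.
rewrite raddfD /=; apply/rowP => w; rewrite !mxE ev_residue0 // add0r.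
have /rowP/(_ (lift v w)) := foldXZ p.[1]; rewrite !mxE => ->.
by rewrite ev_Xn residue_ord_eq (negPf (neq_lift v w)) mulr0.
Qed.

Lemma cut_row_surj v y : exists p, cut_row v p = y.
Proof.
pose z : 'rV[int]_n := \row_w (if unlift v w is Some i then y ord0 i else 0).
have [p pE] := fold_row_surj z; exists p; rewrite /cut_row pE.
by apply/rowP => w; rewrite !mxE liftK.
Qed.

Lemma sandpile_rel (v : 'I_n) p : (mul_aug v p \in sand_rel n d) =
  (cut_row v p \in zspan [seq row i (row' v (col' v (laplacian (deBruijn n d))))
                          | i <- enum 'I_n.-1]).
Proof.
set s := [seq _ | i <- _].
have rowE i : row i (row' v (col' v (laplacian (deBruijn n d)))) =
    cut_row v (row_comb d 'X^(lift v i)).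
  rewrite /cut_row -laplacian_row; apply/rowP => w; by rewrite !mxE.
have spanP q : q \in zspan s <-> exists c, q = cut_row v (row_comb d c).
  apply: (@zspan_rows n _ (cut_row v) (row_comb d) _ v) => //.
  - move=> q' qC; apply/eqP; rewrite cut_row_eq0 (cyc_rel1 qC).
    by rewrite scale0r subr0.
  - exact: row_comb_cyc.
  - exact: row_comb_ones.
  - move=> u lt_un; rewrite -[u]/(val (Ordinal lt_un)) val_eqE eq_sym.
    move=> /unlift_some[i -> _]; apply/mapP; exists i; first by rewrite mem_enum.
    by rewrite rowE.
  by move=> _ /mapP[i _ ->]; exists (lift v i); rewrite rowE.
have relE c : (p - p.[1] *: 'X^v - row_comb d c \in cyc_rel n) =
    (cut_row v p == cut_row v (row_comb d c)).
  rewrite -subr_eq0 -(raddfB (cut_row v)) cut_row_eq0 hornerD hornerN.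
  by rewrite row_comb1 subr0 addrAC.
apply/idP/idP => [/mul_aug_rel[c] | /spanP[c /eqP]].
  by rewrite relE => /eqP pc; apply/spanP; exists c.
by rewrite -relE => pC; apply/mul_aug_rel; exists c.
Qed.

Let rows : seq 'rV[int]_n :=
  [seq row i (laplacian (deBruijn n d)) | i <- enum 'I_n].
Let frows : seq (augideal n) :=
  [seq AugIdeal (@fpoly_aug n d v) | v <- enum 'I_n & val v != 0%N].

Lemma zspan_laplacian y :
  y \in zspan rows <-> exists c, y = fold_row (row_comb d c).
Proof.
apply: (@zspan_rows n _ fold_row (row_comb d) _ 0) => //.
- by move=> p pC; apply/eqP; rewrite fold_row_eq0.
- exact: row_comb_cyc.
- exact: row_comb_ones.
- move=> v lt_vn _; apply/mapP; exists (Ordinal lt_vn); first by rewrite mem_enum.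
  by rewrite laplacian_row.
by move=> _ /mapP[v _ ->]; exists v; rewrite laplacian_row.
Qed.

Lemma fold_row_rel a : (fold_row (aug_rep a) \in zspan rows) = (a \in zspan frows).
Proof.
have relE c : (fold_row (aug_rep a) == fold_row (row_comb d c)) =
    (a == aug_poly (row_comb d c)).
  rewrite -subr_eq0 -raddfB fold_row_eq0 -{2}[a]aug_repK -subr_eq0 -raddfB.
  by rewrite aug_poly_eq0 hornerD hornerN aug_rep1 row_comb1 !subr0.
have augP := @zspan_aug_rows (row_comb d) _ a aug_poly_row
  (@row_comb_cyc n d) (row_comb_ones n d).
apply/idP/idP => [/zspan_laplacian[c /eqP] | /augP[c /eqP]].
  by rewrite relE => /eqP ac; apply/augP; exists c.
by rewrite -relE => /eqP ac; apply/zspan_laplacian; exists c.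
Qed.

(** The cokernel of the full Laplacian has one more summand [Z], generated by
    the vertex [0]. *)
Lemma laplacian_family (J : eqType) (l : seq J) a r :
  cyclic_family (zspan frows) (fun=> True) l a r ->
  cyclic_family (zspan rows) (fun=> True) (None :: map Some l)
    (fun o => if o is Some j then fold_row (aug_rep (a j)) else fold_row 1)
    (fun o => if o is Some j then r j else 0%N).
Proof.
case=> l_uniq _ aR indep gen.
have sumE (x : option J -> int) : \sum_(o <- None :: map Some l)
    (if o is Some j then fold_row (aug_rep (a j)) else fold_row 1) *~ x o =
    fold_row (x None)%:P
    + fold_row (aug_rep (\sum_(j <- l) a j *~ x (Some j))).
  rewrite big_cons big_map -[x None in RHS]intz rmorph_int raddfMz.
  congr (_ + _); rewrite !raddf_sum; apply: eq_bigr => j _.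
  by rewrite !raddfMz.
split=> //.
- rewrite /= map_inj_uniq ?l_uniq ?andbT; last by move=> ? ? [].
  by apply/mapP => -[].
- move=> [j|] jl; last by rewrite mulr0n rpred0.
  rewrite -!raddfMn fold_row_rel aR //.
  by move: jl; rewrite inE /= mem_map // => ? ? [].
- move=> x; rewrite sumE -raddfD => xR.
  have [c] := (zspan_laplacian _).1 xR => /eqP.
  rewrite -subr_eq0 -raddfB fold_row_eq0 => /cyc_rel1.
  rewrite hornerD hornerN hornerD hornerC aug_rep1 row_comb1 addr0 subr0 => x0.
  have x_dvd : forall j, j \in l -> ((r j)%:Z %| x (Some j))%Z.
    by apply: (indep (x \o Some)); rewrite -fold_row_rel; move: xR; rewrite x0 add0r.
  move=> [j|]; last by rewrite x0 dvdz0.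
  by rewrite inE /= mem_map => [|? ? []] //; apply: x_dvd.
move=> y _; have [p <-] := fold_row_surj y.
have [x xP] := gen (aug_poly p) I.
exists (fun o => if o is Some j then x j else p.[1]); rewrite sumE.
rewrite opprD addrA -!raddfB /=.
have pC : p - p.[1]%:P - aug_rep (aug_poly p) \in cyc_rel n.
  have : aug_poly (p - aug_rep (aug_poly p)) == 0.
    by rewrite raddfB subr_eq0 /= aug_repK.
  by rewrite aug_poly_eq0 hornerD hornerN aug_rep1 subr0 addrAC.
have -> : fold_row (p - p.[1]%:P - aug_rep (\sum_(j <- l) a j *~ x j)) =
    fold_row (aug_rep (aug_poly p - \sum_(j <- l) a j *~ x j)).
  apply/eqP; rewrite -subr_eq0 -raddfB fold_row_eq0.
  by rewrite [aug_rep (_ - _)]raddfB opprB addrA subrK.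
by rewrite fold_row_rel.
Qed.

End Augmentation.

(** * Assembling the decompositions *)

Section Decomposition.
Variables n d k : nat.
Local Notation m := (nquo n d k).
Variable V : {set 'I_m}.
Hypotheses (n_gt0 : (0 < n)%N) (d_gt0 : (0 < d)%N).
Hypothesis gk_eq1 : gcdn m d = 1%N.
Hypothesis k_min : forall i, (i < k)%N -> gcdn (nquo n d i) d <> 1%N.
Hypothesis V_reps :
  is_transversal V (nonzero_orbits m d) [set v | val v != 0%N].
Hypothesis V_prime_powers : forall (p j : nat) (v : 'I_m),
  prime p -> (p %| m)%N -> (0 < j)%N -> (p ^ j %| m)%N ->
  val v = (m %/ p ^ j)%N -> v \in V.

(** For [d = 1] the periodic orders are [0]; for [d > 1] all the orders are
    positive, which makes the groups of the graph finite up to the summand [Z] of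
    the full cokernel. *)
Lemma poly_families : exists (J : eqType) (l : seq J) b u r s,
  [/\ cyclic_family (sand_rel n d) (fun=> True) l b r,
      cyclic_family (sand_rel n d) (fun p => (n%:Z %| phi p)%Z) l u s,
      perm_eq [seq r j | j <- l] (sand_dune_moduli V),
      perm_eq [seq s j | j <- l] (sandpile_moduli V)
    & (1 < d)%N -> all (leq 1) (sandpile_moduli V)].
Proof.
have m_gt0 : (0 < m)%N by apply: nquo_gt0.
have md : coprime m d by apply/eqP.
have nM : (n %| m * d ^ k)%N by apply: nquo_dvd.
have perm_V := @perm_rep_order m d m_gt0 V V_prime_powers.
have tw0 := @per_tower m d k m_gt0 d_gt0 md V V_reps V_prime_powers.
have [J [b [r [c [lN [lP [tw rN kN rP kP]]]]]]] :=
  tower_exists n_gt0 d_gt0 nM k_min tw0.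
have [u uF] := tower_kernel n_gt0 nM tw.
have kmod : perm_eq [seq (r j %/ c j)%N | j <- lN ++ lP] (sandpile_moduli V).
  by rewrite map_cat kN kP perm_cat2l perm_map.
exists J, (lN ++ lP), b, u, r, (fun j => r j %/ c j)%N; split=> //.
- exact: tower_family tw.
- by rewrite map_cat rN rP perm_cat2l perm_map.
move=> d_gt1; rewrite -(perm_all _ kmod) all_map; apply/allP => j jl /=.
have cr : (c j %| r j)%N.
  move: jl; rewrite mem_cat => /orP[jN | jP].
    by have := triangular_dvd (tower_tri tw) jN.
  by have := triangular_dvd (tower_tri_per tw) jP.
have r_gt0 : (0 < r j)%N.
  move: jl; rewrite mem_cat => /orP[/(tower_order tw)[]// | jP].
  have : r j \in [seq r j | j <- lP] by apply: map_f.
  rewrite rP => /mapP[v _ ->]; rewrite /per_order subn_gt0 -{1}(expn0 d).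
  by rewrite ltn_exp2l // card_orb_gt0.
by rewrite divn_gt0 ?(dvdn_gt0 r_gt0 cr) // dvdn_leq.
Qed.

End Decomposition.

Local Close Scope ring_scope.

Theorem theorem3p1 (n d k : nat) (V : {set 'I_(nquo n d k)})
  (n_gt0 : 0 < n) (d_gt0 : 0 < d)
  (gk_eq1 : gcdn (nquo n d k) d = 1)
  (k_min : forall i : nat, i < k -> gcdn (nquo n d i) d <> 1)
  (V_reps : is_transversal V (nonzero_orbits (nquo n d k) d)
              [set v : 'I_(nquo n d k) | val v != 0])
  (V_prime_powers : forall (p j : nat) (v : 'I_(nquo n d k)),
     prime p -> p %| nquo n d k -> 0 < j -> p ^ j %| nquo n d k ->
     val v = nquo n d k %/ p ^ j -> v \in V) :
  [/\ zisog (sand_dune n d) (dsum_cyc (sand_dune_moduli V)),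
      zisog (Sgroup n d) (dsum_cyc (sandpile_moduli V))
    & 1 < d ->
      zisog (critical_group (deBruijn n d)) (dsum_cyc (sandpile_moduli V)) /\
      (forall v : 'I_n,
         zisog (sandpile_group (deBruijn n d) v) (dsum_cyc (sandpile_moduli V)))].
Proof.
have [J [l [b [u [r [s [bF uF rE sE s_gt0]]]]]]] :=
  poly_families n_gt0 d_gt0 gk_eq1 k_min V_reps V_prime_powers.
have [a aF] := cyclic_family_transport (mu := mul_aug 0) (nu := aug_poly n_gt0)
  (Sgroup_rel d n_gt0) (mul_aug_phi n 0) (mul_aug_surj d 0)
  (fun y => ex_intro _ _ (aug_repK n_gt0 y)) uF.
split.
- have rel0 (p : {poly int}) : (p - p)%R \in sand_rel n d.
    by rewrite GRing.subrr rpred0.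
  have [b' b'F] := cyclic_family_transport (mu := idfun) (nu := aug_poly n_gt0)
    (sand_dune_rel d n_gt0) (fun=> I)
    (fun p _ => ex_intro _ p (rel0 p))
    (fun y => ex_intro _ _ (aug_repK n_gt0 y)) bF.
  exact: cyclic_family_zquot b'F rE.
- exact: cyclic_family_zquot aF sE.
move=> d_gt1; have tors := dsum_cyc_torsion (s_gt0 d_gt1).
split=> [|v].
  apply: zisog_trans (torsion_cyc0 tors).
  apply: (@torsion_zisog _ (dsum_cyc (0 :: sandpile_moduli V))).
  apply: cyclic_family_zquot (laplacian_family n_gt0 aF) _.
  by rewrite /= -map_comp perm_cons.
have [b' b'F] := cyclic_family_transport (mu := mul_aug v)
  (nu := cut_row v) (sandpile_rel d n_gt0 v) (mul_aug_phi n v)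
  (mul_aug_surj d v) (cut_row_surj v) uF.
apply: zisog_trans (torsion_id tors); apply: torsion_zisog.
exact: cyclic_family_zquot b'F sE.
Qed.
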